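(* Let $q\ge 7$ be an odd prime power, $\Sigma_\infty$ a hyperplane of $\mathrm{PG}(4,q)$, and let $\mathcal C$ be a set of $q^2$ affine points together with a set of affine planes ($\mathcal C$-planes) satisfying: (A1) each $\mathcal C$-plane meets $\mathcal C$ in a $q$-arc, and every plane meeting $\mathcal C$ in more than four points is a $\mathcal C$-plane; (A2) any two distinct points of $\mathcal C$ lie in exactly one $\mathcal C$-plane; (A3) each affine point is either in $\mathcal C$, or on no $\mathcal C$-plane, or on exactly two $\mathcal C$-planes. Then the lines $t_A$, $A\in\mathcal C$, together with the line $t_\infty$, form a spread of $\Sigma_\infty$.
   Context: Affine points/lines/planes are those not contained in $\Sigma_\infty$. A $k$-arc is a set of $k$ points of a plane, no three collinear. For a $\mathcal C$-plane $\pi$, the $q$-arc $\pi\cap\mathcal C$ lies ($q$ odd) in a unique conic $(\pi\cap\mathcal C)\cup\{\pi_\infty\}$ of $\pi$; $\pi_\infty$ is the $\infty$-point of $\pi$, and an $\infty$-point is the $\infty$-point of some $\mathcal C$-plane. The $\mathcal C$-line of a $\mathcal C$-plane $\pi$ is $\pi\cap\Sigma_\infty$; a $0$-point is a point of $\Sigma_\infty$ on no $\mathcal C$-line. The set of all $\infty$-points and $0$-points is a line of $\Sigma_\infty$, denoted $t_\infty$. For $A\in\mathcal C$ and a $\mathcal C$-plane $\pi\ni A$, $A_\pi$ is the point where the tangent at $A$ in $\pi$ to the conic $(\pi\cap\mathcal C)\cup\{\pi_\infty\}$ meets $\Sigma_\infty$; $t_A$ is the set of the $q+1$ points $A_\pi$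 for the $q+1$ $\mathcal C$-planes $\pi$ through $A$, and $t_A$ is a line. A spread of $\Sigma_\infty\cong\mathrm{PG}(3,q)$ is a set of pairwise disjoint lines covering every point. *)

(* Defs.v *)
From HB Require Import structures.
From mathcomp Require Import all_boot all_order all_algebra.
Set Implicit Arguments.
Unset Strict Implicit.
Unset Printing Implicit Defensive.

Import GRing.Theory.
Local Open Scope ring_scope.

(* Over a finite field the subspaces form a finite type, so that sets of      *)
(* points, lines and planes can be handled with {set _} and boolean           *)
(* quantifiers.                                                               *)
Section FiniteSpaces.
Import VectorInternalTheory.
Variables (F : finFieldType) (V : vectType F).
HB.instance Definition _ := [Countable of {vspace V} by <:].
HB.instance Definition _ := [Finite of {vspace V} by <:].
End FiniteSpaces.

(* PG(n-1, q) is the lattice of subspaces of F^n with #|F| = q; geometric     *)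
(* objects are subspaces, of vector dimension one more than the projective    *)
(* dimension.                                                                 *)
Section ProjectiveGeometry.
Variables (F : finFieldType) (n : nat).
Implicit Types (U x l pi : {vspace 'rV[F]_n}) (S O : {set {vspace 'rV[F]_n}}).

Definition is_point U := \dim U == 1%N.
Definition is_line U := \dim U == 2.
Definition is_plane U := \dim U == 3.

Definition points U := [set x : {vspace 'rV[F]_n} | is_point x && (x <= U)%VS].

Definition is_arc (k : nat) pi S :=
  [&& S \subset points pi, #|S| == k &
      [forall l : {vspace 'rV[F]_n}, is_line l ==> (#|S :&: points l| <= 2)%N]].

Definition qform (M : 'M[F]_n) (v : 'rV[F]_n) : F := (v *m M *m v^T) 0 0.
Definition polar (M : 'M[F]_n) (u v : 'rV[F]_n) : F :=
  qform M (u + v) - qform M u - qform M v.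

Definition nonsingular_on (M : 'M[F]_n) U :=
  [forall v : 'rV[F]_n,
     [&& v \in U, qform M v == 0 &
         [forall u : 'rV[F]_n, (u \in U) ==> (polar M u v == 0)]] ==> (v == 0)].

Definition zeros_in (M : 'M[F]_n) U :=
  [set x in points U | [forall v : 'rV[F]_n, (v \in x) ==> (qform M v == 0)]].

(* Every quadratic form on the plane pi is the restriction of a form          *)
(* v |-> v M v^T on the whole space.                                          *)
Definition conic pi O :=
  is_plane pi &&
  [exists M : 'M[F]_n, nonsingular_on M pi && (O == zeros_in M pi)].

Definition tangent O pi x l :=
  [&& is_line l, (l <= pi)%VS & points l :&: O == [set x]].

(* A line is given here as the set of its points. *)
Definition line_set U S :=
  [exists l : {vspace 'rV[F]_n}, [&& is_line l, (l <= U)%VS & S == points l]].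

Definition spread U (T : {set {set {vspace 'rV[F]_n}}}) :=
  [/\ forall S, S \in T -> line_set U S,
      forall S S', S \in T -> S' \in T -> S != S' -> [disjoint S & S'] &
      forall x, x \in points U -> exists2 S, S \in T & x \in S].

End ProjectiveGeometry.

Section Configuration.
Variables (F : finFieldType) (n : nat).
Variables (Sigma : {vspace 'rV[F]_n}) (C CP : {set {vspace 'rV[F]_n}}).
Implicit Types (U x l pi A : {vspace 'rV[F]_n}).

Definition affine U := ~~ (U <= Sigma)%VS.

Definition planes_through x := [set pi in CP | (x <= pi)%VS].

(* y is the point pi_oo of the C-plane pi; as a nonsingular conic has q + 1   *)
(* points, y is not in C when pi meets C in q points.                         *)
Definition is_pi_infty pi y :=
  (y \in points pi) && conic pi (y |: (points pi :&: C)).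

Definition infty_point y := [exists pi in CP, is_pi_infty pi y].

Definition zero_point x :=
  (x \in points Sigma) && [forall pi in CP, ~~ (x <= pi :&: Sigma)%VS].

Definition t_infty := [set x | infty_point x || zero_point x].

(* x is the point A_pi. *)
Definition is_tangent_point A pi x :=
  [exists y, exists l, [&& is_pi_infty pi y,
     tangent (y |: (points pi :&: C)) pi A l & x == (l :&: Sigma)%VS]].

Definition t_at A :=
  [set x | [exists pi in planes_through A, is_tangent_point A pi x]].

End Configuration.

(* Main.v *)
Require Import Defs.
From mathcomp Require Import all_boot all_order all_algebra.
From mathcomp Require Import fingroup finalg cyclic finfield zify ring.
Set Implicit Arguments.
Unset Strict Implicit.
Unset Printing Implicit Defensive.
Import GRing.Theory.

(* The points of C and the C-planes form an affine plane of order q. Counting the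
   affine points of a C-plane outside C, each of which is on exactly one other
   C-plane, shows that disjoint C-planes only meet at infinity and that the
   C-planes meeting a given C-plane pi in a line cut it in q parallel lines, one
   through each point of C in pi; their common infinite point is the infinite
   point of pi. A parity argument shows that parallel C-planes have the same
   infinite point N, so that each such N belongs to two parallel classes.
   Projection from N maps these classes to the two families of lines of a
   hyperbolic paraboloid, which gives coordinates in which C is
   {(x, y, xy, h(x, y))}. The remaining C-planes project to plane sections of the
   paraboloid, that is to the lines of slope other than 0 and infinity of the
   (x, y)-plane, and h is quadratic on each of these lines, hence is a quadratic
   polynomial. Thus C is the graph of a quadratic map Q from F^2 to F^2.
   By (A3) a direction cannot be the only one with its infinite point, and this
   forces the polar form B of Q to satisfy B(u, v) <> 0 for all nonzero u, v.
   Now t_oo is the line x = y = 0 at infinity and t_A, for A above u, consists of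
   the points (v, B(u, v)); these lines partition the points at infinity since
   B(., v) is bijective for v <> 0. *)

Local Open Scope ring_scope.

(** * Counting, functionals, affine points *)

(** (A3) constrains affine points only, so infinite points have to be caught by affine counting: the
    infinite point of a C-plane first appears as the common direction of the lines that other
    C-planes cut on it, and is recognised as the point completing the conic only once coordinates
    exist. There the q-arcs are parabolas; a quadratic form restricted to a parabola is a quartic in
    the parameter, and more than four zeros force it to vanish at the infinite point too. The final
    nondegeneracy comes from a repeated root: B(u, v) = 0 makes a combination of the two components
    of Q a multiple of the square of a linear form vanishing at v, so Q(v) determines v up to a
    scalar, and an affine point off C on the line from a point of C towards Q(v) would lie on just
    one C-plane. Oddness of q serves the parity argument and the halvings; the bound on q leaves
    room in several counts, such as 2(q - 1) > q + 1 for lines through a point of a plane. *)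

Lemma sum_card_swap (I T : finType) (A : {set I}) (B : {set T})
    (r : I -> T -> bool) :
  (\sum_(i in A) #|[set x in B | r i x]| =
   \sum_(x in B) #|[set i in A | r i x]|)%N.
Proof.
under eq_bigr do rewrite -sum1_card.
under [RHS]eq_bigr do rewrite -sum1_card.
rewrite (exchange_big_dep (mem B)) /=; last by move=> i x _; rewrite inE => /andP[].
apply: eq_bigr => x xB; apply: eq_bigl => i; rewrite !inE xB.
by case: (i \in A).
Qed.

Lemma card_gt_notin (T : finType) (A B : {set T}) :
  (#|B| < #|A|)%N -> exists2 x, x \in A & x \notin B.
Proof.
move=> ltBA; case: (set_0Vmem (A :\: B)) => [/eqP|[x]].
  by rewrite setD_eq0 => /subset_leq_card; rewrite leqNgt ltBA.
by rewrite inE => /andP[xB xA]; exists x.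
Qed.

Section Vectors.
Variables (F : finFieldType) (n : nat).
Implicit Types (u v w : 'rV[F]_n) (U W : {vspace 'rV[F]_n}) (c : 'cV[F]_n).

Definition dot v c : F := (v *m c) 0 0.

Lemma dotD u v c : dot (u + v) c = dot u c + dot v c.
Proof. by rewrite /dot mulmxDl mxE. Qed.

Lemma dotZ a v c : dot (a *: v) c = a * dot v c.
Proof. by rewrite /dot -scalemxAl mxE. Qed.

Lemma dotN v c : dot (- v) c = - dot v c.
Proof. by rewrite -scaleN1r dotZ mulN1r. Qed.

Lemma dot0 c : dot 0 c = 0.
Proof. by rewrite -[0](scale0r 0) dotZ mul0r. Qed.

Definition dotE := (dotD, dotN, dotZ, dot0).

Lemma mem_span2P u v w :
  reflect (exists s t, w = s *: u + t *: v) (w \in (<[u]> + <[v]>)%VS).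
Proof.
apply: (iffP memv_addP) => [[_ /vlineP[s ->] [_ /vlineP[t ->] ->]]|[s [t ->]]].
  by exists s, t.
by exists (s *: u); rewrite ?memvZ ?memv_line //; exists (t *: v); rewrite ?memvZ ?memv_line.
Qed.

Lemma mem_span3P u v w x :
  reflect (exists s t k, x = s *: u + t *: v + k *: w)
          (x \in (<[u]> + <[v]> + <[w]>)%VS).
Proof.
apply: (iffP memv_addP) => [[_ /mem_span2P[s [t ->]] [_ /vlineP[k ->] ->]]|[s [t [k ->]]]].
  by exists s, t, k.
exists (s *: u + t *: v); first by apply/mem_span2P; exists s, t.
by exists (k *: w); rewrite ?memvZ ?memv_line.
Qed.

(** Project onto a complement along [U]; some coordinate of the image of [v] is nonzero, and [c] is
    that coordinate, rescaled. *)
Lemma separating_functional U v : v \notin U ->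
  exists2 c, dot v c = 1 & forall u, u \in U -> dot u c = 0.
Proof.
move=> vU; pose f := daddv_pi (U^C) U.
have dCU : (U^C :&: U = 0)%VS by rewrite capvC capv_compl.
have fD u : f u + daddv_pi U (U^C) u = u.
  by apply: daddv_pi_add => //; rewrite addvC addv_complf memvf.
have fU u : u \in U -> f u = 0.
  move=> uU; apply: (addIr u); rewrite add0r -[in RHS](fD u).
  by congr (_ + _); apply/esym/daddv_pi_id => //; apply: capv_compl.
have fv : f v != 0.
  apply: contra vU => /eqP fv0; rewrite -(fD v) fv0 add0r.
  exact: memv_pi.
have [i fvi] : exists i, f v 0 i != 0.
  apply/existsP; apply: contraR fv; rewrite negb_exists => /forallP fv0.
  by apply/eqP/rowP=> i; rewrite mxE; apply/eqP; have := fv0 i; rewrite negbK.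
pose c : 'cV[F]_n := \col_j (f (delta_mx 0 j) 0 i / f v 0 i).
have cE u : dot u c = f u 0 i / f v 0 i.
  rewrite /dot mxE [in RHS](row_sum_delta u) linear_sum summxE mulr_suml.
  by apply: eq_bigr => j _; rewrite linearZ !mxE mulrA.
by exists c => [|u uU]; rewrite cE ?divff // fU // mxE mul0r.
Qed.

End Vectors.

Lemma sum_leq1_card (T : finType) (A : {set T}) (f : T -> nat) :
  (forall x, x \in A -> f x <= 1)%N ->
  (\sum_(x in A) f x = #|[set x in A | f x != 0%N]|)%N.
Proof.
move=> f1; rewrite -sum1_card [RHS](eq_bigl (fun x => (x \in A) && (f x != 0%N))).
  rewrite big_mkcondr; apply: eq_bigr => x /f1.
  by case: (f x) => [|[]].
by move=> x; rewrite inE.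
Qed.

(** Five spanning vectors are the rows of an invertible matrix; the columns of its inverse are the
    dual basis. *)
Lemma coordinates5 (F : finFieldType) (v0 v1 v2 v3 v4 : 'rV[F]_5) :
  (forall v, exists a b c d e,
     v = a *: v0 + b *: v1 + c *: v2 + d *: v3 + e *: v4) ->
  exists k0 k1 k2 k3 k4, forall a b c d e,
    let v := a *: v0 + b *: v1 + c *: v2 + d *: v3 + e *: v4 in
    [/\ dot v k0 = a, dot v k1 = b, dot v k2 = c, dot v k3 = d & dot v k4 = e].
Proof.
move=> span_v; pose nz := nth (0 : 'rV[F]_5) [:: v0; v1; v2; v3; v4].
pose P : 'M[F]_5 := \matrix_i nz i.
pose r (a b c d e : F) : 'rV[F]_5 := \row_i nth 0 [:: a; b; c; d; e] i.
have rP a b c d e : r a b c d e *m P =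
    a *: v0 + b *: v1 + c *: v2 + d *: v3 + e *: v4.
  rewrite mulmx_sum_row !big_ord_recl big_ord0 !rowK !mxE /= /nz /=.
  by rewrite addr0 !addrA.
have uP : P \in unitmx.
  rewrite -row_full_unit -sub1mx; apply/row_subP => i; apply/submxP.
  have [a [b [c [d [e ->]]]]] := span_v (row i 1%:M).
  by exists (r a b c d e); rewrite rP.
have dotP a b c d e i : dot (r a b c d e *m P) (col i (invmx P)) =
    nth 0 [:: a; b; c; d; e] i.
  by rewrite /dot colE !mulmxA mulmxK // -colE !mxE.
exists (col 0 (invmx P)), (col (inord 1) (invmx P)), (col (inord 2) (invmx P)).
exists (col (inord 3) (invmx P)), (col (inord 4) (invmx P)) => a b c d e /=.
by rewrite -rP !dotP /= ?inordK.
Qed.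

Lemma spanning5_inj (F : finFieldType) (v0 v1 v2 v3 v4 : 'rV[F]_5) :
  (forall v, exists a b c d e,
     v = a *: v0 + b *: v1 + c *: v2 + d *: v3 + e *: v4) ->
  forall a b c d e a' b' c' d' e',
  a *: v0 + b *: v1 + c *: v2 + d *: v3 + e *: v4 =
  a' *: v0 + b' *: v1 + c' *: v2 + d' *: v3 + e' *: v4 ->
  [/\ a = a', b = b', c = c', d = d' & e = e'].
Proof.
move=> /coordinates5[k0 [k1 [k2 [k3 [k4 h]]]]] a b c d e a' b' c' d' e' E.
have := h a' b' c' d' e'; have := h a b c d e; rewrite /= E.
move=> [h0 h1 h2 h3 h4] [h0' h1' h2' h3' h4'].
by split; [exact: etrans (esym h0) h0' | exact: etrans (esym h1) h1'
  | exact: etrans (esym h2) h2' | exact: etrans (esym h3) h3'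
  | exact: etrans (esym h4) h4'].
Qed.

Section Affine.
Variables (F : finFieldType) (Sigma : {vspace 'rV[F]_5}) (lam : 'cV[F]_5).
Hypothesis dim_Sigma : \dim Sigma = 4%N.
Hypothesis SigmaE : forall v, (v \in Sigma) = (dot v lam == 0).
Implicit Types (v w : 'rV[F]_5) (U : {vspace 'rV[F]_5}).

Definition aff U := [set v | (v \in U) && (dot v lam == 1)].

Lemma affP U v : reflect (v \in U /\ dot v lam = 1) (v \in aff U).
Proof. by rewrite inE; apply: (iffP andP) => [[? /eqP]|[? ->]]. Qed.

Lemma dim_cap_Sigma U v : v \in aff U -> (\dim (U :&: Sigma)).+1 = \dim U.
Proof.
case/affP=> vU v1; have := dimv_sum_cap U Sigma.
suff -> : \dim (U + Sigma) = 5%N by rewrite dim_Sigma; lia.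
apply/eqP; rewrite eqn_leq.
have -> : (\dim (U + Sigma) <= 5)%N by rewrite (leq_trans (dimvS (subvf _))) // dimvf.
rewrite ltnNge; apply/negP => le_dim.
have /eqP eS : Sigma == (U + Sigma)%VS by rewrite eqEdim addvSr dim_Sigma.
have : v \in Sigma by rewrite eS (subvP (addvSl _ _)).
by rewrite SigmaE v1 oner_eq0.
Qed.

(** The normalised generators in [U] form a translate of [U :&: Sigma], which has codimension one in
    [U]. *)
Lemma card_aff U v : v \in aff U -> #|aff U| = (#|F| ^ (\dim U).-1)%N.
Proof.
move=> vU; rewrite -(dim_cap_Sigma vU) -pred_Sn -card_vspace.
have [vU1 v1] := affP _ _ vU.
rewrite -[RHS](card_imset _ (addrI v)); apply: eq_card => w.
apply/affP/imsetP => [[wU w1]|[x]]; last first.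
  rewrite memv_cap => /andP[xU]; rewrite SigmaE => /eqP x0 ->.
  by rewrite memvD // dotD v1 x0 addr0.
exists (w - v); last by rewrite addrC subrK.
by rewrite memv_cap memvB //= SigmaE dotD dotN w1 v1 subrr.
Qed.

Lemma affS U W : (U <= W)%VS -> aff U \subset aff W.
Proof.
by move=> /subvP sUW; apply/subsetP => v /affP[/sUW vW v1]; apply/affP.
Qed.

End Affine.

(** * The affine plane formed by the C-planes *)

Definition block (F : finFieldType) (D : {set 'rV[F]_5})
  (U : {vspace 'rV[F]_5}) := [set a in D | a \in U].

(* An affine point is represented by its generator [v] with [dot v lam = 1], where
   [lam] is a linear form with kernel [Sigma]; [D] is the set of the generators
   of the points of C, and [P] is the set of C-planes. *)
Record configuration (F : finFieldType) (q : nat) (Sigma : {vspace 'rV[F]_5})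
    (lam : 'cV[F]_5) (D : {set 'rV[F]_5}) (P : {set {vspace 'rV[F]_5}}) : Prop :=
  Configuration {
  cfg_card_F : #|F| = q;
  cfg_odd : odd q;
  cfg_ge7 : (7 <= q)%N;
  cfg_dim_Sigma : \dim Sigma = 4%N;
  cfg_SigmaE : forall v, (v \in Sigma) = (dot v lam == 0);
  cfg_D1 : forall a, a \in D -> dot a lam = 1;
  cfg_card_D : #|D| = (q ^ 2)%N;
  cfg_dimP : forall pi, pi \in P -> \dim pi = 3%N;
  cfg_card_block : forall pi, pi \in P -> #|block D pi| = q;
  cfg_arc : forall a b c, a \in D -> b \in D -> c \in D -> a != b -> c != a ->
    c != b -> c \notin (<[a]> + <[b]>)%VS;
  cfg_plane : forall U : {vspace 'rV[F]_5},
    \dim U = 3%N -> (4 < #|block D U|)%N -> U \in P;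
  cfg_join : forall a b, a \in D -> b \in D -> a != b ->
    exists pi, [/\ pi \in P, a \in pi & b \in pi];
  cfg_join_uniq : forall a b pi pi', a \in D -> b \in D -> a != b ->
    pi \in P -> pi' \in P -> a \in pi -> b \in pi -> a \in pi' -> b \in pi' ->
    pi = pi';
  cfg_two : forall v pi, dot v lam = 1 -> v \notin D -> pi \in P -> v \in pi ->
    #|[set pi' in P | v \in pi']| = 2%N }.

Section Incidence.
Variables (F : finFieldType) (q : nat) (Sigma : {vspace 'rV[F]_5}).
Variables (lam : 'cV[F]_5) (D : {set 'rV[F]_5}) (P : {set {vspace 'rV[F]_5}}).
Hypothesis cfg : configuration q Sigma lam D P.
Implicit Types (a b v w : 'rV[F]_5) (pi rho U : {vspace 'rV[F]_5}).

Let q7 : (7 <= q)%N. Proof. exact: cfg_ge7 cfg. Qed.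
Notation blk := (block D).
Notation affl := (aff lam).

Lemma blkP a pi : reflect (a \in D /\ a \in pi) (a \in blk pi).
Proof. by rewrite inE; apply: andP. Qed.

Lemma card_join a b : a \in D -> b \in D -> a != b ->
  #|[set pi in P | (a \in pi) && (b \in pi)]| = 1%N.
Proof.
move=> aD bD ab; have [pi [piP api bpi]] := cfg_join cfg aD bD ab.
apply/eqP/cards1P; exists pi; apply/setP => rho; rewrite !inE.
apply/idP/eqP => [/and3P[rP ar br]|->]; last by rewrite piP api bpi.
exact: (cfg_join_uniq cfg aD bD ab).
Qed.

(** Each of the q^2 - 1 other points of C is joined to [a] by one plane, and each plane through [a]
    carries q - 1 of them. *)
Lemma card_planes_at a : a \in D -> #|[set pi in P | a \in pi]| = q.+1.
Proof.
move=> aD; have := sum_card_swap [set pi in P | a \in pi] (D :\ a)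
  (fun pi b => b \in pi).
rewrite (eq_bigr (fun=> q.-1)); last first.
  move=> pi; rewrite inE => /andP[piP api].
  have := cardsD1 a (blk pi); rewrite (cfg_card_block cfg piP) inE aD api add1n.
  move=> ->; rewrite -pred_Sn; apply: eq_card => b; rewrite !inE.
  by rewrite andbA.
rewrite [RHS](eq_bigr (fun=> 1%N)); last first.
  move=> b; rewrite !inE => /andP[ba bD]; rewrite eq_sym in ba.
  apply: etrans (card_join aD bD ba); apply: eq_card => pi; rewrite !inE.
  by rewrite andbA.
rewrite !sum_nat_const muln1.
have := cardsD1 a D; rewrite aD (cfg_card_D cfg) add1n => cD.
have [k qk] : exists k, q = k.+1 by exists q.-1; lia.
have -> : #|D :\ a| = (q.+1 * q.-1)%N by move: cD; rewrite qk -mulnn; set x := #|_|; lia.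
by move=> /eqP; rewrite eqn_pmul2r ?(eqP _) => [/eqP|]; lia.
Qed.

Lemma card_P : #|P| = (q ^ 2 + q)%N.
Proof.
have := sum_card_swap P D (fun pi b => b \in pi).
rewrite (eq_bigr (fun=> q)); last by move=> pi /(cfg_card_block cfg).
rewrite [RHS](eq_bigr (fun=> q.+1)) => [|a /card_planes_at //].
rewrite !sum_nat_const (cfg_card_D cfg) => eq1.
have : (#|P| * q == (q ^ 2 + q) * q)%N by rewrite eq1; lia.
by rewrite eqn_pmul2r; [move/eqP | lia].
Qed.

Lemma blkI_le1 pi rho : pi \in P -> rho \in P -> pi != rho ->
  (#|blk pi :&: blk rho| <= 1)%N.
Proof.
move=> piP rP; apply: contraR; rewrite -ltnNge => /card_gt1P[a [b []]].
rewrite !inE => /andP[/andP[aD api] /andP[_ ar]] /andP[/andP[bD bpi] /andP[_ br]] ab.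
by apply/eqP/(cfg_join_uniq cfg aD bD ab).
Qed.

Lemma blkI_uniq pi rho a b : pi \in P -> rho \in P -> pi != rho ->
  a \in D -> b \in D -> a \in pi -> a \in rho -> b \in pi -> b \in rho -> a = b.
Proof.
move=> piP rP npr aD bD api ar bpi br; apply/eqP; apply: contraR npr => ab.
by apply/eqP/(cfg_join_uniq cfg aD bD ab).
Qed.

Definition parallel pi rho := (pi == rho) || [disjoint blk pi & blk rho].

Lemma par_refl pi : parallel pi pi. Proof. by rewrite /parallel eqxx. Qed.

Lemma par_sym pi rho : parallel pi rho = parallel rho pi.
Proof. by rewrite /parallel eq_sym disjoint_sym. Qed.

Lemma parPn pi rho : pi \in P -> rho \in P ->
  reflect (pi != rho /\ exists a, [/\ a \in D, a \in pi & a \in rho]) (~~ parallel pi rho).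
Proof.
move=> piP rP; rewrite negb_or; apply: (iffP andP) => [[npr]|[npr [a [aD api ar]]]].
  rewrite -setI_eq0 => /set0Pn[a]; rewrite !inE => /andP[/andP[? ?] /andP[_ ?]].
  by split=> //; exists a.
by split=> //; rewrite -setI_eq0; apply/set0Pn; exists a; rewrite !inE aD api ar.
Qed.

(** Of the q + 1 planes through [a], exactly q join [a] to the q points of C in [pi]; one is left
    over. *)
Lemma playfair pi a : pi \in P -> a \in D -> a \notin pi ->
  #|[set rho in P | (a \in rho) && [disjoint blk pi & blk rho]]| = 1%N.
Proof.
move=> piP aD api; have := sum_card_swap [set rho in P | a \in rho] (blk pi)
  (fun rho b => b \in rho).
rewrite [X in _ = X](eq_bigr (fun=> 1%N)); last first.
  move=> b /blkP[bD bpi].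
  have ab : a != b by apply: contraNneq api => ->.
  apply: etrans (card_join aD bD ab); apply: eq_card => rho; rewrite !inE.
  by rewrite andbA.
have blkI rho : [set b in blk pi | b \in rho] = blk pi :&: blk rho.
  by apply/setP => b; rewrite !inE; case: (b \in D).
rewrite sum1_card (cfg_card_block cfg piP) sum_leq1_card; last first.
  move=> rho; rewrite inE blkI => /andP[rP ar].
  by apply: blkI_le1 => //; apply: contraNneq api => ->.
move=> cq; have := cardsID [set rho | blk pi :&: blk rho == set0] [set rho in P | a \in rho].
rewrite (card_planes_at aD).
have -> : [set rho in P | a \in rho] :\: [set rho | blk pi :&: blk rho == set0]
   = [set x in [set rho in P | a \in rho] | #|[set b in blk pi | b \in x]| != 0%N].
  by apply/setP => rho; rewrite !inE blkI cards_eq0 andbC.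
rewrite cq => c1; transitivity (q.+1 - q)%N; last lia.
by rewrite -c1 addnK; apply: eq_card => rho; rewrite !inE -setI_eq0 -andbA.
Qed.

Lemma playfair_ex pi a : pi \in P -> a \in D ->
  exists rho, [/\ rho \in P, a \in rho & parallel pi rho].
Proof.
move=> piP aD; have [api|api] := boolP (a \in pi).
  by exists pi; rewrite par_refl.
have /eqP/cards1P[rho /setP/(_ rho)] := playfair piP aD api.
by rewrite !inE eqxx => /and3P[rP ar dpr]; exists rho; rewrite /parallel dpr orbT.
Qed.

Lemma playfair_uniq pi a rho rho' : pi \in P -> a \in D -> rho \in P ->
  rho' \in P -> a \in rho -> a \in rho' -> parallel pi rho -> parallel pi rho' ->
  rho = rho'.
Proof.
move=> piP aD rP rP' ar ar'; have [api|api] := boolP (a \in pi).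
  have E (x : {vspace _}) : x \in P -> a \in x -> parallel pi x -> x = pi.
    move=> xP ax; rewrite /parallel => /orP[/eqP//|/pred0P/(_ a)].
    by rewrite !inE aD api ax.
  by move=> /E-> // /E->.
have N (x : {vspace _}) : a \in x -> parallel pi x -> [disjoint blk pi & blk x].
  by move=> ax /orP[/eqP epx|//]; rewrite epx ax in api.
move=> /(N _ ar) d1 /(N _ ar') d2.
have /eqP/cards1P[x /setP ex] := playfair piP aD api.
have := ex rho; have := ex rho'; rewrite !inE rP rP' ar ar' d1 d2 /=.
by move=> /esym/eqP-> /esym/eqP->.
Qed.

Lemma par_trans pi rho tau : pi \in P -> rho \in P -> tau \in P ->
  parallel pi rho -> parallel pi tau -> parallel rho tau.
Proof.
move=> piP rP tP pr pt; apply: contraT => /(parPn rP tP)[/eqP nrt [a [aD ar at_]]].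
by case: nrt; apply: (playfair_uniq piP aD).
Qed.

(** Each of the q points of C in [pi] is on q further planes, and no plane is counted twice since
    two planes share at most one point of C. *)
Lemma card_meet pi : pi \in P ->
  #|[set rho in P | (rho != pi) && ~~ [disjoint blk pi & blk rho]]| = (q ^ 2)%N.
Proof.
move=> piP; have := sum_card_swap (P :\ pi) (blk pi) (fun rho b => b \in rho).
rewrite [X in _ = X](eq_bigr (fun=> q)); last first.
  move=> b /blkP[bD bpi].
  have := cardsD1 pi [set x in P | b \in x]; rewrite card_planes_at // inE piP bpi.
  move=> /eqP; rewrite add1n eqSS => /eqP ->.
  by apply: eq_card => rho; rewrite !inE andbA.
have blkI rho : [set b in blk pi | b \in rho] = blk pi :&: blk rho.
  by apply/setP => b; rewrite !inE; case: (b \in D).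
rewrite sum_nat_const (cfg_card_block cfg piP) sum_leq1_card; last first.
  by move=> rho; rewrite !inE blkI => /andP[rP ar]; apply: blkI_le1; rewrite // eq_sym.
rewrite -mulnn => <-; apply: eq_card => rho.
by rewrite !inE blkI -setI_eq0 cards_eq0 andbA [(rho != pi) && _]andbC.
Qed.

Lemma card_disjoint pi : pi \in P ->
  #|[set rho in P | (rho != pi) && [disjoint blk pi & blk rho]]| = q.-1.
Proof.
move=> piP; have := cardsID [set rho | [disjoint blk pi & blk rho]] (P :\ pi).
have := cardsD1 pi P; rewrite piP card_P add1n => cP.
have -> : (P :\ pi) :\: [set rho | [disjoint blk pi & blk rho]] =
  [set rho in P | (rho != pi) && ~~ [disjoint blk pi & blk rho]].
  by apply/setP => rho; rewrite !inE andbC [(rho != pi) && _]andbC andbA.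
have -> : (P :\ pi) :&: [set rho | [disjoint blk pi & blk rho]] =
  [set rho in P | (rho != pi) && [disjoint blk pi & blk rho]].
  by apply/setP => rho; rewrite !inE [(rho != pi) && _]andbC andbA.
rewrite card_meet // addnC => e; rewrite -e in cP.
by move: cP => /eqP; rewrite -addnS eqn_add2l => /eqP ->.
Qed.

Lemma card_class pi : pi \in P -> #|[set rho in P | parallel pi rho]| = q.
Proof.
move=> piP; have := cardsD1 pi [set rho in P | parallel pi rho].
rewrite inE piP par_refl => ->.
rewrite (_ : _ :\ _ = [set rho in P | (rho != pi) && [disjoint blk pi & blk rho]]).
  by rewrite card_disjoint //=; lia.
apply/setP => rho; rewrite !inE /parallel eq_sym.
by case: (pi == rho) => //=; rewrite andbF.
Qed.

End Incidence.

(** * C-planes that meet in an affine line *)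

Section Linked.
Variables (F : finFieldType) (q : nat) (Sigma : {vspace 'rV[F]_5}).
Variables (lam : 'cV[F]_5) (D : {set 'rV[F]_5}) (P : {set {vspace 'rV[F]_5}}).
Hypothesis cfg : configuration q Sigma lam D P.
Implicit Types (a b v w : 'rV[F]_5) (pi rho U : {vspace 'rV[F]_5}).

Notation blk := (block D).
Notation affl := (aff lam).

Let affP := affP lam.
Lemma q_gt0 : (0 < q)%N. Proof. by have := cfg_ge7 cfg; lia. Qed.

Lemma card_affl U v : v \in affl U -> #|affl U| = (q ^ (\dim U).-1)%N.
Proof.
move=> vU; rewrite -(cfg_card_F cfg).
exact: (card_aff (cfg_dim_Sigma cfg) (cfg_SigmaE cfg) vU).
Qed.

Lemma blk_aff pi : blk pi \subset affl pi.
Proof.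
apply/subsetP => a /blkP[aD api]; apply/affP; split=> //.
exact: cfg_D1 cfg _ aD.
Qed.

Lemma blk_neq0 pi : pi \in P -> exists a, a \in blk pi.
Proof.
by move=> piP; apply/set0Pn; rewrite -card_gt0 (cfg_card_block cfg piP) q_gt0.
Qed.

Lemma card_aff_plane pi : pi \in P -> #|affl pi| = (q ^ 2)%N.
Proof.
move=> piP; have [a /(subsetP (blk_aff pi)) api] := blk_neq0 piP.
by rewrite (card_affl api) (cfg_dimP cfg piP).
Qed.

Lemma dim_capP pi rho : pi \in P -> rho \in P -> pi != rho ->
  (0 < \dim (pi :&: rho) < 3)%N.
Proof.
move=> piP rP npr; have := dimv_sum_cap pi rho.
rewrite (cfg_dimP cfg piP) (cfg_dimP cfg rP) => d6.
have d5 : (\dim (pi + rho) <= 5)%N by rewrite (leq_trans (dimvS (subvf _))) // dimvf.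
have d3 : (\dim (pi :&: rho) < 3)%N; last lia.
rewrite ltnNge; apply: contra npr => d3.
have /eqP e1 : (pi :&: rho)%VS == pi by rewrite eqEdim capvSl (cfg_dimP cfg piP).
have /eqP e2 : (pi :&: rho)%VS == rho by rewrite eqEdim capvSr (cfg_dimP cfg rP).
by rewrite -e1 e2.
Qed.

Lemma card_aff_cap pi rho : pi \in P -> rho \in P -> pi != rho ->
  affl (pi :&: rho) != set0 ->
  #|affl (pi :&: rho)| = if \dim (pi :&: rho) == 2%N then q else 1%N.
Proof.
move=> piP rP npr /set0Pn[v /card_affl->].
by have := dim_capP piP rP npr; case: (\dim _) => [|[|[|]]].
Qed.

Lemma third_plane v pi rho tau : dot v lam = 1 -> v \notin D ->
  pi \in P -> rho \in P -> tau \in P -> v \in pi -> v \in rho -> v \in tau ->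
  pi != rho -> tau = pi \/ tau = rho.
Proof.
move=> v1 vD piP rP tP vpi vr vt npr.
have : (#|[set pi; rho; tau]| <= #|[set x in P | v \in x]|)%N.
  apply: subset_leq_card.
  by apply/subsetP => x; rewrite !inE => /orP[/orP[]|] /eqP->; apply/andP.
rewrite (cfg_two cfg v1 vD piP vpi) setUC cardsU1 cards2 npr !inE; case: eqP => [->|_]; first by left.
by case: eqP => [->|//]; right.
Qed.

(** Two C-planes with a common affine line: a single common affine point, or a common line inside
    [Sigma], would give one or no common affine point instead of [q]. *)
Definition linked pi rho :=
  [&& pi \in P, rho \in P, pi != rho & #|affl (pi :&: rho)| == q].

Lemma linked_sym pi rho : linked pi rho = linked rho pi.
Proof.
rewrite /linked capvC eq_sym.
by case: (pi \in P); case: (rho \in P); rewrite ?andbF.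
Qed.

Lemma linkedP pi rho : linked pi rho ->
  [/\ pi \in P, rho \in P, pi != rho, \dim (pi :&: rho) = 2%N &
      exists v, v \in affl (pi :&: rho)].
Proof.
move=> /and4P[piP rP npr /eqP eq_q].
have n0 : affl (pi :&: rho) != set0.
  by rewrite -card_gt0 eq_q; exact: q_gt0.
split=> //; last exact/set0Pn.
have := card_aff_cap piP rP npr n0; rewrite eq_q.
by have := cfg_ge7 cfg; case: eqP => // _ ? ?; lia.
Qed.

Lemma linkedI pi rho v : pi \in P -> rho \in P -> pi != rho ->
  v \in affl (pi :&: rho) -> (1 < \dim (pi :&: rho))%N -> linked pi rho.
Proof.
move=> piP rP npr vpr d2; rewrite /linked piP rP npr /= card_aff_cap //.
  by have := dim_capP piP rP npr; case: (\dim _) d2 => [|[|[|]]].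
by apply/set0Pn; exists v.
Qed.

Lemma linked_blk_uniq pi rho a b : linked pi rho -> a \in D -> b \in D ->
  a \in (pi :&: rho)%VS -> b \in (pi :&: rho)%VS -> a = b.
Proof.
move=> /linkedP[piP rP npr _ _] aD bD; rewrite !memv_cap => /andP[? ?] /andP[? ?].
exact: (blkI_uniq cfg piP rP npr aD bD).
Qed.

(** Incidences of affine points of [pi] with other planes: each of the q points of C is on q of
    them, and by (A3) each of the remaining q^2 - q points is on exactly one. *)
Lemma sum_card_cap pi : pi \in P ->
  (\sum_(rho in P :\ pi) #|affl (pi :&: rho)| = q * q + (q * q - q))%N.
Proof.
move=> piP; have := sum_card_swap (P :\ pi) (affl pi) (fun rho b => b \in rho).
rewrite (eq_bigr (fun rho => #|affl (pi :&: rho)|)); last first.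
  move=> rho _; apply: eq_card => b; rewrite !inE memv_cap.
  by case: (dot b lam == 1); rewrite ?andbF ?andbT.
have D1 v : v \in affl pi -> #|[set rho in P :\ pi | v \in rho]|.+1 = 
   #|[set rho in P | v \in rho]|.
  case/affP=> vpi _; rewrite [RHS](cardsD1 pi) inE piP vpi add1n; congr _.+1.
  by apply: eq_card => rho; rewrite !inE andbA.
move=> ->; rewrite (big_setID (blk pi)) /=; congr (_ + _)%N.
  rewrite (setIidPr (blk_aff pi)) (eq_bigr (fun=> q)).
    by rewrite sum_nat_const (cfg_card_block cfg piP).
  move=> a ab; have := D1 a (subsetP (blk_aff pi) _ ab).
  by have [aD _] := blkP _ _ _ ab; rewrite (card_planes_at cfg aD) => -[].
rewrite (eq_bigr (fun=> 1%N)).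
  rewrite sum1_card cardsD (setIidPr (blk_aff pi)) (cfg_card_block cfg piP).
  by rewrite card_aff_plane // mulnn.
move=> v /setDP[vpi vb]; have := D1 v vpi; have [vp v1] := affP _ _ vpi.
rewrite (cfg_two cfg v1 _ piP vp) => [[]//|].
by apply: contra vb => vD; apply/blkP.
Qed.

(* With [l], [o], [z] planes meeting [pi] in [q], [1], [0] affine points, counting
   planes and incidences gives [z = (q - 1) * (l - (q - 1))], and [z <= q - 1]. *)
Lemma linked_count pi : pi \in P ->
  let l := #|[set rho | linked pi rho]| in
  let z := #|[set rho in P :\ pi | affl (pi :&: rho) == set0]| in
  (l = q /\ z = q.-1) \/ (l = q.-1 /\ z = 0%N).
Proof.
move=> piP l z; have := sum_card_cap piP.
pose o := #|[set rho in P :\ pi | #|affl (pi :&: rho)| == 1%N]|.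
have q7 := cfg_ge7 cfg.
have trich rho : rho \in P :\ pi -> 
   [\/ #|affl (pi :&: rho)| = 0, #|affl (pi :&: rho)| = 1 | #|affl (pi :&: rho)| = q]%N.
  rewrite !inE eq_sym => /andP[npr rP].
  have [->|n0] := eqVneq (affl (pi :&: rho)) set0; first by rewrite cards0; constructor 1.
  by rewrite (card_aff_cap piP rP npr n0); case: ifP => _; [constructor 3|constructor 2].
have lE : l = (\sum_(rho in P :\ pi) (#|affl (pi :&: rho)| == q))%N.
  rewrite sum_leq1_card => [|rho _]; last by case: (_ == _).
  apply: eq_card => rho; rewrite !inE /linked piP eq_sym eqb0 negbK /=.
  by case: (rho \in P); rewrite ?andbF ?andbT.
have zE : z = (\sum_(rho in P :\ pi) (#|affl (pi :&: rho)| == 0))%N.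
  rewrite sum_leq1_card => [|rho _]; last by case: (_ == _).
  by apply: eq_card => rho; rewrite !inE -cards_eq0 eqb0 negbK.
have oE : o = (\sum_(rho in P :\ pi) (#|affl (pi :&: rho)| == 1))%N.
  rewrite sum_leq1_card => [|rho _]; last by case: (_ == _).
  by apply: eq_card => rho; rewrite !inE eqb0 negbK.
have sumE : (\sum_(rho in P :\ pi) #|affl (pi :&: rho)| = l * q + o)%N.
  rewrite lE oE big_distrl -big_split /=; apply: eq_bigr => rho /trich.
  case=> ->; rewrite ?eqxx; do ?case: eqP => ?; lia.
have cardE : (#|P :\ pi| = l + o + z)%N.
  rewrite lE oE zE -!big_split /= -sum1_card; apply: eq_bigr => rho /trich.
  case=> ->; rewrite ?eqxx; do ?case: eqP => ?; lia.
have z_le : (z <= q.-1)%N.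
  rewrite -(card_disjoint cfg piP); apply: subset_leq_card; apply/subsetP => rho.
  rewrite !inE -andbA => /and3P[-> -> /eqP e0] /=.
  apply/pred0P => a /=; apply/negP => /andP[/blkP[aD api] /blkP[_ ar]].
  by move/setP: e0 => /(_ a); rewrite !inE memv_cap api ar (cfg_D1 cfg aD) eqxx.
have := cardsD1 pi P; rewrite piP (card_P cfg) cardE sumE -mulnn.
move: z_le; clear -q7; case: q q7 => // k k6 z_le e1 e2.
have {e1 e2} e : (z + k * k = k * l)%N by nia.
have [l_lt|l_gt|l_eq] := ltngtP l k.+1.
- have [l_lt'|l_gt|l_eq] := ltngtP l k; [nia | lia |].
  by right; rewrite l_eq in e *; split; lia.
- nia.
- by left; rewrite l_eq in e *; split; lia.
Qed.

End Linked.

Lemma dim1_line (F : finFieldType) (n : nat) (U : {vspace 'rV[F]_n}) v :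
  \dim U = 1%N -> v \in U -> v != 0 -> U = <[v]>%VS.
Proof.
move=> d1 vU v0; apply/esym/eqP; rewrite eqEdim d1 dim_vline v0.
by rewrite -memvE vU.
Qed.

(** * The common direction of the lines cut on a C-plane *)

Section Direction.
Variables (F : finFieldType) (q : nat) (Sigma : {vspace 'rV[F]_5}).
Variables (lam : 'cV[F]_5) (D : {set 'rV[F]_5}) (P : {set {vspace 'rV[F]_5}}).
Hypothesis cfg : configuration q Sigma lam D P.
Implicit Types (a b v w : 'rV[F]_5) (pi rho U W : {vspace 'rV[F]_5}).

Notation blk := (block D).
Notation affl := (aff lam).
Notation linked := (linked q lam P).

Let affP := affP lam.
Let q7 : (7 <= q)%N. Proof. exact: cfg_ge7 cfg. Qed.

Lemma dim_span2 a b : dot a lam = 1 -> dot b lam = 1 -> a != b ->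
  \dim (<[a]> + <[b]>) = 2%N.
Proof.
move=> a1 b1 ab.
have n0 v : dot v lam = 1 -> v != 0.
  by move=> v1; apply/eqP => v0; move: v1; rewrite v0 dot0 => /esym/eqP; rewrite oner_eq0.
rewrite dimv_disjoint_sum ?dim_vline ?n0 //.
apply/eqP; rewrite -subv0; apply/subvP => x; rewrite memv_cap.
case/andP => /vlineP[s ->] /vlineP[t e].
have est : s = t by have := congr1 (fun x => dot x lam) e; rewrite /= !dotZ a1 b1 !mulr1.
move/eqP: e; rewrite est -subr_eq0 -scalerBr scaler_eq0 subr_eq0 (negPf ab) orbF.
by move=> /eqP->; rewrite scale0r mem0v.
Qed.

Lemma dim2_span U a b : \dim U = 2%N -> a \in affl U -> b \in affl U -> a != b ->
  U = (<[a]> + <[b]>)%VS.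
Proof.
move=> dU /affP[aU a1] /affP[bU b1] ab; apply/esym/eqP.
by rewrite eqEdim dU dim_span2 // subv_add -!memvE aU bU.
Qed.

Lemma dim2_eq U W a b : \dim U = 2%N -> \dim W = 2%N ->
  a \in affl U -> b \in affl U -> a \in W -> b \in W -> a != b -> U = W.
Proof.
move=> dU dW aU bU aW bW ab; rewrite (dim2_span dU aU bU ab).
have [_ a1] := affP _ _ aU; have [_ b1] := affP _ _ bU.
by apply/esym/dim2_span => //; apply/affP.
Qed.

Lemma linked_nonD pi rho : linked pi rho -> exists2 v, v \in affl (pi :&: rho) & v \notin D.
Proof.
move=> l; have /and4P[piP rP npr /eqP cq] := l.
have [|v vpr vb] := @card_gt_notin _ (affl (pi :&: rho)) (blk pi :&: blk rho).
  by rewrite cq (leq_ltn_trans (blkI_le1 cfg piP rP npr)) // (leq_trans _ q7).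
exists v => //; apply: contra vb => vD; have [] := affP _ _ vpr.
by rewrite memv_cap !inE vD => /andP[-> ->].
Qed.

Lemma linked_common pi rho tau v : linked pi rho -> linked pi tau -> rho != tau ->
  dot v lam = 1 -> v \in pi -> v \in rho -> v \in tau -> v \in D.
Proof.
move=> /(linkedP cfg)[_ rP npr _ _] /(linkedP cfg)[piP tP npt _ _].
move=> nrt v1 vpi vr vt.
apply: contraT => vD.
by have [e|e] := third_plane cfg v1 vD piP rP tP vpi vr vt npr;
  rewrite e eqxx in npt nrt.
Qed.

(** A line shared by three C-planes would contain a point outside C on all three, against (A3). *)
Lemma linked_cap_inj pi rho tau : linked pi rho -> linked pi tau ->
  (pi :&: rho)%VS = (pi :&: tau)%VS -> rho = tau.
Proof.
move=> lr lt e; apply/eqP; apply: contraT => nrt.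
have [v vpr] := linked_nonD lr; have [] := affP _ _ vpr.
rewrite memv_cap => /andP[vpi vr] v1; rewrite (linked_common lr lt nrt v1 vpi vr) //.
by have := affP _ _ vpr; rewrite e memv_cap => -[/andP[]].
Qed.

Lemma dim_cap_dir pi rho : linked pi rho -> \dim (pi :&: rho :&: Sigma) = 1%N.
Proof.
move=> /(linkedP cfg)[_ _ _ d2 [v]].
by move=> /(dim_cap_Sigma (cfg_dim_Sigma cfg) (cfg_SigmaE cfg)); rewrite d2 => -[].
Qed.

(** Two lines of the plane [pi] meet; if they do so in an affine point, this point is on three
    C-planes and hence in C. *)
Lemma linked_dir_or_meet pi rho tau : linked pi rho -> linked pi tau -> rho != tau ->
  (pi :&: rho :&: Sigma = pi :&: tau :&: Sigma)%VS \/
  exists a, [/\ a \in D, a \in pi, a \in rho & a \in tau].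
Proof.
move=> lr lt nrt; have [piP rP npr dr _] := linkedP cfg lr.
have [_ tP npt dt _] := linkedP cfg lt.
have := dimv_sum_cap (pi :&: rho) (pi :&: tau); rewrite dr dt => d4.
have d3 : (\dim ((pi :&: rho) + (pi :&: tau)) <= 3)%N.
  apply: leq_trans (_ : _ <= \dim pi)%N _; last by rewrite (cfg_dimP cfg piP).
  by rewrite dimvS // subv_add !capvSl.
pose w := vpick (pi :&: rho :&: (pi :&: tau)).
have w0 : w != 0 by rewrite vpick0 -dimv_eq0; lia.
have := memv_pick (pi :&: rho :&: (pi :&: tau)); rewrite -/w !memv_cap.
move=> /andP[/andP[wpi wr] /andP[_ wt]].
have [wl|wl] := eqVneq (dot w lam) 0.
  left; rewrite (dim1_line (v := w) (dim_cap_dir lr)) //; last first.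
    by rewrite !memv_cap wpi wr (cfg_SigmaE cfg) wl /=.
  rewrite (dim1_line (v := w) (dim_cap_dir lt)) //.
  by rewrite !memv_cap wpi wt (cfg_SigmaE cfg) wl /=.
right; exists ((dot w lam)^-1 *: w); rewrite !memvZ //; split=> //.
by apply: (linked_common lr lt nrt); rewrite ?memvZ // dotZ mulVf.
Qed.

(** Lines through [a] share no other affine point and have q - 1 further ones each, out of q^2 -
    1. *)
Lemma card_lines_at pi a (G : {set {vspace 'rV[F]_5}}) : pi \in P ->
  a \in affl pi -> (forall U, U \in G -> [/\ \dim U = 2%N, a \in U & (U <= pi)%VS]) ->
  (#|G| <= q.+1)%N.
Proof.
move=> piP api hG; have := sum_card_swap G (affl pi :\ a) (fun U x => x \in U).
have [ap a1] := affP _ _ api.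
rewrite (eq_bigr (fun=> q.-1)); last first.
  move=> U /hG[dU aU sU]; have aaU : a \in affl U by apply/affP.
  have := card_affl cfg aaU; rewrite dU expn1 (cardsD1 a) aaU add1n => <-.
  apply: eq_card => x; rewrite !inE; case: (x != a) => //=.
  by rewrite andbC; have [xU|//] := boolP (x \in U); rewrite (subvP sU).
have le1 : (\sum_(x in affl pi :\ a) #|[set U in G | x \in U]| <= #|affl pi :\ a|)%N.
  rewrite -sum1_card; apply: leq_sum => x; rewrite in_setD1 => /andP[xa /affP[xpi x1]].
  rewrite leqNgt; apply/negP => /card_gt1P[U [W []]].
  rewrite !inE => /andP[/hG[dU aU _] xU] /andP[/hG[dW aW _] xW] /eqP[].
  by apply: (dim2_eq (a := x) (b := a)) => //; apply/affP.
have := card_aff_plane cfg piP; rewrite (cardsD1 a) api add1n sum_nat_const -mulnn.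
move=> c e; rewrite -e in le1; have : (#|G| * q.-1 < q * q)%N by rewrite -c ltnS.
move: #|G| => g; clear -q7; case: q q7 => // k; nia.
Qed.

(** Suppose two of the lines meet in a point [a] of C. Any other line cut by a linked plane is not
    parallel to both, so it meets one of them in a point of C, which can only be [a]. These at least
    q - 1 lines through [a] have no second point of C, hence differ from the q - 1 chords of the arc
    at [a]: too many lines of [pi] through one point. *)
Lemma linked_parallel pi rho tau : linked pi rho -> linked pi tau ->
  (pi :&: rho :&: Sigma = pi :&: tau :&: Sigma)%VS.
Proof.
move=> lr lt; have [<-//|nrt] := eqVneq rho tau.
have [//|[a [aD api ar at_]]] := linked_dir_or_meet lr lt nrt.
apply/eqP; apply: contraT => /eqP ndir; have piP := let: And5 h _ _ _ _ := linkedP cfg lr in h.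
have a1 := cfg_D1 cfg aD.
have aall sig : linked pi sig -> a \in sig.
  move=> ls; have [<-//|nsr] := eqVneq rho sig; have [<-//|nst] := eqVneq tau sig.
  have [er|[b [bD bpi br bs]]] := linked_dir_or_meet lr ls nsr.
    have [et|[b [bD bpi bt bs]]] := linked_dir_or_meet lt ls nst.
      by case: ndir; rewrite er et.
    by rewrite (linked_blk_uniq cfg lt aD bD) ?memv_cap ?api ?bpi.
  by rewrite (linked_blk_uniq cfg lr aD bD) ?memv_cap ?api ?bpi.
pose A := [set (pi :&: sig)%VS | sig in [set sig | linked pi sig]].
pose B := [set (<[a]> + <[b]>)%VS | b : 'rV[F]_5 in blk pi :\ a].
have cA : (q.-1 <= #|A|)%N.
  rewrite card_in_imset; last by move=> x y; rewrite !inE => lx ly; apply: linked_cap_inj.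
  by have [[-> _]|[-> _]] := linked_count cfg piP; lia.
have cB : #|B| = q.-1.
  rewrite card_in_imset => [|x y].
    by have := cardsD1 a (blk pi); rewrite (cfg_card_block cfg piP) inE aD api => ->.
  rewrite !inE => /and3P[xa xD _] /and3P[ya yD _] e.
  apply/eqP; apply: contraT => nxy.
  have /negP[] := cfg_arc cfg aD xD yD (ltac:(by rewrite eq_sym)) ya (ltac:(by rewrite eq_sym)).
  by rewrite e (subvP (addvSr _ _)) ?memv_line.
have dAB : [disjoint A & B].
  apply/pred0P => U /=; apply/negP => /andP[/imsetP[sig]]; rewrite inE => ls ->.
  case/imsetP => b; rewrite !inE => /and3P[/eqP ba bD bpi] e; case: ba.
  have bs : b \in (pi :&: sig)%VS by rewrite e (subvP (addvSr _ _)) ?memv_line.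
  by apply: (linked_blk_uniq cfg ls bD aD bs); rewrite memv_cap api aall.
have := @card_lines_at pi a (A :|: B) piP.
rewrite cardsU disjoint_setI0 // cards0 subn0 cB => /(_ _ _).
have aapi : a \in affl pi by apply/affP.
move=> /(_ aapi) h; suff /h le : forall U, U \in A :|: B -> [/\ \dim U = 2%N, a \in U & (U <= pi)%VS].
  by have le2 := leq_trans (leq_add cA (leqnn q.-1)) le; clear -q7 le2; lia.
move=> U; rewrite inE => /orP[] /imsetP[x]; rewrite !inE.
  move=> lx ->; split; rewrite ?capvSl ?memv_cap ?api ?aall //.
  by have [] := linkedP cfg lx.
move=> /and3P[xa xD xpi] ->; split.
- by rewrite dim_span2 // ?(cfg_D1 cfg) // eq_sym.
- by rewrite (subvP (addvSl _ _)) ?memv_line.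
- by rewrite subv_add -!memvE api.
Qed.

(** The choice of [rho] is immaterial by [linked_parallel], and on [P] the default [0] is never
    reached, by [linked_ex]. *)
Definition dir pi :=
  if [pick rho | linked pi rho] is Some rho then (pi :&: rho :&: Sigma)%VS else 0%VS.

Lemma linked_dir pi rho : linked pi rho -> (pi :&: rho :&: Sigma)%VS = dir pi.
Proof.
rewrite /dir; case: pickP => [tau lt lr|/(_ rho)->//].
exact: linked_parallel.
Qed.

Lemma dir_linked pi rho : linked pi rho -> dir pi = dir rho.
Proof.
move=> l; rewrite -(linked_dir l) [(pi :&: rho)%VS]capvC; apply: linked_dir.
by rewrite linked_sym.
Qed.

Lemma linked_ex pi : pi \in P -> exists rho, linked pi rho.
Proof.
move=> piP; have : (0 < #|[set rho | linked pi rho]|)%N.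
  by have [[-> _]|[-> _]] := linked_count cfg piP; lia.
by case/card_gt0P => rho; rewrite inE; exists rho.
Qed.

Lemma dirP pi : pi \in P -> [/\ \dim (dir pi) = 1%N, (dir pi <= pi)%VS & (dir pi <= Sigma)%VS].
Proof.
move=> /linked_ex[rho l]; rewrite -(linked_dir l) dim_cap_dir // capvSr; split=> //.
by rewrite (subv_trans (capvSl _ _)) // capvSl.
Qed.

Lemma linkedD pi rho v n : linked pi rho -> v \in (pi :&: rho)%VS -> n \in dir pi ->
  v + n \in (pi :&: rho)%VS.
Proof.
move=> l vpr npi; rewrite memvD //; move: npi; rewrite -(linked_dir l).
by rewrite memv_cap => /andP[].
Qed.

Lemma linkedB pi rho v w : linked pi rho -> v \in affl (pi :&: rho) ->
  w \in affl (pi :&: rho) -> w - v \in dir pi.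
Proof.
move=> l /affP[vU v1] /affP[wU w1]; rewrite -(linked_dir l) memv_cap memvB //=.
by rewrite (cfg_SigmaE cfg) dotD dotN v1 w1 subrr.
Qed.

(** Both lines have direction [dir pi], so a common affine point makes them equal, and then
    [linked_cap_inj] applies. *)
Lemma linked_disjoint pi rho tau v : linked pi rho -> linked pi tau ->
  v \in affl pi -> v \in rho -> v \in tau -> rho = tau.
Proof.
move=> lr lt /affP[vpi v1] vr vt; apply: (linked_cap_inj lr lt).
have piP := let: And5 h _ _ _ _ := linkedP cfg lr in h.
have [d1 _ /subvP sS] := dirP piP.
have [_ _ _ dr _] := linkedP cfg lr; have [_ _ _ dt _] := linkedP cfg lt.
pose n := vpick (dir pi); have npi : n \in dir pi := memv_pick _.
have n0 : n != 0 by rewrite vpick0 -dimv_eq0 d1.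
have vr' : v \in (pi :&: rho)%VS by rewrite memv_cap vpi.
have vt' : v \in (pi :&: tau)%VS by rewrite memv_cap vpi.
have nl : dot n lam = 0 by apply/eqP; rewrite -(cfg_SigmaE cfg) sS.
apply: (dim2_eq (a := v) (b := v + n)) => //; try exact/affP.
- by apply/affP; rewrite dotD nl addr0; split=> //; apply: linkedD.
- exact: linkedD.
- by rewrite eq_sym -subr_eq0 addrC addKr.
Qed.

End Direction.

Lemma dim_add_vline (F : finFieldType) (n : nat) (U : {vspace 'rV[F]_n}) v :
  v \notin U -> \dim (U + <[v]>) = (\dim U).+1.
Proof.
move=> vU; have v0 : v != 0 by apply: contraNneq vU => ->; rewrite mem0v.
rewrite dimv_disjoint_sum ?dim_vline ?v0 ?addn1 //.
apply/eqP; rewrite -subv0; apply/subvP => x; rewrite memv_cap => /andP[xU /vlineP[k ex]].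
have [k0|k0] := eqVneq k 0; first by rewrite ex k0 scale0r mem0v.
by case/negP: vU; rewrite -[v](scalerK k0) -ex memvZ.
Qed.

(** * Disjoint C-planes meet at infinity *)

Section Residual.
Variables (F : finFieldType) (q : nat) (Sigma : {vspace 'rV[F]_5}).
Variables (lam : 'cV[F]_5) (D : {set 'rV[F]_5}) (P : {set {vspace 'rV[F]_5}}).
Hypothesis cfg : configuration q Sigma lam D P.
Implicit Types (a b v w : 'rV[F]_5) (pi rho tau U W : {vspace 'rV[F]_5}).

Notation blk := (block D).
Notation affl := (aff lam).
Notation linked := (linked q lam P).
Notation par := (parallel D).
Notation dir := (dir q Sigma lam P).

Let affP := affP lam.
Let q7 : (7 <= q)%N. Proof. exact: cfg_ge7 cfg. Qed.

Lemma par_notD pi rho v : par pi rho -> pi != rho -> v \in pi -> v \in rho -> v \notin D.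
Proof.
rewrite /parallel => /orP[->//|/pred0P/(_ v)] /= h _ vpi vr.
by apply/negP => vD; rewrite !inE vD vpi vr in h.
Qed.

Lemma par_three pi rho tau v : pi \in P -> rho \in P -> tau \in P ->
  par pi rho -> pi != rho -> pi != tau -> rho != tau -> dot v lam = 1 ->
  v \in pi -> v \in rho -> v \in tau -> False.
Proof.
move=> piP rP tP pr npr npt nrt v1 vpi vr vt.
have vD := par_notD pr npr vpi vr.
by have [e|e] := third_plane cfg v1 vD piP rP tP vpi vr vt npr;
  rewrite e eqxx in npt nrt.
Qed.

(** By [linked_disjoint] a point of [pi] is on at most one linked plane, so the sum counts no point
    twice. *)
Lemma sum_linked pi (X : {set 'rV[F]_5}) : X \subset affl pi ->
  (\sum_(rho in [set rho | linked pi rho]) #|[set x in X | x \in rho]| =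
   #|[set x in X | [exists rho, linked pi rho && (x \in rho)]]|)%N.
Proof.
move=> /subsetP sX.
rewrite (sum_card_swap _ X (fun (rho : {vspace 'rV[F]_5}) x => x \in rho)).
rewrite sum_leq1_card => [|x /sX xpi].
  apply: eq_card => x; rewrite !inE; congr (_ && _); rewrite -lt0n.
  apply/card_gt0P/existsP => -[rho].
    by rewrite !inE => h; exists rho.
  by move=> h; exists rho; rewrite !inE.
rewrite leqNgt; apply/negP => /card_gt1P[U [W []]].
rewrite !inE => /andP[lU xU] /andP[lW xW] /eqP[].
exact: (linked_disjoint cfg lU lW xpi).
Qed.

Lemma sum_linked_aff pi : pi \in P ->
  (#|[set rho | linked pi rho]| * q =
   #|[set x in affl pi | [exists rho, linked pi rho && (x \in rho)]]|)%N.
Proof.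
move=> piP; rewrite -sum_linked // (eq_bigr (fun=> q)) ?sum_nat_const //.
move=> rho; rewrite inE => /and4P[_ _ _ /eqP <-]; apply: eq_card => x.
by rewrite !inE memv_cap; case: (dot x lam == 1); rewrite ?andbF ?andbT.
Qed.

(* The second alternative of [linked_count]; no such plane exists, by
   [par_at_infinity]. *)
Definition exceptional pi := (pi \in P) && (#|[set rho | linked pi rho]| == q.-1).

(** The planes sharing no affine point with [pi] are among the q - 1 planes sharing no point of C
    with it. As [rho] is one of the latter only, the first alternative of [linked_count] is
    impossible. *)
Lemma exceptional_par pi rho v : pi \in P -> rho \in P -> par pi rho -> pi != rho ->
  v \in affl (pi :&: rho) ->
  exceptional pi /\ (forall tau, tau \in P -> tau != pi -> affl (pi :&: tau) != set0).
Proof.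
move=> piP rP pr npr vpr.
have h : #|[set rho in P :\ pi | affl (pi :&: rho) == set0]| != q.-1.
  rewrite neq_ltn -(card_disjoint cfg piP); apply/orP; left.
  apply: proper_card; apply/properP; split.
    apply/subsetP => tau; rewrite !inE -andbA => /and3P[-> -> /eqP e0] /=.
    apply/pred0P => a /=; apply/negP => /andP[/blkP[aD api] /blkP[_ ar]].
    by move/setP: e0 => /(_ a); rewrite !inE memv_cap api ar (cfg_D1 cfg aD) eqxx.
  exists rho; first by move: pr; rewrite !inE rP eq_sym npr /parallel (negPf npr).
  by rewrite !inE rP eq_sym npr /=; apply/set0Pn; exists v.
rewrite /exceptional piP; have [[_ z]|[-> z]] := linked_count cfg piP.
  by rewrite z eqxx in h.
rewrite eqxx; split=> // tau tP ntpi; apply/negP => e0.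
move/eqP: z; rewrite cards_eq0 => /eqP/setP/(_ tau).
by rewrite !inE tP ntpi e0.
Qed.

Definition residual pi U := [/\ \dim U = 2%N, (U <= pi)%VS &
  forall v, v \in affl pi ->
    (v \in U) = ~~ [exists rho, linked pi rho && (v \in rho)]].

(** The q - 1 parallel lines cover q(q - 1) affine points of [pi]. The q points left over are closed
    under translation along [dir pi], so they are the line in that direction through any one of
    them. *)
Lemma residual_ex pi : exceptional pi -> exists U, residual pi U.
Proof.
case/andP=> piP /eqP cl; have := sum_linked_aff piP; rewrite cl.
pose T := [set x in affl pi | [exists rho, linked pi rho && (x \in rho)]].
rewrite -/T => cT; have cR : #|affl pi :\: T| = q.
  have := cardsID T (affl pi).
  have -> : affl pi :&: T = T by apply/setIidPr/subsetP => x; rewrite inE => /andP[].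
  rewrite -cT (card_aff_plane cfg piP) -mulnn; move: #|_| => x.
  by clear -q7; case: q q7 => // k; nia.
have [r] : exists r, r \in affl pi :\: T by apply/set0Pn; rewrite -card_gt0 cR; lia.
rewrite !inE negb_and => /andP[/orP[nr|nr] /andP[rpi r1]].
  by rewrite rpi r1 in nr.
have [d1 sp sS] := dirP cfg piP.
pose U := (<[r]> + dir pi)%VS.
have rS : r \notin Sigma by rewrite (cfg_SigmaE cfg) (eqP r1) oner_eq0.
have dU : \dim U = 2%N.
  by rewrite /U addvC dim_add_vline ?d1 //; apply: contra rS; apply: (subvP sS).
have sU : (U <= pi)%VS by rewrite subv_add -memvE rpi.
have rU : r \in U by rewrite (subvP (addvSl _ _)) ?memv_line.
have sUT : affl U \subset affl pi :\: T.
  apply/subsetP => v vU; have [vU' v1] := affP _ _ vU.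
  rewrite inE (subsetP (affS lam sU)) // andbT inE negb_and; apply/orP; right.
  apply: contra nr => /existsP[rho /andP[l vr]]; apply/existsP; exists rho; rewrite l /=.
  case/memv_addP: vU' => _ /vlineP[k ->] [n nd ev].
  have nl : dot n lam = 0 by apply/eqP; rewrite -(cfg_SigmaE cfg) (subvP sS).
  have k1 : k = 1 by move: v1; rewrite ev dotD dotZ nl (eqP r1) mulr1 addr0.
  have -> : r = v + (- n) by rewrite ev k1 scale1r addrK.
  have := linkedD cfg l (v := v) (n := - n); rewrite !memv_cap vr.
  by rewrite (subvP sU) ?(affP _ _ vU).1 // rpredN nd => /(_ isT isT)/andP[].
have eUT : affl U = affl pi :\: T.
  apply/eqP; rewrite eqEcard sUT cR.
  have -> : #|affl U| = (q ^ (\dim U).-1)%N by apply: (card_affl cfg (v := r)); apply/affP; rewrite (eqP r1).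
  by rewrite dU expn1 leqnn.
exists U; split=> // v vpi; have [vp v1] := affP _ _ vpi.
by have /setP/(_ v) := eUT; rewrite !inE v1 eqxx vp /= !andbT.
Qed.

Lemma arc_line_le2 U : \dim U = 2%N -> (#|blk U| <= 2)%N.
Proof.
move=> dU; rewrite leqNgt; apply/negP => /card_gt2P[a [b [c [[]]]]].
move=> /blkP[aD aU] /blkP[bD bU] /blkP[cD cU] [ab bc ca].
rewrite eq_sym in bc; have /negP[] := cfg_arc cfg aD bD cD ab ca bc.
by rewrite -(@dim2_span _ lam U a b) //; apply/affP; rewrite (cfg_D1 cfg).
Qed.

(** The points of C in [pi] off [U] correspond to the linked planes that meet [pi] in C. Hence [U]
    holds one more point of C than there are planes both linked and parallel to [pi], and it holds
    at most two because C meets [pi] in an arc. *)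
Lemma residual_counts pi U : exceptional pi -> residual pi U ->
  (exists a, a \in blk U) /\
  (#|[set rho | linked pi rho && par pi rho]| <= 1)%N.
Proof.
case/andP=> piP /eqP cl [dU sU UE].
have := sum_linked (blk_aff cfg pi).
have -> : [set x in blk pi | [exists rho, linked pi rho && (x \in rho)]] = blk pi :\: blk U.
  apply/setP => a; rewrite in_setD inE andbC; have [ab|] := boolP (a \in blk pi); last by rewrite !andbF.
  rewrite !andbT; have [aD api] := blkP _ _ _ ab.
  by rewrite inE aD UE ?negbK // (subsetP (blk_aff cfg pi)).
rewrite sum_leq1_card => [|rho]; last first.
  rewrite inE => /(linkedP cfg)[_ rP npr _ _].
  apply: leq_trans (blkI_le1 cfg piP rP npr); apply: subset_leq_card.
  by apply/subsetP => x; rewrite !inE => /andP[/andP[-> ->] ->].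
set A := [set x in _ | _].
have eA : A = [set rho | linked pi rho] :\: [set rho | linked pi rho && par pi rho].
  apply/setP => rho; rewrite !inE negb_and; have [l|] := boolP (linked pi rho); last by rewrite !andbF.
  have [_ rP npr _ _] := linkedP cfg l.
  rewrite andbT /= -lt0n; apply/idP/idP => [/card_gt0P[a]|/(parPn D piP rP)[_ [a [aD api ar]]]].
    rewrite !inE => /andP[/andP[aD api] ar]; apply/(parPn D piP rP).
    by split=> //; exists a.
  by apply/card_gt0P; exists a; rewrite !inE aD api ar.
have sB : blk U \subset blk pi.
  by apply/subsetP => a; rewrite !inE => /andP[-> /(subvP sU)].
have sL : [set rho | linked pi rho && par pi rho] \subset [set rho | linked pi rho].
  by apply/subsetP => a; rewrite !inE => /andP[->].
rewrite eA !cardsD (setIidPr sB) (setIidPr sL) (cfg_card_block cfg piP) cl.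
have := arc_line_le2 dU; have := subset_leq_card sL; rewrite cl.
have <- : (0 < #|blk U|)%N <-> exists a, a \in blk U.
  by split=> [/card_gt0P|h]; last apply/card_gt0P.
move: #|_| #|_| => x y; clear -q7; lia.
Qed.

Lemma residual_mem pi rho U v : residual pi U -> pi \in P -> rho \in P ->
  par pi rho -> pi != rho -> ~~ linked pi rho -> v \in affl (pi :&: rho) -> v \in U.
Proof.
move=> [dU sU UE] piP rP pr npr nl /affP[]; rewrite memv_cap => /andP[vpi vr] v1.
rewrite UE; last exact/affP; apply/negP => /existsP[tau /andP[lt vt]].
have [_ tP npt _ _] := linkedP cfg lt.
have [e|nrt] := eqVneq rho tau; first by rewrite e lt in nl.
exact: (par_three (rho := rho) (tau := tau) (v := v) piP rP tP).
Qed.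

(* Otherwise every plane of the parallel class is exceptional, and all but at most
   one of the others meet it in a point of its residual line. Hence the residual
   lines lie in one plane, which contains a point of C on each of them and so is
   a C-plane; then a common point of two of the lines is on three C-planes. *)
Theorem par_at_infinity pi rho : pi \in P -> rho \in P -> par pi rho -> pi != rho ->
  affl (pi :&: rho) = set0.
Proof.
move=> p0P rP pr npr; apply/eqP; apply: contraT => /set0Pn[v0 v0pr].
set p0 := pi in p0P pr npr v0pr.
pose K := [set x in P | par p0 x].
have [ex0 all0] := exceptional_par p0P rP pr npr v0pr.
have KP x : x \in K -> x \in P by rewrite inE => /andP[].
have KK x y : x \in K -> y \in K -> par x y.
  by rewrite !inE => /andP[xP px] /andP[yP py]; apply: (par_trans cfg p0P).
have K0 : p0 \in K by rewrite inE p0P par_refl.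
have exK x : x \in K -> exceptional x /\
    (forall tau, tau \in P -> tau != x -> affl (x :&: tau) != set0).
  move=> xK; have [->//|nx] := eqVneq x p0.
  have [v vx] := set0Pn _ (all0 x (KP x xK) nx).
  by apply: (exceptional_par (KP _ xK) p0P (KK _ _ xK K0) nx (v := v)); rewrite capvC.
have meetK x y : x \in K -> y \in K -> x != y -> exists w, [/\ dot w lam = 1, w \in x & w \in y].
  move=> xK yK nxy; have [_ /(_ y (KP y yK))] := exK x xK.
  rewrite eq_sym => /(_ nxy)/set0Pn[w /affP[]]; rewrite memv_cap => /andP[wx wy] w1.
  by exists w.
have few x : x \in K -> (#|[set y | linked x y && par x y]| <= 1)%N.
  move=> xK; have [ex _] := exK x xK; have [U rU] := residual_ex ex.
  by have [] := residual_counts ex rU.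
have three x y z w : x \in K -> y \in K -> z \in K -> x != y -> x != z -> y != z ->
    dot w lam = 1 -> w \in x -> w \in y -> w \in z -> False.
  by move=> xK yK zK; apply: par_three; auto.
have memK x y U w : residual x U -> x \in K -> y \in K -> x != y -> ~~ linked x y ->
    dot w lam = 1 -> w \in x -> w \in y -> w \in U.
  move=> rU xK yK nxy nl w1 wx wy.
  apply: (residual_mem rU (KP _ xK) (KP _ yK) (KK _ _ xK yK) nxy nl).
  by apply/affP; rewrite memv_cap wx.
have cK : #|K| = q by apply: (card_class cfg).
have [p1 p1K] : exists2 p1, p1 \in K & p1 \notin p0 |: [set y | linked p0 y && par p0 y].
  apply: card_gt_notin; rewrite cK cardsU1.
  by apply: leq_ltn_trans (leq_add (leq_b1 _) (few p0 K0)) _; apply: leq_trans q7.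
rewrite !inE negb_or negb_and => /andP[n10 nl01].
have {}nl01 : ~~ linked p0 p1 by case/orP: nl01 => //; rewrite (KK _ _ K0 p1K).
have [p2 p2K] : exists2 p2, p2 \in K & p2 \notin [set p0; p1] :|:
  ([set y | linked p0 y && par p0 y] :|: [set y | linked p1 y && par p1 y]).
  apply: card_gt_notin; rewrite cK.
  apply: (@leq_ltn_trans (2 + (1 + 1))); last by apply: leq_trans q7.
  apply: leq_trans (leq_card_setU _ _).1 _; apply: leq_add.
    by rewrite cards2; case: (_ != _).
  by apply: leq_trans (leq_card_setU _ _).1 _; apply: leq_add; apply: few.
rewrite !inE !negb_or (KK _ _ K0 p2K) (KK _ _ p1K p2K) !andbT.
move=> /andP[/andP[n20 n21] /andP[nl02 nl12]].
have n01 : p0 != p1 by rewrite eq_sym.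
have n02 : p0 != p2 by rewrite eq_sym.
have n12 : p1 != p2 by rewrite eq_sym.
have [U0 r0] := residual_ex (exK _ K0).1.
have [U1 r1] := residual_ex (exK _ p1K).1.
have [U2 r2] := residual_ex (exK _ p2K).1.
have [w01 [w01_1 w01_0 w01_p1]] := meetK _ _ K0 p1K n01.
have [w02 [w02_1 w02_0 w02_p2]] := meetK _ _ K0 p2K n02.
have [w12 [w12_1 w12_p1 w12_p2]] := meetK _ _ p1K p2K n12.
have lsym x y : ~~ linked x y -> ~~ linked y x by rewrite linked_sym.
have w01U0 : w01 \in U0 by apply: memK r0 K0 p1K _ _ _ _ _.
have w02U0 : w02 \in U0 by apply: memK r0 K0 p2K _ _ _ _ _.
have w01U1 : w01 \in U1 by apply: memK r1 p1K K0 _ _ _ _ _ => //; exact: lsym.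
have w12U1 : w12 \in U1 by apply: memK r1 p1K p2K _ _ _ _ _.
have w02U2 : w02 \in U2 by apply: memK r2 p2K K0 _ _ _ _ _ => //; exact: lsym.
have w12U2 : w12 \in U2 by apply: memK r2 p2K p1K _ _ _ _ _ => //; exact: lsym.
have w12_0 : w12 \notin p0 by apply/negP => h; apply: (three p0 p1 p2 w12).
have w02_1' : w02 \notin p1 by apply/negP => h; apply: (three p0 p1 p2 w02).
have nw0 : w01 != w02 by apply: contraNneq w02_1' => <-.
have nw1 : w01 != w12 by apply: contraNneq w12_0 => <-.
have nw2 : w02 != w12 by apply: contraNneq w12_0 => <-.
pose T := (U0 + <[w12]>)%VS.
have [dU0 sU0 _] := r0; have [dU1 _ _] := r1; have [dU2 _ _] := r2.
have dT : \dim T = 3%N.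
  by rewrite dim_add_vline ?dU0 //; apply: contra w12_0; apply: (subvP sU0).
have U0T : (U0 <= T)%VS by rewrite addvSl.
have w12T : w12 \in T by rewrite (subvP (addvSr _ _)) ?memv_line.
have w01T : w01 \in T by rewrite (subvP U0T).
have w02T : w02 \in T by rewrite (subvP U0T).
have spanT U a b : \dim U = 2%N -> a \in U -> b \in U -> dot a lam = 1 ->
    dot b lam = 1 -> a != b -> a \in T -> b \in T -> (U <= T)%VS.
  move=> dU aU bU a1 b1 nab aT bT.
  by rewrite (@dim2_span _ lam U a b) ?subv_add -?memvE ?aT //; apply/affP.
have U1T : (U1 <= T)%VS by apply: (spanT _ w01 w12).
have U2T : (U2 <= T)%VS by apply: (spanT _ w02 w12).
(* Apart from [p0], [p1], [p2] themselves, [x] is linked to at most one of these three, so it meets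
   the other two in distinct points that lie on its own residual line and on theirs, hence in
   [T]. *)
have allT x U : x \in K -> residual x U -> (U <= T)%VS.
  move=> xK rU; have [dU _ _] := rU.
  have two y z Uy Uz : y \in K -> z \in K -> residual y Uy -> residual z Uz ->
      (Uy <= T)%VS -> (Uz <= T)%VS -> y != z -> ~~ linked x y -> ~~ linked x z ->
      x != y -> x != z -> (U <= T)%VS.
    move=> yK zK ry rz yT zT nyz nlxy nlxz nxy nxz.
    have [w [w1 wx wy]] := meetK _ _ xK yK nxy.
    have [w' [w'1 w'x w'z]] := meetK _ _ xK zK nxz.
    apply: (spanT _ w w') => //.
    - exact: memK rU xK yK _ _ _ _ _.
    - exact: memK rU xK zK _ _ _ _ _.
    - by apply/eqP => e; apply: (three x y z w) => //; rewrite e.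
    - apply: (subvP yT); apply: memK ry yK xK _ _ _ _ _ => //; first by rewrite eq_sym.
      exact: lsym.
    - apply: (subvP zT); apply: memK rz zK xK _ _ _ _ _ => //; first by rewrite eq_sym.
      exact: lsym.
  have onelink y z : y \in K -> z \in K -> y != z -> linked x y -> ~~ linked x z.
    move=> yK zK nyz ly; apply/negP => lz; have := few x xK.
    rewrite leqNgt => /negP[]; apply/card_gt1P; exists y, z.
    by rewrite !inE ly lz (KK x y) ?(KK x z).
  have [e0|nx0] := eqVneq x p0.
    have h w : w \in U0 -> dot w lam = 1 -> w \in U.
      move=> wU0 w1; case: rU r0 => _ _ UE [_ _ U0E]; rewrite e0 in UE.
      have wp : w \in affl p0 by apply/affP; rewrite (subvP sU0).
      by rewrite UE // -U0E.
    by apply: (spanT _ w01 w02); auto.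
  have [e1|nx1] := eqVneq x p1.
    have h w : w \in U1 -> dot w lam = 1 -> w \in U.
      move=> wU1 w1; case: rU r1 => _ _ UE [_ sU1 U1E]; rewrite e1 in UE.
      have wp : w \in affl p1 by apply/affP; rewrite (subvP sU1).
      by rewrite UE // -U1E.
    by apply: (spanT _ w01 w12); auto.
  have [e2|nx2] := eqVneq x p2.
    have h w : w \in U2 -> dot w lam = 1 -> w \in U.
      move=> wU2 w1; case: rU r2 => _ _ UE [_ sU2 U2E]; rewrite e2 in UE.
      have wp : w \in affl p2 by apply/affP; rewrite (subvP sU2).
      by rewrite UE // -U2E.
    by apply: (spanT _ w02 w12); auto.
  have [l0|nl0] := boolP (linked x p0).
    by apply: (two p1 p2 U1 U2) => //; apply: (onelink p0).
  have [l1|nl1] := boolP (linked x p1).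
    by apply: (two p0 p2 U0 U2) => //; apply: (onelink p1).
  by apply: (two p0 p1 U0 U1).
have TP : T \in P.
  apply: (cfg_plane cfg dT).
  suff le : (#|K| <= #|blk T|)%N by apply: leq_trans le; rewrite cK (leq_trans _ q7).
  have := sum_card_swap K (blk T) (fun (rho : {vspace 'rV[F]_5}) x => x \in rho).
  rewrite -sum1_card => e; apply: (@leq_trans (\sum_(x in K) #|[set a in blk T | a \in x]|)).
    apply: leq_sum => x xK; have [U rU] := residual_ex (exK _ xK).1.
    have [[a /blkP[aD aU]] _] := residual_counts (exK _ xK).1 rU; have [_ sU _] := rU.
    by apply/card_gt0P; exists a; rewrite !inE aD (subvP (allT x U xK rU)) // (subvP sU).
  rewrite e -sum1_card; apply: leq_sum => a /blkP[aD aT].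
  rewrite leqNgt; apply/negP => /card_gt1P[x [y []]].
  rewrite !inE -!andbA => /and3P[xP px ax] /and3P[yP py ay] /eqP[].
  exact: (playfair_uniq cfg p0P aD).
have w01D : w01 \notin D := par_notD (KK _ _ K0 p1K) n01 w01_0 w01_p1.
have [eT|eT] := third_plane cfg w01_1 w01D p0P (KP _ p1K) TP w01_0 w01_p1 w01T n01.
  by rewrite eT (negPf w12_0) in w12T.
by rewrite eT (negPf w02_1') in w02T.
Qed.

End Residual.

(** * The infinite points of C-planes *)

Section Partner.
Variables (F : finFieldType) (q : nat) (Sigma : {vspace 'rV[F]_5}).
Variables (lam : 'cV[F]_5) (D : {set 'rV[F]_5}) (P : {set {vspace 'rV[F]_5}}).
Hypothesis cfg : configuration q Sigma lam D P.
Implicit Types (a b v w : 'rV[F]_5) (pi rho tau U W : {vspace 'rV[F]_5}).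

Notation blk := (block D).
Notation affl := (aff lam).
Notation linked := (linked q lam P).
Notation par := (parallel D).
Notation dir := (dir q Sigma lam P).

Let affP := affP lam.
Let q7 : (7 <= q)%N. Proof. exact: cfg_ge7 cfg. Qed.

(** The second alternative of [linked_count] leaves no plane without affine points in common with
    [pi], but another plane of its parallel class is one, by [par_at_infinity]. *)
Lemma card_linked pi : pi \in P -> #|[set rho | linked pi rho]| = q.
Proof.
move=> piP; have [[]//|[_ /eqP]] := linked_count cfg piP.
rewrite cards_eq0 => /eqP/setP z.
have [|rho] := @card_gt_notin _ [set rho in P | par pi rho] [set pi].
  by rewrite cards1 (card_class cfg piP) (leq_trans _ q7).
rewrite !inE => /andP[rP pr] nr; have := z rho.
by rewrite !inE nr rP (par_at_infinity cfg piP rP pr) ?eqxx // eq_sym.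
Qed.

(** The [q] linked planes cut [pi] in disjoint sets of [q] affine points, which exhaust its q^2
    affine points. *)
Lemma partner_ex pi v : pi \in P -> v \in affl pi -> exists2 rho, linked pi rho & v \in rho.
Proof.
move=> piP vpi; have := sum_linked_aff cfg piP; rewrite card_linked //.
set T := [set x in _ | _] => cT.
have sT : T \subset affl pi by apply/subsetP => x; rewrite inE => /andP[].
have /eqP eT : T == affl pi by rewrite eqEcard sT -cT (card_aff_plane cfg piP) -mulnn leqnn.
by move: vpi; rewrite -eT inE => /andP[_ /existsP[rho /andP[l vr]]]; exists rho.
Qed.

Lemma linked_meet pi rho : linked pi rho -> exists2 a, a \in blk pi & a \in rho.
Proof.
move=> l; have [piP rP npr _ [v vpr]] := linkedP cfg l.
have /(parPn D piP rP)[_ [a [aD api ar]]] : ~~ par pi rho.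
  apply/negP => pr; have := par_at_infinity cfg piP rP pr npr.
  by move=> e0; rewrite e0 inE in vpr.
by exists a => //; apply/blkP.
Qed.

(** With [block_dir_uniq]: each affine line of [pi] through its infinite point holds exactly one
    point of C, the one shared with the linked plane cutting that line. *)
Lemma block_over_dir pi v : pi \in P -> v \in affl pi ->
  exists2 a, a \in blk pi & a - v \in dir pi.
Proof.
move=> piP vpi; have [rho l vr] := partner_ex piP vpi.
have [a ab ar] := linked_meet l; exists a => //.
have [aD api] := blkP _ _ _ ab; have [vp v1] := affP _ _ vpi.
have a1 := cfg_D1 cfg aD.
by apply: (linkedB cfg l); apply/affP; rewrite memv_cap ?vp ?api.
Qed.

Lemma block_dir_uniq pi a b : pi \in P -> a \in D -> b \in D -> a \in pi ->
  b - a \in dir pi -> a = b.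
Proof.
move=> piP aD bD api abd; have api' : a \in affl pi.
  by apply/affP; rewrite (cfg_D1 cfg).
have [rho l ar] := partner_ex piP api'.
have apr : a \in (pi :&: rho)%VS by rewrite memv_cap api.
have bpr := linkedD cfg l apr abd; rewrite subrKC in bpr.
exact: (linked_blk_uniq cfg l aD bD apr bpr).
Qed.

Lemma linked_of_dir pi rho a : pi \in P -> rho \in P -> pi != rho -> a \in D ->
  a \in pi -> a \in rho -> (dir pi <= rho)%VS -> linked pi rho.
Proof.
move=> piP rP npr aD api ar dr; have [d1 dp dS] := dirP cfg piP.
have a1 := cfg_D1 cfg aD.
apply: (linkedI cfg piP rP npr (v := a)); first by apply/affP; rewrite memv_cap api.
apply: leq_trans (_ : (1 < \dim (dir pi + <[a]>))%N) _.
  rewrite dim_add_vline ?d1 //; apply/negP => /(subvP dS).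
  by rewrite (cfg_SigmaE cfg) a1 oner_eq0.
by rewrite dimvS // subv_add subv_cap dp dr /= -memvE memv_cap api.
Qed.

(** Other planes through [a] with the direction of [pi] are linked to [pi] along the line joining
    [a] to [dir pi], and only one linked plane passes through [a]. *)
Lemma same_dir_cases pi rho tau a : pi \in P -> rho \in P -> tau \in P ->
  pi != rho -> a \in D -> a \in pi -> a \in rho -> a \in tau ->
  dir rho = dir pi -> dir tau = dir pi -> tau = pi \/ tau = rho.
Proof.
move=> piP rP tP npr aD api ar at_ dr dt.
have [->|ntp] := eqVneq tau pi; [by left | right].
have lr : linked pi rho.
  by apply: (linked_of_dir (a := a)) => //; rewrite -dr; have [] := dirP cfg rP.
have lt : linked pi tau.
  by apply: (linked_of_dir (a := a)) => //; rewrite 1?eq_sym // -dt; have [] := dirP cfg tP.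
apply: (linked_disjoint cfg lt lr (v := a)) => //.
by apply/affP; rewrite (cfg_D1 cfg).
Qed.

(* Each point lies on no plane or on two planes with a given direction, so the
   number of such planes meeting [m] has a parity depending on whether [m]
   itself has that direction. *)
Lemma par_dir pi rho : pi \in P -> rho \in P -> par pi rho -> dir rho = dir pi.
Proof.
move=> piP rP pr; apply/eqP; apply: contraT => ndir.
pose Q := [set tau in P | dir tau == dir pi].
have count m : m \in P -> (#|[set tau in Q | ~~ par m tau]| =
    \sum_(a in blk m) #|[set tau in Q :\ m | a \in tau]|)%N.
  move=> mP; rewrite -(sum_card_swap _ _ (fun (tau : {vspace 'rV[F]_5}) a => a \in tau)).
  have e (tau : {vspace 'rV[F]_5}) : [set a in blk m | a \in tau] = blk m :&: blk tau.
    by apply/setP => a; rewrite !inE; case: (a \in D).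
  rewrite sum_leq1_card => [|tau]; last first.
    by rewrite !inE e => /and3P[ntm tP _]; apply: (blkI_le1 cfg); rewrite // eq_sym.
  apply: eq_card => tau; rewrite !inE e cards_eq0 setI_eq0 /parallel negb_or [m == tau]eq_sym.
  by case: (tau == m); rewrite ?andbF ?andbT /= ?andbA.
have same : [set tau in Q | ~~ par pi tau] = [set tau in Q | ~~ par rho tau].
  apply/setP => tau; rewrite !inE; case tP : (tau \in P) => //=; congr (_ && ~~ _).
  apply/idP/idP; first exact: (par_trans cfg).
  by apply: (par_trans cfg rP piP tP); rewrite par_sym.
have := count _ piP; rewrite same count //.
rewrite [RHS](eq_bigr (fun=> 1%N)); last first.
  move=> a ab; have [aD api] := blkP _ _ _ ab.
  have [tau l at_] := partner_ex piP (subsetP (blk_aff cfg pi) _ ab).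
  have [_ tP npt _ _] := linkedP cfg l; have dt := dir_linked cfg l.
  apply/eqP/cards1P; exists tau; apply/setP => sig; rewrite !inE.
  apply/idP/eqP => [/andP[/and3P[nsp sP /eqP ds] as_]|->].
    have [e|//] := same_dir_cases piP tP sP npt aD api at_ as_ (esym dt) ds.
    by rewrite e eqxx in nsp.
  by rewrite eq_sym npt tP -dt eqxx at_.
rewrite sum1_card (cfg_card_block cfg piP) => e.
suff : (2 %| q)%N by rewrite dvdn2 (cfg_odd cfg).
rewrite -e; apply: dvdn_sum => a ab; have [aD ar] := blkP _ _ _ ab.
have [->|[tau]] := set_0Vmem [set tau in Q :\ rho | a \in tau]; first by rewrite cards0.
rewrite !inE => /andP[/and3P[ntr tP /eqP dt] at_].
have ata : a \in affl tau by apply/affP; rewrite (cfg_D1 cfg).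
have [sig l as_] := partner_ex tP ata.
have [_ sP nts _ _] := linkedP cfg l; have ds := dir_linked cfg l.
have nsr : sig != rho by apply: contra ndir => /eqP <-; rewrite -ds dt.
rewrite (_ : [set _ in _ | _] = [set tau; sig]) ?cards2 ?nts //.
apply/setP => x; rewrite !inE.
apply/idP/orP => [/andP[/and3P[nx xP /eqP dx] ax]|[]/eqP->].
- have [->|->] := same_dir_cases tP sP xP nts aD at_ as_ ax (esym ds) (etrans dx (esym dt)).
    by left.
  by right.
- by rewrite ntr tP dt eqxx.
- by rewrite nsr sP -ds dt eqxx.
Qed.

End Partner.

(** * Two parallel classes with a common infinite point *)

Section Frame.
Variables (F : finFieldType) (q : nat) (Sigma : {vspace 'rV[F]_5}).
Variables (lam : 'cV[F]_5) (D : {set 'rV[F]_5}) (P : {set {vspace 'rV[F]_5}}).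
Hypothesis cfg : configuration q Sigma lam D P.
Implicit Types (a b v w : 'rV[F]_5) (pi rho tau U W X Y : {vspace 'rV[F]_5}).

Notation blk := (block D).
Notation affl := (aff lam).
Notation linked := (linked q lam P).
Notation par := (parallel D).
Notation dir := (dir q Sigma lam P).

Let affP := affP lam.
Let q7 : (7 <= q)%N. Proof. exact: cfg_ge7 cfg. Qed.

Lemma dir_vector pi : pi \in P ->
  exists n, [/\ n != 0, dot n lam = 0 & dir pi = <[n]>%VS].
Proof.
move=> piP; have [d1 dp dS] := dirP cfg piP.
have n0 : vpick (dir pi) != 0 by rewrite vpick0 -dimv_eq0 d1.
exists (vpick (dir pi)); split=> //; last exact: dim1_line (memv_pick _) n0.
by apply/eqP; rewrite -(cfg_SigmaE cfg) (subvP dS) ?memv_pick.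
Qed.

Lemma par_shared pi rho a : pi \in P -> rho \in P -> par pi rho -> a \in D ->
  a \in pi -> a \in rho -> pi = rho.
Proof.
move=> piP rP pr aD api ar; apply/eqP; apply: contraT => npr.
by have := par_notD pr npr api ar; rewrite aD.
Qed.

Lemma par_linkedN pi rho : par pi rho -> ~~ linked pi rho.
Proof.
move=> pr; apply/negP => l; have [piP rP npr _ [v]] := linkedP cfg l.
by rewrite (par_at_infinity cfg piP rP pr npr) inE.
Qed.

(** [X] and [Y] are not parallel, since [X0] and [Y0] are not; so they share a point of C, and by
    [par_dir] they also share the infinite point. *)
Lemma linked_classes X0 Y0 X Y : linked X0 Y0 -> X \in P -> Y \in P ->
  par X0 X -> par Y0 Y -> linked X Y.
Proof.
move=> l XP YP pX pY; have [X0P Y0P n0 _ _] := linkedP cfg l.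
have npXY : ~~ par X Y.
  apply/negP => pXY; have /negP[] := par_linkedN (par_trans cfg XP X0P Y0P
    (ltac:(by rewrite par_sym)) (par_trans cfg YP XP Y0P (ltac:(by rewrite par_sym)) (ltac:(by rewrite par_sym)))).
  exact: l.
have [nXY [a [aD aX aY]]] := parPn D XP YP npXY.
apply: (linked_of_dir cfg XP YP nXY aD aX aY).
rewrite (par_dir cfg X0P XP pX) (dir_linked cfg l) -(par_dir cfg Y0P YP pY).
by have [] := dirP cfg YP.
Qed.

Lemma plane_span3 pi a b n : pi \in P -> a \in affl pi -> b \in pi ->
  dot n lam = 0 -> n != 0 -> n \in pi -> b \notin (<[a]> + <[n]>)%VS ->
  pi = (<[a]> + <[b]> + <[n]>)%VS.
Proof.
move=> piP /affP[api a1] bpi nl n0 npi nb; apply/esym/eqP.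
have da : \dim <[a]> = 1%N.
  by rewrite dim_vline; case: eqP a1 => // ->; rewrite dot0 => /esym/eqP; rewrite oner_eq0.
have d3 : \dim (<[a]> + <[n]> + <[b]>) = 3%N.
  rewrite dim_add_vline // dim_add_vline ?da //; apply/negP => /vlineP[k en].
  by move: n0; rewrite en; move: nl; rewrite en dotZ a1 mulr1 => ->; rewrite scale0r eqxx.
rewrite -addvA [(<[b]> + _)%VS]addvC addvA eqEdim d3 (cfg_dimP cfg piP) leqnn andbT.
by rewrite !subv_add -!memvE api bpi npi.
Qed.

(* Otherwise all C-planes lie in the solid [X0 + X1], so that any two C-planes
   through a common point are linked. *)
Lemma par_cap_dim1 X0 X1 : X0 \in P -> X1 \in P -> par X0 X1 -> X0 != X1 ->
  \dim (X0 :&: X1) = 1%N.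
Proof.
move=> X0P X1P p01 n01; have := dim_capP cfg X0P X1P n01.
case d: (\dim _) => [|[|[|//]]] // _.
pose H := (X0 + X1)%VS.
have dH : \dim H = 4%N.
  have := dimv_sum_cap X0 X1; rewrite d (cfg_dimP cfg X0P) (cfg_dimP cfg X1P).
  by rewrite -/H; lia.
have [A /blkP[AD AX0]] := blk_neq0 cfg X0P.
have A1 := cfg_D1 cfg AD.
have [Y0 l0 AY0] : exists2 Y0, linked X0 Y0 & A \in Y0.
  by apply: (partner_ex cfg X0P); apply/affP.
have [_ Y0P nXY _ _] := linkedP cfg l0.
have YH Y : Y \in P -> par Y0 Y -> (Y <= H)%VS.
  move=> YP pY; have lX0 := linked_classes l0 X0P YP (par_refl _ _) pY.
  have lX1 := linked_classes l0 X1P YP p01 pY.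
  have [c0 /blkP[c0D c0X] c0Y] := linked_meet cfg lX0.
  have [c1 /blkP[c1D c1X] c1Y] := linked_meet cfg lX1.
  have [n [n0 nl dn]] := dir_vector X0P.
  have dY := esym (dir_linked cfg lX0); have [_ sdX0 _] := dirP cfg X0P.
  have [_ sdY _] := dirP cfg YP.
  have nX0 : n \in X0 by rewrite (subvP sdX0) // dn memv_line.
  have nY : n \in Y by rewrite (subvP sdY) // dY dn memv_line.
  rewrite (@plane_span3 Y c0 c1 n) //; last first.
  - apply: contraL c1X => c1s; apply/negP => c1X.
    have c1X0 : c1 \in X0.
      by apply: (subvP _ _ c1s); rewrite subv_add -!memvE c0X nX0.
    by have := par_notD p01 n01 c1X0 c1X; rewrite c1D.
  - by apply/affP; rewrite (cfg_D1 cfg).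
  rewrite !subv_add -!memvE; apply/andP; split; last by rewrite (subvP (addvSl _ _)).
  by rewrite (subvP (addvSl _ _)) // (subvP (addvSr _ _)).
have DH a : a \in D -> a \in H.
  by move=> aD; have [Y [YP aY pY]] := playfair_ex cfg Y0P aD; apply: (subvP (YH Y YP pY)).
have PH rho : rho \in P -> (rho <= H)%VS.
  move=> rP; have : (2 < #|blk rho|)%N by rewrite (cfg_card_block cfg rP) (leq_trans _ q7).
  case/card_gt2P => a [b [c [[/blkP[aD ar] /blkP[bD br] /blkP[cD cr]] [ab bc ca]]]].
  have d3 : \dim (<[a]> + <[b]> + <[c]>) = 3%N.
    rewrite dim_add_vline ?(@dim_span2 _ lam) ?(cfg_D1 cfg) //.
    by apply: (cfg_arc cfg); rewrite // eq_sym.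
  have /eqP <- : (<[a]> + <[b]> + <[c]>)%VS == rho.
    by rewrite eqEdim d3 (cfg_dimP cfg rP) leqnn !subv_add -!memvE ar br cr.
  by rewrite !subv_add -!memvE !DH.
have allL rho : rho \in P -> rho != X0 -> A \in rho -> linked X0 rho.
  move=> rP nr Ar; apply: (linkedI cfg X0P rP _ (v := A)); first by rewrite eq_sym.
    by apply/affP; rewrite memv_cap AX0.
  have := dimv_sum_cap X0 rho; rewrite (cfg_dimP cfg X0P) (cfg_dimP cfg rP).
  have : (\dim (X0 + rho) <= \dim H)%N by rewrite dimvS // subv_add !PH.
  rewrite dH; move: (\dim (X0 + rho)) (\dim (X0 :&: rho)) => d1 d2; clear; lia.
(* More than two planes pass through [A], yet only one of them can be linked to [X0] there. *)
have [|tau] := @card_gt_notin _ [set rho in P | A \in rho] [set X0; Y0].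
  by rewrite cards2 nXY (card_planes_at cfg AD) ltnS (leq_trans _ q7).
rewrite !inE negb_or => /andP[tP At] /andP[ntX /eqP[]].
apply: (linked_disjoint cfg (allL _ tP ntX At) l0 _ At AY0).
by apply/affP.
Qed.

End Frame.

Ltac row_ring := apply/rowP => ?; rewrite !mxE; ring.

(** If 2 = 0, the additive order of 1 divides both 2 and the odd order of [F]. *)
Lemma two_neq0 (F : finFieldType) : odd #|F| -> (2 : F) != 0.
Proof.
move=> oddF; apply/eqP => e.
have d2 : (#[1%R : F]%g %| 2)%N by rewrite order_dvdn; apply/eqP.
have dF : (#[1%R : F]%g %| #|F|)%N by rewrite -cardsT order_dvdG // inE.
have /eqP : coprime 2 #|F| by rewrite coprime2n.
move: (dvdn_gcd #[1%R : F]%g 2 #|F|); rewrite d2 dF /= => + g1.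
by rewrite g1 dvdn1 order_eq1 => /eqP/eqP; rewrite (oner_eq0 F).
Qed.

(** * Coordinates *)

Section Coordinates.
Variables (F : finFieldType) (q : nat) (Sigma : {vspace 'rV[F]_5}).
Variables (lam : 'cV[F]_5) (D : {set 'rV[F]_5}) (P : {set {vspace 'rV[F]_5}}).
Hypothesis cfg : configuration q Sigma lam D P.
Implicit Types (a b v w : 'rV[F]_5) (pi rho tau U W X Y : {vspace 'rV[F]_5}).

Notation blk := (block D).
Notation affl := (aff lam).
Notation linked := (linked q lam P).
Notation par := (parallel D).
Notation dir := (dir q Sigma lam P).

Let affP := affP lam.
Let q7 : (7 <= q)%N. Proof. exact: cfg_ge7 cfg. Qed.

Variables (X0 X1 Y0 Y1 : {vspace 'rV[F]_5}) (A00 A01 A10 A11 n : 'rV[F]_5).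
Hypotheses (l00 : linked X0 Y0) (X1P : X1 \in P) (Y1P : Y1 \in P).
Hypotheses (pX : par X0 X1) (nX : X0 != X1) (pY : par Y0 Y1) (nY : Y0 != Y1).
Hypotheses (A00D : A00 \in D) (A00X : A00 \in X0) (A00Y : A00 \in Y0).
Hypotheses (A01D : A01 \in D) (A01X : A01 \in X0) (A01Y : A01 \in Y1).
Hypotheses (A10D : A10 \in D) (A10X : A10 \in X1) (A10Y : A10 \in Y0).
Hypotheses (A11D : A11 \in D) (A11X : A11 \in X1) (A11Y : A11 \in Y1).
Hypotheses (n0 : n != 0) (nl : dot n lam = 0) (dirX0 : dir X0 = <[n]>%VS).

(** [X0] and [Y0] represent the two parallel classes with infinite point [n], and [Aij] is the point
    of C on [Xi] and [Yj]. The two classes will become the families x = const and y = const. *)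
Definition isX X := (X \in P) && par X0 X.
Definition isY Y := (Y \in P) && par Y0 Y.

Let X0P : X0 \in P. Proof. by have [] := linkedP cfg l00. Qed.
Let Y0P : Y0 \in P. Proof. by have [] := linkedP cfg l00. Qed.
Let X0X : isX X0. Proof. by rewrite /isX X0P par_refl. Qed.
Let X1X : isX X1. Proof. by rewrite /isX X1P. Qed.
Let Y0Y : isY Y0. Proof. by rewrite /isY Y0P par_refl. Qed.
Let Y1Y : isY Y1. Proof. by rewrite /isY Y1P. Qed.
Let XP X : isX X -> X \in P. Proof. by case/andP. Qed.
Let YP Y : isY Y -> Y \in P. Proof. by case/andP. Qed.

Lemma XY_linked X Y : isX X -> isY Y -> linked X Y.
Proof. by move=> /andP[? ?] /andP[? ?]; apply: (linked_classes cfg l00). Qed.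

Lemma isX_par X X' : isX X -> isX X' -> par X X'.
Proof. by move=> /andP[? ?] /andP[? ?]; apply: (par_trans cfg X0P). Qed.

Lemma isY_par Y Y' : isY Y -> isY Y' -> par Y Y'.
Proof. by move=> /andP[? ?] /andP[? ?]; apply: (par_trans cfg Y0P). Qed.

Lemma dirX X : isX X -> dir X = <[n]>%VS.
Proof. by move=> /andP[XP' pX0]; rewrite (par_dir cfg X0P XP' pX0). Qed.

Lemma dirY Y : isY Y -> dir Y = <[n]>%VS.
Proof.
by move=> /andP[YP' pY0]; rewrite (par_dir cfg Y0P YP' pY0) -(dir_linked cfg l00).
Qed.

Lemma n_in rho : rho \in P -> dir rho = <[n]>%VS -> n \in rho.
Proof. by move=> rP dr; have [_ /subvP s _] := dirP cfg rP; rewrite s // dr memv_line. Qed.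

Lemma uniq_modn rho a b k : rho \in P -> dir rho = <[n]>%VS -> a \in D -> b \in D ->
  a \in rho -> b = a + k *: n -> a = b.
Proof.
move=> rP dr aD bD ar eb; apply: (block_dir_uniq cfg rP) => //.
by rewrite eb addrC addKr dr memvZ ?memv_line.
Qed.

Lemma plane_param rho a b v : rho \in P -> dir rho = <[n]>%VS -> a \in D ->
  b \in D -> a != b -> a \in rho -> b \in rho -> v \in rho -> dot v lam = 1 ->
  exists t k, v = (1 - t) *: a + t *: b + k *: n.
Proof.
move=> rP dr aD bD ab ar br vr v1.
have a1 := cfg_D1 cfg aD; have b1 := cfg_D1 cfg bD.
have : v \in (<[a]> + <[b]> + <[n]>)%VS.
  rewrite -(@plane_span3 _ _ _ _ _ _ cfg rho a b n) //; [exact/affP|exact: n_in|].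
  apply/negP => /mem_span2P[s [t eb]]; have s1 : s = 1.
    by move: b1; rewrite eb !dotE a1 nl mulr0 addr0 mulr1.
  by case/eqP: ab; apply: (uniq_modn (k := t) rP dr); rewrite // eb s1 scale1r.
case/mem_span3P => s [t [k ev]]; exists t, k; rewrite ev.
have -> // : s = 1 - t.
by move: v1; rewrite ev !dotE a1 b1 nl !mulr1 mulr0 addr0 => <-; rewrite addrK.
Qed.

(** With these axes [A00], [A10], [A01], [A11] get the coordinates (0,0,0), (1,0,0), (0,1,0),
    (1,1,1) modulo [n], all on z = xy; [axis3] is the defect of the four points from a
    parallelogram. *)
Definition axis1 := A10 - A00.
Definition axis2 := A01 - A00.
Definition axis3 := A11 - A10 - A01 + A00.
Definition comb (a b c d k : F) : 'rV[F]_5 :=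
  a *: A00 + b *: axis1 + c *: axis2 + d *: axis3 + k *: n.

Lemma dot_comb r s t u k f : dot (comb r s t u k) f =
  r * dot A00 f + s * dot axis1 f + t * dot axis2 f + u * dot axis3 f + k * dot n f.
Proof. by rewrite /comb; move: axis1 axis2 axis3 => v1 v2 v3; rewrite !dotE. Qed.

Let nA0 : A00 != A01.
Proof. by apply/eqP => e; have := par_notD pY nY A00Y; rewrite e A01D => /(_ A01Y). Qed.
Let nA1 : A10 != A11.
Proof. by apply/eqP => e; have := par_notD pY nY A10Y; rewrite e A11D => /(_ A11Y). Qed.
Let nB0 : A00 != A10.
Proof. by apply/eqP => e; have := par_notD pX nX A00X; rewrite e A10D => /(_ A10X). Qed.
Let nB1 : A01 != A11.
Proof. by apply/eqP => e; have := par_notD pX nX A01X; rewrite e A11D => /(_ A11X). Qed.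

(** [X0] and [X1] meet in dimension one only, so their sum is the whole space; each is spanned by
    two of the four points together with [n]. *)
Lemma comb_span v : exists r s t u k, v = comb r s t u k.
Proof.
have aff_span v' : dot v' lam = 1 -> exists r s t u k, v' = comb r s t u k.
  move=> v1; have : v' \in (X0 + X1)%VS.
    suff -> : (X0 + X1)%VS = fullv by rewrite memvf.
    apply/eqP; rewrite eqEdim subvf dimvf /=.
    have := dimv_sum_cap X0 X1; rewrite (par_cap_dim1 cfg X0P X1P pX nX).
    by rewrite (cfg_dimP cfg X0P) (cfg_dimP cfg X1P) addn1 => -[->].
  have sub0 : (X0 <= <[A00]> + <[A01]> + <[n]>)%VS.
    rewrite -(@plane_span3 _ _ _ _ _ _ cfg X0 A00 A01 n) ?n_in //.
      by apply/affP; rewrite (cfg_D1 cfg).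
    apply/negP => /mem_span2P[s [t eb]]; have s1 : s = 1.
      by have := cfg_D1 cfg A01D; rewrite eb !dotE (cfg_D1 cfg A00D) nl mulr0 addr0 mulr1.
    by case/eqP: nA0; apply: (uniq_modn (k := t) X0P dirX0); rewrite // eb s1 scale1r.
  have sub1 : (X1 <= <[A10]> + <[A11]> + <[n]>)%VS.
    have d1 := dirX X1X.
    rewrite -(@plane_span3 _ _ _ _ _ _ cfg X1 A10 A11 n) ?n_in //.
      by apply/affP; rewrite (cfg_D1 cfg).
    apply/negP => /mem_span2P[s [t eb]]; have s1 : s = 1.
      by have := cfg_D1 cfg A11D; rewrite eb !dotE (cfg_D1 cfg A10D) nl mulr0 addr0 mulr1.
    by case/eqP: nA1; apply: (uniq_modn (k := t) X1P d1); rewrite // eb s1 scale1r.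
  case/memv_addP => x0 /(subvP sub0)/mem_span3P[s0 [t0 [k0 ->]]].
  case=> x1 /(subvP sub1)/mem_span3P[s1 [t1 [k1 ->]]] ->.
  exists (s0 + t0 + s1 + t1), (s1 + t1), (t0 + t1), t1, (k0 + k1).
  by rewrite /comb /axis1 /axis2 /axis3; row_ring.
have [a0 [b0 [c0 [d0 [k0 e]]]]] := aff_span (v + (1 - dot v lam) *: A00)
  (ltac:(by rewrite !dotE (cfg_D1 cfg A00D) mulr1 addrC subrK)).
exists (a0 - (1 - dot v lam)), b0, c0, d0, k0.
rewrite -[LHS](addrK ((1 - dot v lam) *: A00)) e /comb; row_ring.
Qed.

Lemma comb_inj r s t u k r' s' t' u' k' :
  comb r s t u k = comb r' s' t' u' k' ->
  [/\ r = r', s = s', t = t', u = u' & k = k'].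
Proof. exact: (spanning5_inj comb_span). Qed.

Let isX_nl X : isX X -> n \in X. Proof. by move=> h; apply: n_in (XP h) (dirX h). Qed.

Lemma X0_param v : v \in X0 -> dot v lam = 1 ->
  exists t k, v = comb 1 0 t 0 k.
Proof.
move=> vX v1; have [t [k ->]] := plane_param X0P dirX0 A00D A01D nA0 A00X A01X vX v1.
by exists t, k; rewrite /comb /axis1 /axis2 /axis3; row_ring.
Qed.

Lemma X1_param v : v \in X1 -> dot v lam = 1 ->
  exists t k, v = comb 1 1 t t k.
Proof.
move=> vX v1; have [t [k ->]] := plane_param X1P (dirX X1X) A10D A11D nA1 A10X A11X vX v1.
by exists t, k; rewrite /comb /axis1 /axis2 /axis3; row_ring.
Qed.

Lemma Y0_param v : v \in Y0 -> dot v lam = 1 ->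
  exists t k, v = comb 1 t 0 0 k.
Proof.
move=> vY v1; have [t [k ->]] := plane_param Y0P (dirY Y0Y) A00D A10D nB0 A00Y A10Y vY v1.
by exists t, k; rewrite /comb /axis1 /axis2 /axis3; row_ring.
Qed.

Lemma Y1_param v : v \in Y1 -> dot v lam = 1 ->
  exists t k, v = comb 1 t 1 t k.
Proof.
move=> vY v1; have [t [k ->]] := plane_param Y1P (dirY Y1Y) A01D A11D nB1 A01Y A11Y vY v1.
by exists t, k; rewrite /comb /axis1 /axis2 /axis3; row_ring.
Qed.

(** [X] is spanned by [n] and its points of C on [Y0] and [Y1]; [x] and [xi] are the
    [axis1]-coordinates of these two points. *)
Lemma X_param X : isX X -> exists b x xi k,
  [/\ b \in D, b \in X, b \in Y0, b = comb 1 x 0 0 k &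
  forall v, v \in affl X <->
    exists s k', v = comb 1 (x + s * (xi - x)) s (s * xi) k'].
Proof.
move=> XX; have [b0 /blkP[b0D b0X] b0Y] := linked_meet cfg (XY_linked XX Y0Y).
have [b1 /blkP[b1D b1X] b1Y] := linked_meet cfg (XY_linked XX Y1Y).
have nb : b0 != b1.
  by apply/eqP => e; have := par_notD pY nY b0Y; rewrite e b1D => /(_ b1Y).
have [x [k0 e0]] := Y0_param b0Y (cfg_D1 cfg b0D).
have [xi [k1 e1']] := Y1_param b1Y (cfg_D1 cfg b1D).
exists b0, x, xi, k0; split=> // v; split=> [/affP[vX v1]|[s [k' ev]]].
  have [t [k ->]] := plane_param (XP XX) (dirX XX) b0D b1D nb b0X b1X vX v1.
  exists t, ((1 - t) * k0 + t * k1 + k); rewrite e0 e1' /comb; row_ring.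
have {}ev : v = (1 - s) *: b0 + s *: b1 + (k' - (1 - s) * k0 - s * k1) *: n.
  by rewrite ev e0 e1' /comb; row_ring.
apply/affP; rewrite ev !dotE (cfg_D1 cfg b0D) (cfg_D1 cfg b1D) nl; split; last by ring.
by rewrite !memvD ?memvZ ?isX_nl.
Qed.

Lemma Y_param Y : isY Y -> exists c y eta k,
  [/\ c \in D, c \in Y, c \in X0, c = comb 1 0 y 0 k &
  forall v, v \in affl Y <->
    exists t k', v = comb 1 t (y + t * (eta - y)) (t * eta) k'].
Proof.
move=> YY; have [c0 /blkP[c0D c0X] c0Y] := linked_meet cfg (XY_linked X0X YY).
have [c1 /blkP[c1D c1X] c1Y] := linked_meet cfg (XY_linked X1X YY).
have nc : c0 != c1.
  by apply/eqP => e; have := par_notD pX nX c0X; rewrite e c1D => /(_ c1X).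
have [y [k0 e0]] := X0_param c0X (cfg_D1 cfg c0D).
have [eta [k1 e1']] := X1_param c1X (cfg_D1 cfg c1D).
exists c0, y, eta, k0; split=> // v; split=> [/affP[vY v1]|[s [k' ev]]].
  have [t [k ->]] := plane_param (YP YY) (dirY YY) c0D c1D nc c0Y c1Y vY v1.
  exists t, ((1 - t) * k0 + t * k1 + k); rewrite e0 e1' /comb; row_ring.
have {}ev : v = (1 - s) *: c0 + s *: c1 + (k' - (1 - s) * k0 - s * k1) *: n.
  by rewrite ev e0 e1' /comb; row_ring.
apply/affP; rewrite ev !dotE (cfg_D1 cfg c0D) (cfg_D1 cfg c1D) nl; split; last by ring.
by rewrite !memvD ?memvZ ?(n_in (YP YY) (dirY YY)).
Qed.

Lemma dir_pt rho v : rho \in P -> dir rho = <[n]>%VS -> v \in affl rho ->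
  exists a k, [/\ a \in D, a \in rho & a = v + k *: n].
Proof.
move=> rP dr vr; have [a /blkP[aD ar]] := block_over_dir cfg rP vr.
rewrite dr => /vlineP[k e]; exists a, k; split=> //.
by rewrite -e subrKC.
Qed.

(* For [Y != Y0], [eta != y] in [Y_param] would give [Y] a point of [D] whose
   [axis2]-coordinate is 0, and such a point lies on [Y0]. *)
Lemma Y_const Y : isY Y -> exists c y k,
  [/\ c \in D, c \in Y, c \in X0, c = comb 1 0 y 0 k &
  forall v, v \in affl Y <-> exists t k', v = comb 1 t y (t * y) k'].
Proof.
move=> YY; have [c [y [eta [k [cD cY cX ec YE]]]]] := Y_param YY.
suff e : eta = y.
  exists c, y, k; split=> // v; rewrite YE; split=> -[t [k' ->]];
  by exists t, k'; rewrite e subrr mulr0 addr0.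
have [eY|nYY] := eqVneq Y Y0.
  have : A10 \in affl Y by rewrite eY; apply/affP; rewrite (cfg_D1 cfg).
  rewrite YE => -[t [k1 e10]].
  have : A10 = comb 1 1 0 0 0 by rewrite /comb /axis1; row_ring.
  rewrite e10 => /comb_inj[_ -> + _ _]; rewrite mul1r subrKC => ->.
  have : A00 \in affl Y by rewrite eY; apply/affP; rewrite (cfg_D1 cfg).
  rewrite YE => -[s [k2 e00]].
  have : A00 = comb 1 0 0 0 0 by rewrite /comb; row_ring.
  by rewrite e00 => /comb_inj[_ -> + _ _]; rewrite mul0r addr0.
apply/eqP; apply: contraT => nye.
pose t0 := - y / (eta - y).
have d0 : eta - y != 0 by rewrite subr_eq0.
have t0E : y + t0 * (eta - y) = 0 by rewrite /t0 divfK // addrN.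
have [a [k1 [aD aY ea]]] : exists a k1, [/\ a \in D, a \in Y &
    a = comb 1 t0 0 (t0 * eta) 0 + k1 *: n].
  apply: (dir_pt (YP YY) (dirY YY)); rewrite YE; exists t0, 0.
  by rewrite t0E.
have [X [XP' aX pX0]] := playfair_ex cfg X0P aD.
have XX : isX X by rewrite /isX XP' pX0.
have [b [x [xi [kb [bD bX bY eb XE]]]]] := X_param XX.
have : a \in affl X by apply/affP; rewrite (cfg_D1 cfg).
rewrite XE => -[s [k2 ea2]].
have ea' : a = comb 1 t0 0 (t0 * eta) k1 by rewrite ea /comb; row_ring.
move: (ea2); rewrite {1}ea' => /comb_inj[_ _ s0 _ _].
have eab : a = b.
  apply/esym/(@uniq_modn X b a (k2 - kb) XP' (dirX XX) bD aD bX).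
  by rewrite ea2 eb -s0 /comb; row_ring.
have := par_notD (isY_par Y0Y YY) (ltac:(by rewrite eq_sym)) bY.
by rewrite -eab aD => /(_ aY).
Qed.

Lemma X_const X : isX X -> exists b x k,
  [/\ b \in D, b \in X, b \in Y0, b = comb 1 x 0 0 k &
  forall v, v \in affl X <-> exists s k', v = comb 1 x s (s * x) k'].
Proof.
move=> XX; have [b [x [xi [k [bD bX bY eb XE]]]]] := X_param XX.
suff e : xi = x.
  exists b, x, k; split=> // v; rewrite XE; split=> -[t [k' ->]];
  by exists t, k'; rewrite e subrr mulr0 addr0.
(* On this line z = xy reads s(1 - s)(xi - x) = 0, which is void at s = 0 and s = 1; the value s = 2
   decides. *)
have [a [k1 [aD aX ea]]] : exists a k1, [/\ a \in D, a \in X &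
    a = comb 1 (x + 2 * (xi - x)) 2 (2 * xi) 0 + k1 *: n].
  by apply: (dir_pt (XP XX) (dirX XX)); rewrite XE; exists 2, 0.
have {}ea : a = comb 1 (x + 2 * (xi - x)) 2 (2 * xi) k1.
  by rewrite ea /comb; row_ring.
have [Y [YP' aY pY0]] := playfair_ex cfg Y0P aD.
have [c [y [kc [_ _ _ _ YE]]]] := Y_const (ltac:(by rewrite /isY YP' pY0) : isY Y).
have : a \in affl Y by apply/affP; rewrite (cfg_D1 cfg).
rewrite YE => -[t [k2]]; rewrite ea => /comb_inj[_ e1' e2' e3' _].
have two0 : (2 : F) != 0.
  by apply: two_neq0; rewrite (cfg_card_F cfg) (cfg_odd cfg).
have et : xi = t by apply: (mulfI two0); rewrite e3' -e2' mulrC.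
have : (x + 2 * (xi - x)) - xi = 0 by rewrite e1' et subrr.
by rewrite (_ : _ - xi = xi - x); [move/eqP; rewrite subr_eq0 => /eqP | ring].
Qed.

Definition pt x y k := comb 1 x y (x * y) k.

Lemma pt_inj x y k x' y' k' : pt x y k = pt x' y' k' -> [/\ x = x', y = y' & k = k'].
Proof. by move=> /comb_inj[]. Qed.

Lemma D_pt a : a \in D -> exists x y k, a = pt x y k.
Proof.
move=> aD; have [Y [YP' aY pY0]] := playfair_ex cfg Y0P aD.
have [c [y [kc [_ _ _ _ YE]]]] := Y_const (ltac:(by rewrite /isY YP' pY0) : isY Y).
have : a \in affl Y by apply/affP; rewrite (cfg_D1 cfg).
by rewrite YE => -[t [k ->]]; exists t, y, k.
Qed.

Lemma X_pt X x y k : isX X -> pt x y k \in D -> pt x y k \in X ->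
  exists2 b, [/\ b \in D, b \in X & b \in Y0] & exists kb, b = comb 1 x 0 0 kb.
Proof.
move=> XX aD aX; have [b [x' [kb [bD bX bY eb XE]]]] := X_const XX.
have : pt x y k \in affl X by apply/affP; rewrite (cfg_D1 cfg).
rewrite XE => -[s [k']] /comb_inj[_ ex _ _ _].
by exists b => //; exists kb; rewrite ex.
Qed.

Lemma Y_pt Y x y k : isY Y -> pt x y k \in D -> pt x y k \in Y ->
  exists2 b, [/\ b \in D, b \in Y & b \in X0] & exists kb, b = comb 1 0 y 0 kb.
Proof.
move=> YY aD aY; have [b [y' [kb [bD bY bX eb YE]]]] := Y_const YY.
have : pt x y k \in affl Y by apply/affP; rewrite (cfg_D1 cfg).
rewrite YE => -[s [k']] /comb_inj[_ _ ey _ _].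
by exists b => //; exists kb; rewrite ey.
Qed.

(** The planes of the first class through the two points meet [Y0] in points of C that agree modulo
    [n]; these coincide, and then so do the planes. *)
Lemma same_x x y k y' k' : pt x y k \in D -> pt x y' k' \in D ->
  exists X, [/\ isX X, pt x y k \in X & pt x y' k' \in X].
Proof.
move=> aD bD; have [X [XP1 aX p1]] := playfair_ex cfg X0P aD.
have [X' [XP2 bX p2]] := playfair_ex cfg X0P bD.
have XX : isX X by rewrite /isX XP1. have XX' : isX X' by rewrite /isX XP2.
have [c [cD cX cY] [kc ec]] := X_pt XX aD aX.
have [d [dD dX dY] [kd ed]] := X_pt XX' bD bX.
have ecd : c = d.
  apply: (@uniq_modn Y0 c d (kd - kc) Y0P (dirY Y0Y)) => //.
  by rewrite ec ed /comb; row_ring.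
have eX : X = X'.
  by apply: (par_shared XP1 XP2 (isX_par XX XX') cD cX); rewrite ecd.
by exists X; rewrite {3}eX.
Qed.

Lemma same_y x y k x' k' : pt x y k \in D -> pt x' y k' \in D ->
  exists Y, [/\ isY Y, pt x y k \in Y & pt x' y k' \in Y].
Proof.
move=> aD bD; have [Y [YP1 aY p1]] := playfair_ex cfg Y0P aD.
have [Y' [YP2 bY p2]] := playfair_ex cfg Y0P bD.
have YY : isY Y by rewrite /isY YP1. have YY' : isY Y' by rewrite /isY YP2.
have [c [cD cY cX] [kc ec]] := Y_pt YY aD aY.
have [d [dD dY dX] [kd ed]] := Y_pt YY' bD bY.
have ecd : c = d.
  apply: (@uniq_modn X0 c d (kd - kc) X0P dirX0) => //.
  by rewrite ec ed /comb; row_ring.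
have eY : Y = Y'.
  by apply: (par_shared YP1 YP2 (isY_par YY YY') cD cY); rewrite ecd.
by exists Y; rewrite {3}eY.
Qed.

Lemma pt_uniq x y k k' : pt x y k \in D -> pt x y k' \in D -> k = k'.
Proof.
move=> aD bD; have [X [XX aX bX]] := same_x aD bD.
have : pt x y k = pt x y k'.
  apply: (@uniq_modn X _ _ (k' - k) (XP XX) (dirX XX)) => //.
  by rewrite /pt /comb; row_ring.
by case/pt_inj.
Qed.

(** By [pt_uniq] the map to (x, y) is injective on [D], and [D] has as many elements as the (x,
    y)-plane. *)
Lemma pt_ex x y : exists k, pt x y k \in D.
Proof.
have [k0 [k1 [k2 [k3 [k4 h]]]]] := coordinates5 comb_span.
pose f a := (dot a k1, dot a k2).
have fE x' y' k : f (pt x' y' k) = (x', y').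
  by have [_ e1' e2' _ _] := h 1 x' y' (x' * y') k; congr (_, _).
have f_inj : {in D &, injective f}.
  move=> a b aD bD; have [x1 [y1 [ka ea]]] := D_pt aD.
  have [x2 [y2 [kb eb]]] := D_pt bD; rewrite ea eb !fE => -[ex ey].
  by rewrite ex ey in ea *; congr pt; apply: (@pt_uniq x2 y2); rewrite -?ea -?eb.
have : (x, y) \in f @: D.
  suff -> : f @: D = setT by rewrite inE.
  apply/eqP; rewrite eqEcard subsetT card_in_imset // cardsT card_prod.
  by rewrite (cfg_card_D cfg) (cfg_card_F cfg) -mulnn leqnn.
case/imsetP => a aD; have [x1 [y1 [ka ea]]] := D_pt aD.
by rewrite ea fE => -[-> ->]; exists ka; rewrite -ea.
Qed.

(** A plane containing [n] is linked to the plane of the first class through any of its points of C,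
    and linked planes have the same direction. *)
Lemma other_dir_n rho : rho \in P -> dir rho != <[n]>%VS -> n \notin rho.
Proof.
move=> rP dr; apply/negP => nr; have [a /blkP[aD ar]] := blk_neq0 cfg rP.
have [X [XP' aX pX0]] := playfair_ex cfg X0P aD.
have XX : isX X by rewrite /isX XP'.
have nXr : X != rho by apply: contra dr => /eqP <-; rewrite dirX.
have l : linked X rho.
  by apply: (linked_of_dir cfg XP' rP nXr aD aX ar); rewrite dirX // -memvE.
by case/eqP: dr; rewrite -(dir_linked cfg l) dirX.
Qed.

Lemma other_dir_x rho x y k y' k' : rho \in P -> dir rho != <[n]>%VS ->
  pt x y k \in D -> pt x y' k' \in D -> pt x y k \in rho -> pt x y' k' \in rho ->
  y = y'.
Proof.
move=> rP dr aD bD ar br; have [X [XX aX bX]] := same_x aD bD.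
have nXr : X != rho by apply: contra dr => /eqP <-; rewrite dirX.
by have /pt_inj[] := blkI_uniq cfg (XP XX) rP nXr aD bD aX ar bX br.
Qed.

Lemma other_dir_y rho x y k x' k' : rho \in P -> dir rho != <[n]>%VS ->
  pt x y k \in D -> pt x' y k' \in D -> pt x y k \in rho -> pt x' y k' \in rho ->
  x = x'.
Proof.
move=> rP dr aD bD ar br; have [Y [YY aY bY]] := same_y aD bD.
have nYr : Y != rho by apply: contra dr => /eqP <-; rewrite dirY.
by have /pt_inj[] := blkI_uniq cfg (YP YY) rP nYr aD bD aY ar bY br.
Qed.

(** By [other_dir_x] the first coordinate is injective on the [q] points of C in [rho], hence takes
    every value. *)
Lemma other_dir_pt rho x : rho \in P -> dir rho != <[n]>%VS ->
  exists y k, pt x y k \in D /\ pt x y k \in rho.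
Proof.
move=> rP dr; have [k0 [k1 [k2 [k3 [k4 h]]]]] := coordinates5 comb_span.
have fE x' y' k : dot (pt x' y' k) k1 = x'.
  by have [_ e1' _ _ _] := h 1 x' y' (x' * y') k.
pose f a := dot a k1; have f_inj : {in blk rho &, injective f}.
  move=> a b /blkP[aD ar] /blkP[bD br]; have [x1 [y1 [ka ea]]] := D_pt aD.
  have [x2 [y2 [kb eb]]] := D_pt bD; rewrite /f ea eb !fE => ex.
  rewrite -ex in eb *; rewrite ea in aD ar; rewrite eb in bD br.
  have ey := other_dir_x rP dr aD bD ar br.
  by rewrite -ey in bD *; rewrite (pt_uniq aD bD).
have : x \in f @: blk rho.
  suff -> : f @: blk rho = setT by rewrite inE.
  apply/eqP; rewrite eqEcard subsetT card_in_imset // cardsT.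
  by rewrite (cfg_card_block cfg rP) (cfg_card_F cfg) leqnn.
case/imsetP => a /blkP[aD ar]; have [x1 [y1 [ka ea]]] := D_pt aD.
by rewrite ea /f fE => ->; exists y1, ka; rewrite -ea.
Qed.

(** Through a point of C only two planes have direction [n], one in each class, and these keep x or
    y constant. *)
Lemma transversal_dir rho x y k x' y' k' : rho \in P ->
  pt x y k \in D -> pt x' y' k' \in D -> pt x y k \in rho -> pt x' y' k' \in rho ->
  x != x' -> y != y' -> dir rho != <[n]>%VS.
Proof.
move=> rP aD bD ar br nx ny; apply/negP => /eqP dr.
have [X [XP' aX pX0]] := playfair_ex cfg X0P aD.
have [Y [YP' aY pY0]] := playfair_ex cfg Y0P aD.
have XX : isX X by rewrite /isX XP'. have YY : isY Y by rewrite /isY YP'.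
have [_ _ nXY _ _] := linkedP cfg (XY_linked XX YY).
have b1 := cfg_D1 cfg bD; have a1 := cfg_D1 cfg aD.
have dX := dirX XX; have dY := dirY YY.
have [e|e] := same_dir_cases cfg XP' YP' rP nXY aD aX aY ar (etrans dY (esym dX)) (etrans dr (esym dX)).
  rewrite e in br; have [c [x1 [kc [_ _ _ _ XE]]]] := X_const XX.
  have : pt x y k \in affl X by apply/affP.
  have : pt x' y' k' \in affl X by apply/affP.
  rewrite !XE => -[s [ks]] /comb_inj[_ e1' _ _ _] [s' [ks']] /comb_inj[_ e2' _ _ _].
  by rewrite e1' e2' eqxx in nx.
rewrite e in br; have [c [y1 [kc [_ _ _ _ YE]]]] := Y_const YY.
have : pt x y k \in affl Y by apply/affP.
have : pt x' y' k' \in affl Y by apply/affP.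
rewrite !YE => -[s [ks]] /comb_inj[_ _ e1' _ _] [s' [ks']] /comb_inj[_ _ e2' _ _].
by rewrite e1' e2' eqxx in ny.
Qed.

(* Modulo [n] a further plane lies in a plane of the affine 3-space in which
   [D] becomes the hyperbolic paraboloid [z = xy]; a section of it that is
   a bijection between the x- and the y-axis is a line. *)
Lemma other_dir_line rho : rho \in P -> dir rho != <[n]>%VS ->
  exists m c, forall x y k, pt x y k \in D -> pt x y k \in rho -> y = m * x + c.
Proof.
move=> rP dr; have nr := other_dir_n rP dr.
have two0 : (2 : F) != 0.
  by apply: two_neq0; rewrite (cfg_card_F cfg) (cfg_odd cfg).
have [w wH] : exists w, w \notin (rho + <[n]>)%VS.
  apply/existsP; apply: contraT; rewrite negb_exists => /forallP all_in.
  have : (fullv <= rho + <[n]>)%VS by apply/subvP => v _; move: (all_in v); rewrite negbK.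
  move/dimvS; rewrite dim_add_vline // (cfg_dimP cfg rP) dimvf /=.
  by rewrite dim_matrix.
have [f fw f0] := separating_functional wH.
have fn : dot n f = 0 by apply: f0; rewrite (subvP (addvSr _ _)) ?memv_line.
set de := dot A00 f; set al := dot axis1 f; set be := dot axis2 f; set ga := dot axis3 f.
(* As [f] kills both [rho] and [n], it gives the equation of the projection of [rho] from [n],
   restricted to z = xy. *)
have eqn x y k : pt x y k \in rho -> de + x * al + y * be + x * y * ga = 0.
  move=> pr; have : dot (pt x y k) f = 0 by apply: f0; rewrite (subvP (addvSl _ _)).
  by rewrite /pt dot_comb fn mulr0 addr0 mul1r.
have nz : ~ [/\ de = 0, al = 0, be = 0 & ga = 0].
  case=> d1 a1 b1 g1; move: fw; have [r [s [t [u [k ->]]]]] := comb_span w.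
  rewrite dot_comb fn -/de -/al -/be -/ga d1 a1 b1 g1 !mulr0 !addr0 => /esym/eqP.
  by rewrite oner_eq0.
clearbody de al be ga.
have ga0 : ga = 0.
  apply/eqP; apply: contraT => g0.
  (* At x = -be/ga the terms in y cancel, which fixes [de]. The equation then factors as (x +
     be/ga)(ga y + al) = 0, so y would be constant at all other x. *)
  have [y0 [k0 [D0 /eqn r0]]] := other_dir_pt (- be / ga) rP dr.
  have c0 : de = be * al / ga.
    apply/eqP; rewrite -subr_eq0; apply/eqP; apply: etrans r0; by field.
  have other t : t != 0 -> exists k,
      pt (- be / ga + t) (- al / ga) k \in D /\ pt (- be / ga + t) (- al / ga) k \in rho.
    move=> t0; have [y [k [D1 r1]]] := other_dir_pt (- be / ga + t) rP dr.
    suff e : y = - al / ga by exists k; rewrite -e.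
    have /eqP : t * (ga * y + al) = 0 by apply: etrans (eqn _ _ _ r1); rewrite c0; field.
    rewrite mulf_eq0 (negPf t0) /= => /eqP e.
    apply: (mulfI g0); rewrite -[LHS](addrK al) e; field.
    exact: g0.
  have [k1 [D1 r1]] := other 1 (oner_neq0 _).
  have [k2 [D2 r2]] := other 2 two0.
  have /addrI/eqP := other_dir_y rP dr D1 D2 r1 r2.
  by rewrite eq_sym -subr_eq0 (_ : 2 - 1 = 1) ?oner_eq0 //; ring.
have be0 : be != 0.
  apply/eqP => b0; apply: nz.
  have [y0 [k0 [_ /eqn]]] := other_dir_pt 0 rP dr.
  have [y1 [k1 [_ /eqn]]] := other_dir_pt 1 rP dr.
  by rewrite b0 ga0 !mulr0 !addr0 mul1r mul0r addr0 => + d0; rewrite d0 add0r.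
exists (- al / be), (- de / be) => x y k _ /eqn.
rewrite ga0 mulr0 addr0 => e; apply: (mulIf be0).
rewrite -[LHS](addKr (de + x * al)) e; field; exact: be0.
Qed.

(** The plane joining the points of C above x = 0 and x = 1 on the line projects into that line. A
    functional that is 0 on this plane and 1 on [n] then expresses [k] through x, y and xy, which is
    quadratic in x. *)
Lemma line_quadratic m c : m != 0 -> exists r s t, forall x k,
  pt x (m * x + c) k \in D -> k = r + s * x + t * x ^+ 2.
Proof.
move=> m0; have [k0 D0] := pt_ex 0 c; have [k1 D1] := pt_ex 1 (m + c).
have n01 : (0 : F) != 1 by rewrite eq_sym oner_neq0.
have nc : c != m + c.
  by apply/eqP => e; case/eqP: m0; apply: (addIr c); rewrite add0r -e.
have nD : pt 0 c k0 != pt 1 (m + c) k1 by apply/eqP => /pt_inj[/eqP]; rewrite (negPf n01).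
have [rho [rP r0 r1]] := cfg_join cfg D0 D1 nD.
have dr := transversal_dir rP D0 D1 r0 r1 n01 nc.
have [m' [c' line]] := other_dir_line rP dr.
have ec : c = c' by have := line _ _ _ D0 r0; rewrite mulr0 add0r.
have em : m = m'.
  by have := line _ _ _ D1 r1; rewrite mulr1 ec => /addIr.
have [g gn g0] := separating_functional (other_dir_n rP dr).
exists (- (dot A00 g + c * dot axis2 g)), (- (dot axis1 g + m * dot axis2 g + c * dot axis3 g)).
exists (- (m * dot axis3 g)) => x k D2.
have [y [k2 [D3 r3]]] := other_dir_pt x rP dr.
have ey : y = m * x + c by rewrite (line _ _ _ D3 r3) em ec.
rewrite ey in D3 r3; have := g0 _ r3; rewrite (pt_uniq D3 D2) /pt dot_comb gn.
move: (dot A00 g) (dot axis1 g) (dot axis2 g) (dot axis3 g) => d0 d1 d2 d3 e.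
by apply/eqP; rewrite -subr_eq0; apply/eqP; rewrite -[RHS]e; ring.
Qed.

End Coordinates.

Definition surface (F : finFieldType) (p e1 e2 e3 n : 'rV[F]_5) (h : F -> F -> F)
    (x y : F) : 'rV[F]_5 :=
  p + x *: e1 + y *: e2 + (x * y) *: e3 + h x y *: n.

Definition frame (F : finFieldType) (lam : 'cV[F]_5) (p e1 e2 e3 n : 'rV[F]_5) :=
  [/\ dot p lam = 1, dot e1 lam = 0, dot e2 lam = 0, dot e3 lam = 0 & dot n lam = 0] /\
  (forall v, exists r s t u k, v = r *: p + s *: e1 + t *: e2 + u *: e3 + k *: n).

Theorem surface_frame (F : finFieldType) q Sigma lam (D : {set 'rV[F]_5}) P :
  configuration q Sigma lam D P ->
  exists p e1 e2 e3 n h, [/\ frame lam p e1 e2 e3 n,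
    forall a, a \in D <-> exists x y, a = surface p e1 e2 e3 n h x y &
    forall m c, m != 0 -> exists r s t, forall x,
      h x (m * x + c) = r + s * x + t * x ^+ 2].
Proof.
move=> cfg; have q7 := cfg_ge7 cfg.
have [X0 X0P] : exists X0, X0 \in P.
  apply/set0Pn; rewrite -card_gt0 (card_P cfg); lia.
have [A00 /blkP[A00D A00X]] := blk_neq0 cfg X0P.
have [Y0 l00 A00Y] : exists2 Y0, linked q lam P X0 Y0 & A00 \in Y0.
  by apply: (partner_ex cfg X0P); apply/affP; rewrite (cfg_D1 cfg).
have [_ Y0P _ _ _] := linkedP cfg l00.
have other_in_class Z : Z \in P -> exists Z', [/\ Z' \in P, parallel D Z Z' & Z != Z'].
  move=> ZP; have [|Z'] := @card_gt_notin _ [set rho in P | parallel D Z rho] [set Z].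
    by rewrite cards1 (card_class cfg ZP) (leq_trans _ q7).
  by rewrite !inE => /andP[ZP' pZ] nZ; exists Z'; split; rewrite // eq_sym.
have [X1 [X1P pX nX]] := other_in_class _ X0P.
have [Y1 [Y1P pY nY]] := other_in_class _ Y0P.
have l := linked_classes cfg l00.
have [A01 /blkP[A01D A01X] A01Y] := linked_meet cfg (l _ _ X0P Y1P (par_refl _ _) pY).
have [A10 /blkP[A10D A10X] A10Y] := linked_meet cfg (l _ _ X1P Y0P pX (par_refl _ _)).
have [A11 /blkP[A11D A11X] A11Y] := linked_meet cfg (l _ _ X1P Y1P pX pY).
have [n [n0 nl dX]] := dir_vector cfg X0P.
(* By [pt_ex] the default [0] is never taken. *)
pose h x y := odflt 0 [pick k | pt A00 A01 A10 A11 n x y k \in D].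
have D1 := cfg_D1 cfg.
have hD x y : pt A00 A01 A10 A11 n x y (h x y) \in D.
  rewrite /h; case: pickP => [//|none].
  have [k Dk] : exists k, pt A00 A01 A10 A11 n x y k \in D.
    by apply: (pt_ex (X0 := X0) (X1 := X1) (Y0 := Y0) (Y1 := Y1) cfg).
  by have := none k; rewrite Dk.
exists A00, (axis1 A00 A10), (axis2 A00 A01), (axis3 A00 A01 A10 A11), n, h.
have ptE x y : surface A00 (axis1 A00 A10) (axis2 A00 A01) (axis3 A00 A01 A10 A11) n h x y =
    pt A00 A01 A10 A11 n x y (h x y).
  by rewrite /surface /pt /comb scale1r.
split.
- split; first by rewrite /axis1 /axis2 /axis3 !dotE nl !D1 //; split=> //; ring.
  exact: (comb_span cfg l00 X1P pX nX pY nY).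
- move=> a; split=> [aD|[x [y ->]]]; last by rewrite ptE.
  have [x [y [k ea]]] : exists x y k, a = pt A00 A01 A10 A11 n x y k.
    by apply: (D_pt (X0 := X0) (X1 := X1) (Y0 := Y0) (Y1 := Y1) cfg).
  exists x, y; rewrite ptE ea; congr pt; rewrite ea in aD.
  by apply: (pt_uniq (X0 := X0) (X1 := X1) (Y0 := Y0) (Y1 := Y1) cfg) aD (hD _ _).
- move=> m c m0.
  have [r [s [t hk]]] : exists r s t, forall x k,
      pt A00 A01 A10 A11 n x (m * x + c) k \in D -> k = r + s * x + t * x ^+ 2.
    by apply: (line_quadratic (X0 := X0) (X1 := X1) (Y0 := Y0) (Y1 := Y1) cfg).
  by exists r, s, t => x; apply: hk.
Qed.

(** * Functions that are quadratic on lines *)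

(** Divided differences: [q12] and [q23] are the first ones, and their difference is a nonzero
    multiple of [t]. *)
Lemma quadratic_three_roots (F : fieldType) (r s t x1 x2 x3 : F) :
  x1 != x2 -> x2 != x3 -> x3 != x1 ->
  r + s * x1 + t * x1 ^+ 2 = 0 -> r + s * x2 + t * x2 ^+ 2 = 0 ->
  r + s * x3 + t * x3 ^+ 2 = 0 -> [/\ r = 0, s = 0 & t = 0].
Proof.
move=> n12 n23 n31 e1 e2 e3.
have q12 : s + t * (x1 + x2) = 0.
  have /eqP : (x1 - x2) * (s + t * (x1 + x2)) = 0.
    by apply: etrans (subrr (0 : F)); rewrite -{1}e1 -e2; ring.
  by rewrite mulf_eq0 subr_eq0 (negPf n12) => /eqP.
have q23 : s + t * (x2 + x3) = 0.
  have /eqP : (x2 - x3) * (s + t * (x2 + x3)) = 0.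
    by apply: etrans (subrr (0 : F)); rewrite -{1}e2 -e3; ring.
  by rewrite mulf_eq0 subr_eq0 (negPf n23) => /eqP.
have t0 : t = 0.
  have /eqP : (x3 - x1) * t = 0.
    by apply: etrans (subrr (0 : F)); rewrite -{1}q23 -q12; ring.
  by rewrite mulf_eq0 subr_eq0 (negPf n31) => /eqP.
move: q12 e1; rewrite t0 mul0r addr0 => ->.
by rewrite !mul0r !addr0.
Qed.

(** Slope 0 and vertical lines are left out: they are the traces of the two classes through [n],
    which [line_quadratic] does not treat. *)
Definition quadratic_on_lines (F : fieldType) (h : F -> F -> F) :=
  forall m c, m != 0 -> exists r s t, forall x,
    h x (m * x + c) = r + s * x + t * x ^+ 2.

(** A line through (0, 1) of slope other than 0, 1, -1 meets y = x and y = -x in two further zeros,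
    so [h] vanishes on it ([pencil]). A line of slope 1 or -1 that misses (0, 1) meets at least
    three of these lines in distinct points, so [h] vanishes there too ([off]). Every point except
    (0, 1) is on such a line. *)
Lemma quadratic_on_lines_zero (F : finFieldType) (h : F -> F -> F) :
  (7 <= #|F|)%N -> odd #|F| -> quadratic_on_lines h ->
  (forall x, h x x = 0) -> (forall x, h x (- x) = 0) -> h 0 1 = 0 ->
  forall x y, h x y = 0.
Proof.
move=> q7 /two_neq0 two0 hq h1 h2 h01 x y.
have zero3 m c x1 x2 x3 z : m != 0 -> x1 != x2 -> x2 != x3 -> x3 != x1 ->
    h x1 (m * x1 + c) = 0 -> h x2 (m * x2 + c) = 0 -> h x3 (m * x3 + c) = 0 ->
    h z (m * z + c) = 0.
  move=> m0 n12 n23 n31; have [r [s [t e]]] := hq m c m0; rewrite !e => e1 e2 e3.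
  have [-> -> ->] := quadratic_three_roots n12 n23 n31 e1 e2 e3.
  by rewrite !mul0r !addr0.
have nm1 : (1 : F) != -1.
  by rewrite -subr_eq0 opprK.
have pencil m z : m != 0 -> m != 1 -> m != -1 -> h z (m * z + 1) = 0.
  move=> m0 m1 m2; have d1 : 1 - m != 0 by rewrite subr_eq0 eq_sym.
  have d2 : 1 + m != 0 by rewrite addrC -[1]opprK subr_eq0.
  have n1 : 0 != (1 - m)^-1 by rewrite eq_sym invr_eq0.
  have n2 : - (1 + m)^-1 != 0 by rewrite oppr_eq0 invr_eq0.
  apply: (zero3 _ _ 0 ((1 - m)^-1) (- (1 + m)^-1)) => //.
  - apply/eqP => e; case/eqP: two0.
    have : (1 - m) * (1 + m) * ((1 - m)^-1 + (1 + m)^-1) = 0 by rewrite e addNr mulr0.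
    by move=> <-; field; rewrite d1 d2.
  - by rewrite mulr0 add0r.
  - by rewrite (_ : _ + 1 = (1 - m)^-1) //; field.
  - by rewrite (_ : _ + 1 = - (- (1 + m)^-1)) //; field.
have off m c : m != 0 -> c != 1 -> (m == 1) || (m == -1) -> forall z, h z (m * z + c) = 0.
  move=> m0 c1 hm z; pose S : {set F} := [set 0; 1; -1].
  have : (2 < #|[set: F] :\: S|)%N.
    rewrite cardsD cardsT setTI.
    have : (#|S| <= 3)%N.
      by rewrite /S -setUA cardsU1 cards2; case: (_ \notin _); case: (_ != _).
    by move=> le; apply: leq_trans (leq_sub2l _ le); apply: leq_trans (leq_sub2r 3 q7).
  case/card_gt2P => m1 [m2 [m3 [[]]]]; rewrite !inE !negb_or !andbT -!andbA.
  move=> /and3P[m10 m11 m1N] /and3P[m20 m21 m2N] /and3P[m30 m31 m3N] [n12 n23 n31].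
  have nm w : w != 1 -> w != -1 -> w != m.
    by move=> w1 w2; apply: contraTneq hm => <-; rewrite negb_or w1.
  have c0 : c - 1 != 0 by rewrite subr_eq0.
  have pt w : w != 0 -> w != 1 -> w != -1 ->
      h ((c - 1) / (w - m)) (m * ((c - 1) / (w - m)) + c) = 0.
    move=> w0 w1 wN; have d : w - m != 0 by rewrite subr_eq0 nm.
    rewrite -(pencil w ((c - 1) / (w - m))) //; congr h; field; exact: d.
  have inj w w' : w != 1 -> w != -1 -> w' != 1 -> w' != -1 -> w != w' ->
      (c - 1) / (w - m) != (c - 1) / (w' - m).
    move=> w1 wN w'1 w'N; apply: contra => /eqP/(mulfI c0)/invr_inj/addIr ->.
    exact: eqxx.
  by apply: (zero3 m c _ _ _ z m0 (inj m1 m2 _ _ _ _ _) (inj m2 m3 _ _ _ _ _) (inj m3 m1 _ _ _ _ _)); auto.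
have [e|ne] := eqVneq (y - x) 1; last first.
  have := off 1 (y - x) (oner_neq0 _) ne; rewrite eqxx => /(_ isT x).
  by rewrite mul1r subrKC.
have [e'|ne'] := eqVneq (y + x) 1; last first.
  have := off (-1) (y + x); rewrite oppr_eq0 oner_neq0 eqxx orbT => /(_ isT ne' isT x).
  by rewrite mulN1r addrC addrK.
have x0 : x = 0.
  apply: (mulfI two0); rewrite mulr0 (_ : 2 * x = (y + x) - (y - x)); last by ring.
  by rewrite e e' subrr.
by move: e'; rewrite x0 addr0 => ->.
Qed.

(* Subtract the quadratic interpolating [h] on the lines [y = x] and [y = - x] and at
   the point (0, 1). *)
Lemma quadratic_of_lines (F : finFieldType) (h : F -> F -> F) :
  (7 <= #|F|)%N -> odd #|F| -> quadratic_on_lines h ->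
  exists k00 k10 k01 k20 k11 k02, forall x y,
    h x y = k00 + k10 * x + k01 * y + k20 * x ^+ 2 + k11 * (x * y) + k02 * y ^+ 2.
Proof.
move=> q7 oddF hq; have two0 := two_neq0 oddF.
have [a [b [c e1]]] := hq 1 0 (oner_neq0 _).
have N10 : (-1 : F) != 0 by rewrite oppr_eq0 oner_neq0.
have [a' [b' [c' e2]]] := hq (-1) 0 N10.
have {}e1 x : h x x = a + b * x + c * x ^+ 2 by rewrite -e1 mul1r addr0.
have {}e2 x : h x (- x) = a' + b' * x + c' * x ^+ 2 by rewrite -e2 mulN1r addr0.
have ea : a' = a.
  by have := e1 0; rewrite -{2}oppr0 e2 !expr0n /= !mulr0 !addr0.
(* The two diagonals determine the coefficients of 1, x, y and xy, but only the sum of those of x^2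
   and y^2; the value at (0, 1) separates them and yields [t]. *)
pose k01 := (b - b') / 2; pose t := h 0 1 - a - k01.
exists a, ((b + b') / 2), k01, ((c + c') / 2 - t), ((c - c') / 2), t => x y.
pose g x y := h x y - (a + (b + b') / 2 * x + k01 * y + ((c + c') / 2 - t) * x ^+ 2
  + (c - c') / 2 * (x * y) + t * y ^+ 2).
apply/eqP; rewrite -subr_eq0; apply/eqP; rewrite -/(g x y).
apply: quadratic_on_lines_zero => //.
- move=> m d m0; have [r [s [u e]]] := hq m d m0.
  exists (r - (a + k01 * d + t * d ^+ 2)).
  exists (s - ((b + b') / 2 + k01 * m + (c - c') / 2 * d + t * (2 * m * d))).
  exists (u - ((c + c') / 2 - t + (c - c') / 2 * m + t * m ^+ 2)) => z.
  by rewrite /g e; ring.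
- by move=> z; rewrite /g e1 /k01; field.
- by move=> z; rewrite /g e2 ea /k01; field.
- rewrite /g {2}/t; ring.
Qed.

(** * The quadratic surface *)

Definition quadratic_surface (F : finFieldType) (p e1 e2 e3 n : 'rV[F]_5) (al be x y : F) :=
  surface p e1 e2 e3 n (fun x y => al * x ^+ 2 + be * y ^+ 2) x y.

(** Adding multiples of [n] to [p], [e1], [e2], [e3] absorbs the terms of [h] in 1, x, y and xy. *)
Theorem surface_normal_form (F : finFieldType) q Sigma lam (D : {set 'rV[F]_5}) P :
  configuration q Sigma lam D P ->
  exists p e1 e2 e3 n al be, frame lam p e1 e2 e3 n /\
    forall a, a \in D <-> exists x y, a = quadratic_surface p e1 e2 e3 n al be x y.
Proof.
move=> cfg; have [p [e1 [e2 [e3 [n [h [[[p1 e11 e21 e31 n1] span] DE hq]]]]]]] :=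
  surface_frame cfg.
have [k00 [k10 [k01 [k20 [k11 [k02 hE]]]]]] : exists k00 k10 k01 k20 k11 k02,
    forall x y, h x y = k00 + k10 * x + k01 * y + k20 * x ^+ 2 + k11 * (x * y) + k02 * y ^+ 2.
  by apply: quadratic_of_lines => //; rewrite (cfg_card_F cfg); case: cfg.
exists (p + k00 *: n), (e1 + k10 *: n), (e2 + k01 *: n), (e3 + k11 *: n), n, k20, k02.
split; first split.
- by rewrite !dotE p1 e11 e21 e31 n1 !mulr0 !addr0.
- move=> v; have [r [s [t [u [k ->]]]]] := span v.
  exists r, s, t, u, (k - r * k00 - s * k10 - t * k01 - u * k11); row_ring.
- move=> a; rewrite DE; split=> -[x [y ->]]; exists x, y;
  rewrite /quadratic_surface /surface hE; row_ring.
Qed.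

Section QuadraticSurface.
Variables (F : finFieldType) (q : nat) (Sigma : {vspace 'rV[F]_5}).
Variables (lam : 'cV[F]_5) (D : {set 'rV[F]_5}) (P : {set {vspace 'rV[F]_5}}).
Hypothesis cfg : configuration q Sigma lam D P.
Variables (p e1 e2 e3 n : 'rV[F]_5) (al be : F).
Hypothesis fr : frame lam p e1 e2 e3 n.
Notation phi := (quadratic_surface p e1 e2 e3 n al be).
Hypothesis DE : forall a, a \in D <-> exists x y, a = phi x y.
Implicit Types (v w : 'rV[F]_5) (pi rho : {vspace 'rV[F]_5}).

Let affP := affP lam.
Let q7 : (7 <= q)%N. Proof. exact: cfg_ge7 cfg. Qed.
Let two0 : (2 : F) != 0.
Proof. by apply: two_neq0; rewrite (cfg_card_F cfg) (cfg_odd cfg). Qed.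

Definition lincomb r s t u k : 'rV[F]_5 := r *: p + s *: e1 + t *: e2 + u *: e3 + k *: n.
(** The polar form B of the quadratic map [quad], which is Q; [tang x y a b] is the derivative of
    [phi] at (x, y) along (a, b). *)
Definition bil x y a b := (x * b + y * a) *: e3 + (2 * (al * x * a + be * y * b)) *: n.
Definition quad a b := (a * b) *: e3 + (al * a ^+ 2 + be * b ^+ 2) *: n.
Definition tang x y a b := a *: e1 + b *: e2 + bil x y a b.

Lemma phiE x y : phi x y = lincomb 1 x y (x * y) (al * x ^+ 2 + be * y ^+ 2).
Proof. by rewrite /lincomb scale1r. Qed.

Lemma quadE a b : quad a b = lincomb 0 0 0 (a * b) (al * a ^+ 2 + be * b ^+ 2).
Proof. by rewrite /lincomb /quad; row_ring. Qed.

Lemma tangE x y a b :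
  tang x y a b = lincomb 0 a b (x * b + y * a) (2 * (al * x * a + be * y * b)).
Proof. by rewrite /lincomb /tang /bil; row_ring. Qed.

Lemma tangD x y a b : tang x y a b = a *: tang x y 1 0 + b *: tang x y 0 1.
Proof. by rewrite !tangE /lincomb; row_ring. Qed.

(** Exact Taylor expansion: above a line of the (x, y)-plane, C is a parabola with infinite point
    [quad a b]. *)
Lemma phi_shift x y a b t :
  phi (x + t * a) (y + t * b) = phi x y + t *: tang x y a b + t ^+ 2 *: quad a b.
Proof. by rewrite !phiE tangE quadE /lincomb; row_ring. Qed.

Lemma lincomb_inj r s t u k r' s' t' u' k' : lincomb r s t u k = lincomb r' s' t' u' k' ->
  [/\ r = r', s = s', t = t', u = u' & k = k'].
Proof. exact: (spanning5_inj fr.2). Qed.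

Lemma lincomb_eq0 r s t u k : lincomb r s t u k = 0 -> [/\ r = 0, s = 0, t = 0, u = 0 & k = 0].
Proof. by move=> e; apply: lincomb_inj; rewrite e /lincomb; row_ring. Qed.

Lemma dot_lincomb r s t u k : dot (lincomb r s t u k) lam = r.
Proof.
have [[p1 e11 e21 e31 n1] _] := fr.
by rewrite !dotE p1 e11 e21 e31 n1 !mulr0 !addr0 mulr1.
Qed.

Lemma lincomb_Sigma r s t u k : (lincomb r s t u k \in Sigma) = (r == 0).
Proof. by rewrite (cfg_SigmaE cfg) dot_lincomb. Qed.

Lemma phi_inj x y x' y' : phi x y = phi x' y' -> x = x' /\ y = y'.
Proof. by rewrite !phiE => /lincomb_inj[]. Qed.

Lemma phiD x y : phi x y \in D. Proof. by apply/DE; exists x, y. Qed.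

Lemma phi1 x y : dot (phi x y) lam = 1. Proof. by rewrite phiE dot_lincomb. Qed.

Notation nz a b := ((a != 0) || (b != 0)).

(** Otherwise the parabola degenerates to a line, and its points at t = 0, 1, 2 are three collinear
    points of C. *)
Lemma quad_neq0 a b : nz a b -> quad a b != 0.
Proof.
move=> ab; apply/eqP => q0.
have e t : phi (0 + t * a) (0 + t * b) = phi 0 0 + t *: tang 0 0 a b.
  by rewrite phi_shift q0 scaler0 addr0.
have d s t : s != t -> phi (0 + s * a) (0 + s * b) != phi (0 + t * a) (0 + t * b).
  move=> st; apply/eqP => /phi_inj[/addrI/eqP ea /addrI/eqP eb]; move: ea eb.
  rewrite -subr_eq0 -mulrBl mulf_eq0 subr_eq0 (negPf st) /= => a0.
  rewrite -subr_eq0 -mulrBl mulf_eq0 subr_eq0 (negPf st) /= => b0.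
  by rewrite a0 b0 in ab.
have n01 : (0 : F) != 1 by rewrite eq_sym oner_neq0.
have n20 := two0.
have n21 : (2 : F) != 1 by rewrite -subr_eq0 (_ : 2 - 1 = 1) ?oner_neq0 //; ring.
have := cfg_arc cfg (phiD (0 + 0 * a) (0 + 0 * b)) (phiD (0 + 1 * a) (0 + 1 * b))
  (phiD (0 + 2 * a) (0 + 2 * b)) (d _ _ n01) (d _ _ n20) (d _ _ n21).
move=> /negP[]; apply/mem_span2P; exists (-1), 2; rewrite !e; row_ring.
Qed.

(** The plane of the parabola of [phi_shift]. *)
Definition plane x y a b := (<[phi x y]> + <[tang x y a b]> + <[quad a b]>)%VS.

Lemma planeP x y a b v : reflect (exists s t u, v = lincomb s (s * x + t * a) (s * y + t * b)
    (s * (x * y) + t * (x * b + y * a) + u * (a * b))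
    (s * (al * x ^+ 2 + be * y ^+ 2) + t * (2 * (al * x * a + be * y * b)) +
     u * (al * a ^+ 2 + be * b ^+ 2))) (v \in plane x y a b).
Proof.
apply: (iffP (mem_span3P _ _ _ _)) => -[s [t [u ->]]]; exists s, t, u;
  rewrite phiE tangE quadE /lincomb; row_ring.
Qed.

Lemma plane_indep x y a b s t u : nz a b ->
  s *: phi x y + t *: tang x y a b + u *: quad a b = 0 -> [/\ s = 0, t = 0 & u = 0].
Proof.
move=> ab e; have : lincomb s (s * x + t * a) (s * y + t * b)
    (s * (x * y) + t * (x * b + y * a) + u * (a * b))
    (s * (al * x ^+ 2 + be * y ^+ 2) + t * (2 * (al * x * a + be * y * b)) +
     u * (al * a ^+ 2 + be * b ^+ 2)) = 0.
  by rewrite -[RHS]e phiE tangE quadE /lincomb; row_ring.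
case/lincomb_eq0 => s0 ea eb _ _; move: ea eb; rewrite s0 !mul0r !add0r => /eqP + /eqP.
rewrite !mulf_eq0; have [t0 _ _|t0 /= /eqP a0 /eqP b0] := eqVneq t 0; last first.
  by rewrite a0 b0 !eqxx in ab.
split=> //; apply/eqP; move/eqP: e; rewrite s0 t0 !scale0r !add0r scaler_eq0.
by rewrite (negPf (quad_neq0 ab)) orbF.
Qed.

Lemma dim_plane x y a b : nz a b -> \dim (plane x y a b) = 3%N.
Proof.
move=> ab; rewrite /plane dim_add_vline; last first.
  apply/negP => /mem_span2P[s [t e]].
  have [_ _ /eqP] := @plane_indep x y a b s t (-1) ab
    (ltac:(by rewrite e; row_ring)).
  by rewrite oppr_eq0 oner_eq0.
rewrite dim_add_vline ?dim_vline; last first.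
  apply/negP => /vlineP[k e].
  have [_ /eqP] := @plane_indep x y a b k (-1) 0 ab (ltac:(by rewrite e; row_ring)).
  by rewrite oppr_eq0 oner_eq0.
case: eqP => // e.
have [/eqP] := @plane_indep x y a b 1 0 0 ab (ltac:(by rewrite e; row_ring)).
by rewrite oner_eq0.
Qed.

Lemma phi_plane x y a b t : phi (x + t * a) (y + t * b) \in plane x y a b.
Proof. by rewrite phi_shift; apply/mem_span3P; exists 1, t, (t ^+ 2); rewrite scale1r. Qed.

Lemma phi_plane0 x y a b : phi x y \in plane x y a b.
Proof. by have := phi_plane x y a b 0; rewrite !mul0r !addr0. Qed.

(** The parabola provides q > 4 points of C in this plane, so (A1) applies. *)
Lemma plane_P x y a b : nz a b -> plane x y a b \in P.
Proof.
move=> ab; apply: (cfg_plane cfg (dim_plane x y ab)).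
pose f t := phi (x + t * a) (y + t * b).
have f_inj : injective f.
  move=> s t /phi_inj[/addrI/eqP ea /addrI/eqP eb]; apply/eqP; rewrite -subr_eq0.
  apply: contraT => st; move: ea eb.
  rewrite -subr_eq0 -mulrBl mulf_eq0 (negPf st) /= => a0.
  rewrite -subr_eq0 -mulrBl mulf_eq0 (negPf st) /= => b0.
  by rewrite a0 b0 in ab.
apply: (@leq_trans #|[set f t | t in [set: F]]|).
  by rewrite card_imset // cardsT (cfg_card_F cfg) (leq_trans _ q7).
apply: subset_leq_card; apply/subsetP => _ /imsetP[t _ ->].
by apply/blkP; split; [apply: phiD | apply: phi_plane].
Qed.

Lemma plane_D x y a b v : v \in D -> v \in plane x y a b ->
  exists t, v = phi (x + t * a) (y + t * b).
Proof.
move=> /DE[x' [y' ->]] /planeP[s [t [u e]]]; exists t.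
have [s1 ex ey _ _] := lincomb_inj (etrans (esym (phiE x' y')) e).
by rewrite ex ey -s1 !mul1r.
Qed.

(** Take (a, b) as the difference between the parameters of a second point of C in [pi] and (x, y);
    by (A2) the two points lie in only one C-plane. *)
Lemma P_plane pi x y : pi \in P -> phi x y \in pi ->
  exists a b, nz a b /\ pi = plane x y a b.
Proof.
move=> piP A; have [|v] := @card_gt_notin _ (block D pi) [set phi x y].
  by rewrite cards1 (cfg_card_block cfg piP) (leq_trans _ q7).
case/blkP=> vD vpi; rewrite inE; case/DE: (vD) => x' [y' ev] nv.
have ab : nz (x' - x) (y' - y).
  rewrite -negb_and; apply: contra nv; rewrite !subr_eq0 => /andP[/eqP ex /eqP ey].
  by rewrite ev ex ey.
exists (x' - x), (y' - y); split=> //.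
apply: (cfg_join_uniq cfg (phiD x y) vD) => //; first by rewrite eq_sym.
- exact: plane_P.
- exact: phi_plane0.
- by have := phi_plane x y (x' - x) (y' - y) 1; rewrite !mul1r !subrKC -ev.
Qed.

Lemma plane_same x y a b t c d : nz a b -> nz c d -> t != 0 -> c = t * a -> d = t * b ->
  plane x y a b = plane x y c d.
Proof.
move=> ab cd t0 ec ed.
apply: (cfg_join_uniq cfg (phiD x y) (phiD (x + t * a) (y + t * b))) => //.
- have e0 (z w : F) : z = z + w -> w = 0 by move=> e; apply: (addrI z); rewrite addr0.
  by apply/eqP => /phi_inj[/e0 c0 /e0 d0]; rewrite ec ed c0 d0 eqxx in cd.
- exact: plane_P.
- exact: plane_P.
- exact: phi_plane0.
- exact: phi_plane.
- exact: phi_plane0.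
- by have := phi_plane x y c d 1; rewrite !mul1r ec ed.
Qed.

(* If [bil a b c d = 0], the affine points of the line from [phi 0 0] in direction [quad c d]
   lie on the single plane [plane 0 0 c d]. *)
Lemma bil_nondegenerate a b c d : nz a b -> nz c d ->
  a * d + b * c = 0 -> al * a * c + be * b * d = 0 -> False.
Proof.
move=> ab cd e1' e2'.
have al0 : al != 0.
  have := @quad_neq0 1 0; rewrite oner_neq0 => /(_ isT); apply: contra => /eqP a0.
  by rewrite /quad a0; apply/eqP; row_ring.
have be0 : be != 0.
  have := @quad_neq0 0 1; rewrite oner_neq0 orbT => /(_ isT); apply: contra => /eqP a0.
  by rewrite /quad a0; apply/eqP; row_ring.
have c0 : c != 0.
  apply/eqP => c0; move: cd e1' e2'; rewrite c0 eqxx /= => d0.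
  rewrite !mulr0 addr0 add0r => /eqP; rewrite mulf_eq0 (negPf d0) orbF => /eqP a0.
  move=> /eqP; rewrite !mulf_eq0 (negPf d0) (negPf be0) orbF => /eqP b0.
  by rewrite a0 b0 eqxx in ab.
have d0 : d != 0.
  apply/eqP => d0; move: e1' e2'; rewrite d0 !mulr0 addr0 add0r.
  move=> /eqP; rewrite mulf_eq0 (negPf c0) orbF => /eqP b0.
  move=> /eqP; rewrite !mulf_eq0 (negPf c0) (negPf al0) orbF => /eqP a0.
  by rewrite a0 b0 eqxx in ab.
have b0 : b != 0.
  apply/eqP => b0; move: ab e1'; rewrite b0 eqxx orbF => a0.
  by rewrite mul0r addr0 => /eqP; rewrite mulf_eq0 (negPf a0) (negPf d0).
have eq2 : al * c ^+ 2 = be * d ^+ 2.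
  apply: (mulfI b0).
  have ea : b * c = - (a * d) by apply/eqP; rewrite -addr_eq0 addrC e1'.
  have eb : be * b * d = - (al * a * c) by apply/eqP; rewrite -addr_eq0 addrC e2'.
  transitivity (b * c * (al * c)); first by ring.
  transitivity (be * b * d * d); last by ring.
  by rewrite ea eb; ring.
pose v := phi 0 0 + quad c d.
have vE : v = lincomb 1 0 0 (c * d) (al * c ^+ 2 + be * d ^+ 2).
  by rewrite /v phiE quadE /lincomb; row_ring.
have vD : v \notin D.
  apply/negP => /DE[x [y e]]; move: (e); rewrite vE phiE => /lincomb_inj[_ ex ey _ _].
  have /negP[] := quad_neq0 (ltac:(by rewrite c0) : nz c d).
  apply/eqP; apply: (addrI (phi 0 0)); rewrite addr0 -/v e -ex -ey.
  by [].
have v1 : dot v lam = 1 by rewrite vE dot_lincomb.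
have pP : plane 0 0 c d \in P by apply: plane_P; rewrite c0.
have vp : v \in plane 0 0 c d.
  by apply/mem_span3P; exists 1, 0, 1; rewrite !scale1r scale0r addr0.
have [|pi] := @card_gt_notin _ [set pi' in P | v \in pi'] [set plane 0 0 c d].
  by rewrite cards1 (cfg_two cfg v1 vD pP vp).
rewrite !inE => /andP[piP vpi] /eqP[].
have [A /blkP[AD Api]] := blk_neq0 cfg piP; have /DE[x [y eA]] := AD; rewrite eA in Api.
have [a1 [b1 [ab1 epi]]] := P_plane piP Api.
(* The affine points of [pi] lie above a line of the (x, y)-plane. As [v] lies above (0, 0), this
   line passes through (0, 0), so [pi] also contains the point of C there. *)
have p0pi : phi 0 0 \in pi.
  have := vpi; rewrite epi => /planeP[s [t [u]]]; rewrite vE => /lincomb_inj[<- ex ey _ _].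
  by rewrite [X in phi X](_ : 0 = x + t * a1) 1?[X in phi _ X](_ : 0 = y + t * b1);
    [apply: phi_plane | rewrite ey mul1r | rewrite ex mul1r].
have [a2 [b2 [ab2 {}epi]]] := P_plane piP p0pi.
have := vpi; rewrite epi => /planeP[s [t [u]]]; rewrite vE => /lincomb_inj[<- ex ey].
have t0 : t = 0.
  move: ex ey; rewrite !mulr0 !add0r => /esym/eqP + /esym/eqP; rewrite !mulf_eq0.
  by case: eqP => // _ /= a20 b20; rewrite a20 b20 in ab2.
move=> eu0 ek0; have eu : c * d = u * (a2 * b2) by rewrite eu0 t0; ring.
have ek : al * c ^+ 2 + be * d ^+ 2 = u * (al * a2 ^+ 2 + be * b2 ^+ 2).
  by rewrite ek0 t0; ring.
have u0 : u != 0.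
  by apply/eqP => u0; move: eu; rewrite u0 mul0r => /eqP; rewrite mulf_eq0 (negPf c0) (negPf d0).
(* Since al c^2 = be d^2, the form d^2 (al a^2 + be b^2) - 2 al c d a b is al (a d - b c)^2. It
   vanishes at (c, d), hence also at ([a2], [b2]), whose [quad] is proportional to that of (c,
   d). *)
have prop : a2 * d = c * b2.
  apply/eqP; rewrite -subr_eq0; have : al * u * (a2 * d - c * b2) ^+ 2 = 0.
    transitivity (d ^+ 2 * (u * (al * a2 ^+ 2 + be * b2 ^+ 2)) - 2 * al * c * d * (u * (a2 * b2))
       + u * b2 ^+ 2 * (al * c ^+ 2 - be * d ^+ 2)); first by ring.
    rewrite -ek -eu.
    transitivity ((al * c ^+ 2 - be * d ^+ 2) * (u * b2 ^+ 2 - d ^+ 2)); first by ring.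
    by rewrite eq2 subrr mul0r.
  by move/eqP; rewrite !mulf_eq0 (negPf al0) (negPf u0) /= orbb.
have a20 : a2 != 0.
  apply/eqP => a20; move: prop ab2; rewrite a20 mul0r eqxx => /esym/eqP.
  by rewrite mulf_eq0 (negPf c0) /= => ->.
apply: (@plane_same 0 0 a2 b2 (c / a2)) => //.
- by rewrite mulf_neq0 ?invr_eq0.
- by rewrite divfK.
- by rewrite mulrAC -prop; field.
Qed.

End QuadraticSurface.

(** * Conics and tangents *)

Lemma quartic_zero (F : finFieldType) (c0 c1 c2 c3 c4 : F) : (7 <= #|F|)%N ->
  (forall t, c0 + c1 * t + c2 * t ^+ 2 + c3 * t ^+ 3 + c4 * t ^+ 4 = 0) -> c4 = 0.
Proof.
move=> q7 h; pose f := Poly [:: c0; c1; c2; c3; c4].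
have f0 : f = 0.
  apply/eqP; apply: contraT => /max_poly_roots/(_ _ (enum_uniq F)).
  have -> : all (root f) (enum F).
    apply/allP => t _; apply/eqP; apply: etrans (h t); rewrite horner_Poly /=; ring.
  move=> /(_ isT); rewrite -cardE => lt.
  by have := leq_trans q7 (leq_trans (ltnW lt) (size_Poly _)).
by have := coef_Poly [:: c0; c1; c2; c3; c4] 4; rewrite -/f f0 coef0 /=.
Qed.

Lemma is_pointP (F : finFieldType) (n : nat) (U : {vspace 'rV[F]_n}) :
  is_point U -> exists2 v, v != 0 & U = <[v]>%VS.
Proof.
move=> /eqP d1; have v0 : vpick U != 0 by rewrite vpick0 -dimv_eq0 d1.
by exists (vpick U) => //; apply: dim1_line (memv_pick _) v0.
Qed.

Lemma is_point_vline (F : finFieldType) (n : nat) (v : 'rV[F]_n) :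
  is_point <[v]>%VS = (v != 0).
Proof. by rewrite /is_point dim_vline; case: (v != 0). Qed.

Lemma vlineZ (F : fieldType) (V : vectType F) (k : F) (v : V) :
  k != 0 -> <[k *: v]>%VS = <[v]>%VS.
Proof.
move=> k0; apply/eqP; rewrite eqEsubv -!memvE memvZ ?memv_line //=.
by apply/vlineP; exists k^-1; rewrite scalerA mulVf // scale1r.
Qed.

Lemma mem_pointsP (F : finFieldType) (n : nat) (U x : {vspace 'rV[F]_n}) :
  reflect (exists v, [/\ v != 0, v \in U & x = <[v]>%VS]) (x \in points U).
Proof.
rewrite inE; apply: (iffP andP) => [[/is_pointP[v v0 ->]]|[v [v0 vU ->]]].
  by rewrite -memvE; exists v.
by rewrite is_point_vline v0 -memvE.
Qed.

Section QuadraticForms.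
Variables (F : finFieldType) (n : nat) (M : 'M[F]_n).
Implicit Types u v w : 'rV[F]_n.

Definition bform u v : F := (u *m M *m v^T) 0 0.

Lemma bformDl u v w : bform (u + v) w = bform u w + bform v w.
Proof. by rewrite /bform !mulmxDl mxE. Qed.

Lemma bformDr u v w : bform w (u + v) = bform w u + bform w v.
Proof. by rewrite /bform linearD mulmxDr mxE. Qed.

Lemma bformZl a u v : bform (a *: u) v = a * bform u v.
Proof. by rewrite /bform -!scalemxAl mxE. Qed.

Lemma bformZr a u v : bform u (a *: v) = a * bform u v.
Proof. by rewrite /bform linearZ -scalemxAr mxE. Qed.

Lemma qformZ a v : qform M (a *: v) = a ^+ 2 * qform M v.
Proof. by rewrite -[LHS]/(bform _ _) bformZl bformZr mulrA expr2. Qed.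

Lemma zeros_vline v :
  [forall w : 'rV[F]_n, (w \in <[v]>%VS) ==> (qform M w == 0)] = (qform M v == 0).
Proof.
apply/forallP/eqP => [/(_ v)|v0 w]; first by rewrite memv_line => /eqP.
by apply/implyP => /vlineP[k ->]; rewrite qformZ v0 mulr0.
Qed.

(** Along the parabola the form is a quartic in [t] with leading coefficient [qform M w]. *)
Lemma qform_parabola u v w : (7 <= #|F|)%N ->
  (forall t, qform M (u + t *: v + t ^+ 2 *: w) = 0) -> qform M w = 0.
Proof.
move=> q7 h.
apply: (@quartic_zero _ (bform u u) (bform u v + bform v u)
  (bform u w + bform v v + bform w u) (bform v w + bform w v)) => // t.
apply: etrans (h t); rewrite -[RHS]/(bform _ _) !bformDl !bformDr !bformZl !bformZr -[qform M w]/(bform w w); ring.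
Qed.

End QuadraticForms.

(* The form [y^2 - x z] whose zeros are the parabola (1, t, t^2) and its infinite point. *)
Lemma qform_parabolic (F : finFieldType) (n : nat) (c0 c1 c2 : 'cV[F]_n) v :
  qform (c1 *m c1^T - c0 *m c2^T) v = dot v c1 ^+ 2 - dot v c0 * dot v c2.
Proof.
rewrite /qform mulmxBr mulmxBl !mulmxA -!(mulmxA (v *m _)) [LHS]mxE [in X in _ + X]mxE.
rewrite !mxE !big_ord1 -!trmx_mul !mxE expr2.
by rewrite /dot !mxE.
Qed.

Section Spread.
Variables (F : finFieldType) (q : nat) (Sigma : {vspace 'rV[F]_5}).
Variables (lam : 'cV[F]_5) (D : {set 'rV[F]_5}) (P C : {set {vspace 'rV[F]_5}}).
Hypothesis cfg : configuration q Sigma lam D P.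
Hypothesis CE : C = [set <[v : 'rV[F]_5]>%VS | v in D].
Variables (p e1 e2 e3 n : 'rV[F]_5) (al be : F).
Hypothesis fr : frame lam p e1 e2 e3 n.
Hypothesis DE : forall a, a \in D <->
  exists x y, a = quadratic_surface p e1 e2 e3 n al be x y.
Implicit Types (v w : 'rV[F]_5) (pi rho l z : {vspace 'rV[F]_5}).

Notation phi := (quadratic_surface p e1 e2 e3 n al be).
Notation lc := (lincomb p e1 e2 e3 n).
Notation quad := (quad e3 n al be).
Notation tang := (tang e1 e2 e3 n al be).
Notation plane := (plane p e1 e2 e3 n al be).
Notation curve x0 y0 a b t := (phi (x0 + t * a) (y0 + t * b)).
Notation nz a b := ((a != 0) || (b != 0)).

Let affP := affP lam.
Let q7 : (7 <= #|F|)%N. Proof. by rewrite (cfg_card_F cfg) (cfg_ge7 cfg). Qed.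
Let two0 : (2 : F) != 0.
Proof. by apply: two_neq0; rewrite (cfg_card_F cfg) (cfg_odd cfg). Qed.
Let phi1 x y : dot (phi x y) lam = 1. Proof. exact: phi1. Qed.
Let phiD x y : phi x y \in D. Proof. exact: phiD. Qed.
Let dot_lincomb r s t u k : dot (lc r s t u k) lam = r. Proof. exact: dot_lincomb. Qed.

Lemma vline_aff_inj v w : dot v lam = 1 -> dot w lam = 1 -> <[v]>%VS = <[w]>%VS -> v = w.
Proof.
move=> v1 w1 e; have := memv_line v; rewrite e => /vlineP[k ev].
by move: v1; rewrite ev dotZ w1 mulr1 => ->; rewrite scale1r.
Qed.

Lemma C_D v : dot v lam = 1 -> (<[v]>%VS \in C) = (v \in D).
Proof.
move=> v1; rewrite CE; apply/imsetP/idP => [[w wD e]|vD]; last by exists v.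
by rewrite (vline_aff_inj v1 (cfg_D1 cfg wD) e).
Qed.

Lemma phi_neq0 x y : phi x y != 0.
Proof. by apply/eqP => e; have := phi1 x y; rewrite e dot0 => /esym/eqP; rewrite oner_eq0. Qed.

Lemma dot_quad a b : dot (quad a b) lam = 0. Proof. by rewrite (quadE p e1 e2) dot_lincomb. Qed.
Lemma dot_tang x y a b : dot (tang x y a b) lam = 0. Proof. by rewrite (tangE p) dot_lincomb. Qed.

Lemma quad_nC a b : <[quad a b]>%VS \notin C.
Proof.
rewrite CE; apply/imsetP => -[w wD e]; have := memv_line w; rewrite -e => /vlineP[k ew].
have := cfg_D1 cfg wD; rewrite ew dotZ dot_quad mulr0 => /esym/eqP.
by rewrite oner_eq0.
Qed.

Lemma plane_points x0 y0 a b z : nz a b -> z \in points (plane x0 y0 a b) :&: C <->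
  exists t, z = <[curve x0 y0 a b t]>%VS.
Proof.
move=> ab; split=> [|[t ->]].
  rewrite inE CE => /andP[/mem_pointsP[v [v0 vp ->]] /imsetP[w wD e]].
  have wp : w \in plane x0 y0 a b.
    by have := memv_line w; rewrite -e => /vlineP[k ->]; rewrite memvZ.
  have [t ew] := plane_D fr DE wD wp.
  by exists t; rewrite e ew.
rewrite inE C_D ?phi1 // phiD andbT; apply/mem_pointsP.
exists (phi (x0 + t * a) (y0 + t * b)); split=> //; [exact: phi_neq0 | exact: phi_plane].
Qed.

(** In the coordinates (s, t, u) along [A], [T], [Q] the points of C in the plane are (1, t, t^2).
    The conic is t^2 = s u, written with the functionals dual to this basis, and its only point with
    s = 0 is [Q]. *)
Lemma pi_infty_quad x0 y0 a b : nz a b ->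
  is_pi_infty C (plane x0 y0 a b) <[quad a b]>%VS.
Proof.
move=> ab; set pi := plane x0 y0 a b.
have ind := plane_indep (x := x0) (y := y0) cfg fr DE ab.
set T := tang x0 y0 a b; set Q := quad a b; set A := phi x0 y0.
have Q0 : Q != 0 by apply: (quad_neq0 cfg fr DE).
have Qpi : Q \in pi by apply/mem_span3P; exists 0, 0, 1; rewrite !scale0r !add0r scale1r.
apply/andP; split; first by apply/mem_pointsP; exists Q.
apply/andP; split; first by rewrite /is_plane (dim_plane cfg fr DE).
have [c0 c0A c0z] : exists2 c, dot A c = 1 & forall u, u \in (<[T]> + <[Q]>)%VS -> dot u c = 0.
  apply: separating_functional; apply/negP => /mem_span2P[s [t e]].
  have [/eqP] := ind (-1) s t (ltac:(by rewrite -/A e -/T -/Q; row_ring)).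
  by rewrite oppr_eq0 oner_eq0.
have [c1 c1T c1z] : exists2 c, dot T c = 1 & forall u, u \in (<[A]> + <[Q]>)%VS -> dot u c = 0.
  apply: separating_functional; apply/negP => /mem_span2P[s [t e]].
  have [_ /eqP] := ind s (-1) t (ltac:(by rewrite -/T e -/A -/Q; row_ring)).
  by rewrite oppr_eq0 oner_eq0.
have [c2 c2Q c2z] : exists2 c, dot Q c = 1 & forall u, u \in (<[A]> + <[T]>)%VS -> dot u c = 0.
  apply: separating_functional; apply/negP => /mem_span2P[s [t e]].
  have [_ _ /eqP] := ind s t (-1) (ltac:(by rewrite -/Q e -/A -/T; row_ring)).
  by rewrite oppr_eq0 oner_eq0.
have inl u w : u \in (<[u]> + <[w]>)%VS by rewrite (subvP (addvSl _ _)) ?memv_line.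
have inr u w : w \in (<[u]> + <[w]>)%VS by rewrite (subvP (addvSr _ _)) ?memv_line.
have cE s t u : [/\ dot (s *: A + t *: T + u *: Q) c0 = s,
   dot (s *: A + t *: T + u *: Q) c1 = t & dot (s *: A + t *: T + u *: Q) c2 = u].
  rewrite !dotD !dotZ c0A c1T c2Q (c0z T) // (c0z Q) // (c1z A) // (c1z Q) //.
  by rewrite (c2z A) // (c2z T) // !mulr0 !mulr1 !addr0 !add0r.
pose M := c1 *m c1^T - c0 *m c2^T.
have ME s t u : qform M (s *: A + t *: T + u *: Q) = t ^+ 2 - s * u.
  by rewrite qform_parabolic; have [-> -> ->] := cE s t u.
apply/existsP; exists M; apply/andP; split.
  apply/forallP => v; apply/implyP => /and3P[/mem_span3P[s [t [u ->]]] _ /forallP h].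
  have pol s' t' u' : 2 * t * t' - s * u' - s' * u = 0.
    have mem : s' *: A + t' *: T + u' *: Q \in pi by apply/mem_span3P; exists s', t', u'.
    have := h (s' *: A + t' *: T + u' *: Q); rewrite mem /= /polar -/A -/T -/Q.
    rewrite (_ : _ + _ + (s *: A + t *: T + u *: Q) =
      (s' + s) *: A + (t' + t) *: T + (u' + u) *: Q); last by row_ring.
    by rewrite !ME => /eqP e; apply: etrans e; ring.
  have s0 : s = 0.
    by have := pol 0 0 1; rewrite !mulr0 mulr1 mul0r subr0 add0r => /eqP; rewrite oppr_eq0 => /eqP.
  have u0 : u = 0.
    by have := pol 1 0 0; rewrite !mulr0 mul1r subr0 add0r => /eqP; rewrite oppr_eq0 => /eqP.
  have t0 : t = 0.
    have := pol 0 1 0; rewrite !mulr0 mul0r mulr1 !subr0 => /eqP.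
    by rewrite mulf_eq0 (negPf two0) => /eqP.
  by rewrite s0 t0 u0 !scale0r !addr0.
apply/eqP/setP => z; rewrite [RHS]inE in_setU1; apply/orP/andP => [[/eqP ->|]|].
- split; first by apply/mem_pointsP; exists Q.
  rewrite zeros_vline; have := ME 0 0 1.
  by rewrite !scale0r !add0r scale1r mul0r expr0n /= subr0 => ->.
- move=> zpC; have [t ez] := (plane_points x0 y0 z ab).1 zpC.
  split; first by move: zpC; rewrite inE => /andP[].
  rewrite ez zeros_vline phi_shift; have := ME 1 t (t ^+ 2).
  by rewrite scale1r mul1r subrr => ->.
- case=> /mem_pointsP[v [v0 /mem_span3P[s [t [u ev]]] ->]].
  rewrite zeros_vline ev ME subr_eq0 => /eqP etsu.
  have [s0|s0] := eqVneq s 0.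
    left; have t0 : t = 0.
      by move/eqP: etsu; rewrite s0 mul0r sqrf_eq0 => /eqP.
    rewrite s0 t0 !scale0r !add0r vlineZ //.
    by apply: contraNneq v0 => u0; rewrite ev s0 t0 u0 !scale0r !addr0.
  right; apply/(plane_points x0 y0 _ ab); exists (t / s).
  rewrite phi_shift -[RHS](@vlineZ _ _ s) //; congr <[_]>%VS.
  have scale (w1 w2 w3 : 'rV[F]_5) : s *: w1 + t *: w2 + u *: w3 =
      s *: (w1 + (t / s) *: w2 + (t / s) ^+ 2 *: w3).
    rewrite !scalerDr !scalerA (_ : s * (t / s) = t); last by field.
    by rewrite (_ : s * (t / s) ^+ 2 = u) // expr_div_n etsu; field.
  exact: scale.
Qed.

(** Any conic through the affine points of the parabola contains [quad a b] by [qform_parabola]; as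
    this point is not in C, it must be the added point [y]. *)
Lemma pi_infty_uniq x0 y0 a b y : nz a b -> is_pi_infty C (plane x0 y0 a b) y ->
  y = <[quad a b]>%VS.
Proof.
move=> ab /andP[yp /andP[_ /existsP[M /andP[_ /eqP e]]]].
have MD t : qform M (phi x0 y0 + t *: tang x0 y0 a b + t ^+ 2 *: quad a b) = 0.
  have : <[curve x0 y0 a b t]>%VS \in zeros_in M (plane x0 y0 a b).
    by rewrite -e in_setU1; apply/orP; right; apply/(plane_points x0 y0 _ ab); exists t.
  by rewrite inE zeros_vline phi_shift => /andP[_ /eqP].
have Q0 : quad a b != 0 by apply: (quad_neq0 cfg fr DE).
have : <[quad a b]>%VS \in zeros_in M (plane x0 y0 a b).
  rewrite inE zeros_vline (qform_parabola q7 MD) eqxx andbT; apply/mem_pointsP.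
  exists (quad a b); split=> //; apply/mem_span3P; exists 0, 0, 1.
  by rewrite !scale0r !add0r scale1r.
rewrite -e in_setU1 => /orP[/eqP <- //|]; rewrite inE => /andP[_].
by rewrite (negPf (quad_nC a b)).
Qed.

Lemma tang_neq0 x0 y0 a b : nz a b -> tang x0 y0 a b != 0.
Proof.
move=> ab; apply/eqP => T0.
have [_ /eqP] := @plane_indep _ _ _ _ _ _ cfg p e1 e2 e3 n al be fr DE x0 y0 a b 0 1 0 ab
  (ltac:(by rewrite T0; row_ring)).
by rewrite oner_eq0.
Qed.

(** The point of a tangent on [Sigma] is a combination of [T] and [Q]. It is not [Q], which is
    itself on the conic, and a nonzero [Q]-component would produce a second affine point of the
    conic on the line. *)
Lemma tangent_pointP x0 y0 a b x : nz a b ->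
  is_tangent_point Sigma C <[phi x0 y0]>%VS (plane x0 y0 a b) x =
  (x == <[tang x0 y0 a b]>%VS).
Proof.
move=> ab; set pi := plane x0 y0 a b.
have ind := plane_indep (x := x0) (y := y0) cfg fr DE ab.
set T := tang x0 y0 a b in ind *; set Q := quad a b in ind *; set A := phi x0 y0 in ind *.
have T0 : T != 0 by apply: tang_neq0.
have lT : dot T lam = 0 by apply: dot_tang.
have lQ : dot Q lam = 0 by apply: dot_quad.
have A1 : dot A lam = 1 by apply: phi1.
have cap l : \dim l = 2%N -> A \in l -> T \in l -> (l :&: Sigma)%VS = <[T]>%VS.
  move=> dl Al Tl; apply: dim1_line => //.
    have Al' : A \in aff lam l by apply/affP.
    by have := dim_cap_Sigma (cfg_dim_Sigma cfg) (cfg_SigmaE cfg) Al'; rewrite dl => -[].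
  by rewrite memv_cap Tl (cfg_SigmaE cfg) lT /=.
apply/existsP/eqP => [[y /existsP[l /and3P[ypi /and3P[/eqP dl lpi /eqP lO] /eqP ->]]]|->].
  have ey := pi_infty_uniq ab ypi.
  have Al : A \in l.
    have : <[A]>%VS \in points l :&: (y |: points pi :&: C) by rewrite lO inE.
    by rewrite inE => /andP[+ _]; rewrite inE -memvE => /andP[].
  have Al' : A \in aff lam l by apply/affP.
  have d1 := dim_cap_Sigma (cfg_dim_Sigma cfg) (cfg_SigmaE cfg) Al'.
  have {}d1 : \dim (l :&: Sigma) = 1%N by move: d1; rewrite dl => -[].
  have /is_pointP[w w0 ew] : is_point (l :&: Sigma)%VS by rewrite /is_point d1.
  have : w \in (l :&: Sigma)%VS by rewrite ew memv_line.
  rewrite memv_cap => /andP[wl wS]; have /mem_span3P[s [t [u ewE]]] := subvP lpi _ wl.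
  have s0 : s = 0.
    have dot3 (w1 w2 w3 : 'rV[F]_5) : dot (s *: w1 + t *: w2 + u *: w3) lam =
      s * dot w1 lam + t * dot w2 lam + u * dot w3 lam by rewrite !dotE.
    move: wS; rewrite (cfg_SigmaE cfg) ewE dot3 A1 lT lQ !mulr0 !addr0 mulr1.
    by move/eqP.
  have onlyA z : z \in points l -> z \in y |: points pi :&: C -> z = <[A]>%VS.
    by move=> zl zO; apply/eqP; rewrite -in_set1 -lO inE zl.
  have t0 : t != 0.
    apply/eqP => t0; rewrite s0 t0 !scale0r !add0r -/Q in ewE.
    have u0 : u != 0 by apply: contraNneq w0 => u0; rewrite ewE u0 scale0r.
    have : <[Q]>%VS = <[A]>%VS.
      apply: onlyA; last by rewrite ey in_setU1 eqxx.
      apply/mem_pointsP; exists w; split=> //; first by rewrite ewE vlineZ.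
    move=> eQA; have := memv_line A; rewrite -eQA => /vlineP[k eA].
    by move: A1; rewrite eA dotZ lQ mulr0 => /esym/eqP; rewrite oner_eq0.
  have u0 : u = 0.
    (* The line through [A] in direction t T + u Q meets the parabola A + r T + r^2 Q again where
       r^2 / r = u / t. *)
    apply/eqP; apply: contraT => u0; pose r := u / t.
    have r0 : r != 0 by rewrite mulf_neq0 ?invr_eq0.
    have phil : phi (x0 + r * a) (y0 + r * b) \in l.
      have shift (w1 w2 w3 : 'rV[F]_5) : w1 + r *: w2 + r ^+ 2 *: w3 =
          w1 + (r / t) *: (s *: w1 + t *: w2 + u *: w3).
        rewrite s0 scale0r add0r scalerDr !scalerA addrA.
        rewrite (_ : r / t * t = r); last by field.
        by rewrite (_ : r / t * u = r ^+ 2) // /r; field.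
      by rewrite phi_shift shift -ewE memvD // memvZ.
    have : <[curve x0 y0 a b r]>%VS = <[A]>%VS.
      apply: onlyA.
        by apply/mem_pointsP; exists (phi (x0 + r * a) (y0 + r * b)); rewrite phi_neq0.
      by rewrite in_setU1; apply/orP; right; apply/(plane_points x0 y0 _ ab); exists r.
    move=> /(vline_aff_inj (phi1 _ _) A1)/(phi_inj fr)[ex ey'].
    have z0 (c d : F) : c + r * d = c -> d = 0.
      move=> e; apply: (mulfI r0); apply: (addrI c); by rewrite mulr0 addr0.
    by rewrite (z0 _ _ ex) (z0 _ _ ey') eqxx in ab.
  by rewrite ew ewE s0 u0 !scale0r add0r addr0 vlineZ.
exists <[Q]>%VS; apply/existsP; exists (<[A]> + <[T]>)%VS.
have AT : A \in (<[A]> + <[T]>)%VS by rewrite (subvP (addvSl _ _)) ?memv_line.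
have TT : T \in (<[A]> + <[T]>)%VS by rewrite (subvP (addvSr _ _)) ?memv_line.
have dAT : \dim (<[A]> + <[T]>) = 2%N.
  rewrite dim_add_vline ?dim_vline ?phi_neq0 //; apply/negP => /vlineP[k eT].
  by move: lT T0; rewrite eT dotZ A1 mulr1 => ->; rewrite scale0r eqxx.
apply/and3P; split; [exact: pi_infty_quad | | by rewrite cap].
apply/and3P; split; [by rewrite /is_line dAT | exact: addvSl |].
apply/eqP/setP => z; rewrite in_set1 inE; apply/andP/eqP => [[zl]|->]; last first.
  split; first by apply/mem_pointsP; exists A; rewrite phi_neq0.
  rewrite in_setU1; apply/orP; right; apply/(plane_points x0 y0 _ ab).
  by exists 0; rewrite !mul0r !addr0.
case/mem_pointsP: zl => v [v0 /mem_span2P[s [t ev]] ->]; rewrite in_setU1 => /orP[/eqP eQ|].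
  have := memv_line Q; rewrite -eQ => /vlineP[k eQ'].
  have [_ _ /eqP] := ind (k * s) (k * t) (-1)
    (ltac:(by rewrite eQ' ev; row_ring)).
  by rewrite oppr_eq0 oner_eq0.
case/(plane_points x0 y0 _ ab) => r er; rewrite er.
have := memv_line (phi (x0 + r * a) (y0 + r * b)); rewrite -er => /vlineP[k].
rewrite phi_shift ev -/A -/T -/Q => e.
have [_ _ /eqP] := ind (1 - k * s) (r - k * t) (r ^+ 2) (ltac:(
  by rewrite -[RHS](subrr (k *: (s *: A + t *: T))) -{1}e; row_ring)).
by rewrite sqrf_eq0 => /eqP r0; rewrite -ev er r0 !mul0r !addr0.
Qed.

End Spread.

(** * The spread *)

Section Conclusion.
Variables (F : finFieldType) (q : nat) (Sigma : {vspace 'rV[F]_5}).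
Variables (lam : 'cV[F]_5) (D : {set 'rV[F]_5}) (P C : {set {vspace 'rV[F]_5}}).
Hypothesis cfg : configuration q Sigma lam D P.
Hypothesis CE : C = [set <[v : 'rV[F]_5]>%VS | v in D].
Variables (p e1 e2 e3 n : 'rV[F]_5) (al be : F).
Hypothesis fr : frame lam p e1 e2 e3 n.
Hypothesis DE : forall a, a \in D <->
  exists x y, a = quadratic_surface p e1 e2 e3 n al be x y.
Implicit Types (v w : 'rV[F]_5) (pi rho l z : {vspace 'rV[F]_5}).

Notation phi := (quadratic_surface p e1 e2 e3 n al be).
Notation lc := (lincomb p e1 e2 e3 n).
Notation quad := (quad e3 n al be).
Notation tang := (tang e1 e2 e3 n al be).
Notation plane := (plane p e1 e2 e3 n al be).
Notation nz a b := ((a != 0) || (b != 0)).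
Notation tline x y := (<[tang x y 1 0]> + <[tang x y 0 1]>)%VS.
Notation linf := (<[e3]> + <[n]>)%VS.

Let two0 : (2 : F) != 0.
Proof. by apply: two_neq0; rewrite (cfg_card_F cfg) (cfg_odd cfg). Qed.

Lemma mem_points_tline x y z : z \in points (tline x y) <->
  exists a b, nz a b /\ z = <[tang x y a b]>%VS.
Proof.
split=> [/mem_pointsP[v [v0 /mem_span2P[a [b]]]]|[a [b [ab ->]]]].
  rewrite -(tangD p) => ev ->; exists a, b; rewrite ev; split=> //.
  rewrite -negb_and; apply: contra v0 => /andP[/eqP a0 /eqP b0].
  by rewrite ev a0 b0 (tangD p) !scale0r addr0.
apply/mem_pointsP; exists (tang x y a b); split=> //.
  exact: (tang_neq0 cfg fr DE).
by apply/mem_span2P; exists a, b; rewrite -(tangD p).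
Qed.

Lemma t_atE x y : t_at Sigma C P <[phi x y]>%VS = points (tline x y).
Proof.
apply/setP => z; rewrite inE; apply/existsP/idP => [[pi /andP[]]|].
  rewrite inE -memvE => /andP[piP Api].
  have [a [b [ab ->]]] := P_plane cfg fr DE piP Api.
  rewrite (tangent_pointP cfg CE fr DE) // => /eqP ->.
  by apply/mem_points_tline; exists a, b.
move=> /mem_points_tline[a [b [ab ->]]]; exists (plane x y a b).
rewrite (tangent_pointP cfg CE fr DE) // eqxx andbT inE.
by rewrite (plane_P cfg fr DE) //= -memvE phi_plane0.
Qed.

(** The difference of the two sides is B((x, y) - (x', y'), (a, b)), to which [bil_nondegenerate]
    applies. *)
Lemma tang_inj x y x' y' a b : nz a b -> tang x y a b = tang x' y' a b ->
  x = x' /\ y = y'.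
Proof.
move=> ab; rewrite !(tangE p) => /(lincomb_inj fr)[_ _ _ eu ek].
have [/eqP|nd] := boolP ((x == x') && (y == y')).
  by move=> /eqP/andP[/eqP-> /eqP->].
have xy : nz (x - x') (y - y') by rewrite !subr_eq0 -negb_and.
exfalso; apply: (bil_nondegenerate cfg fr DE xy ab).
  by apply/eqP; rewrite !mulrBl addrACA -opprD subr_eq0 eu.
move: ek => /(mulfI two0) ek; apply/eqP.
rewrite (_ : _ + _ = al * x * a + be * y * b - (al * x' * a + be * y' * b)); last by ring.
by rewrite ek subrr.
Qed.

(** Cramer's rule for B((x, y), (s, t)) = (u, k). If [det] vanished, (s, -t) and (s, t) would be
    nonzero vectors with B = 0. *)
Lemma tang_surj s t u k : nz s t -> exists x y, tang x y s t = lc 0 s t u k.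
Proof.
move=> st; pose det := 2 * (be * t ^+ 2 - al * s ^+ 2).
have det0 : det != 0.
  apply/eqP => /eqP; rewrite mulf_eq0 (negPf two0) /= => /eqP d0.
  have sNt : nz s (- t) by rewrite oppr_eq0.
  apply: (bil_nondegenerate cfg fr DE sNt st); first by ring.
  by apply/eqP; rewrite -oppr_eq0; apply/eqP; rewrite -[RHS]d0; ring.
exists ((u * (2 * be * t) - s * k) / det), ((t * k - 2 * al * s * u) / det).
rewrite (tangE p); congr (lincomb _ _ _ _ _ _ _ _ _ _).
  by rewrite /det; field; rewrite two0 andbT; move: det0; rewrite mulf_eq0 negb_or => /andP[].
by rewrite /det; field; rewrite two0 andbT; move: det0; rewrite mulf_eq0 negb_or => /andP[].
Qed.

Lemma lincomb_linf s t u k : (lc 0 s t u k \in linf) = (s == 0) && (t == 0).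
Proof.
apply/mem_span2P/andP => [[u' [k' e]]|[/eqP -> /eqP ->]].
  have : lc 0 s t u k = lc 0 0 0 u' k' by rewrite e /lincomb; row_ring.
  by case/(lincomb_inj fr) => _ -> -> _ _; rewrite !eqxx.
by exists u, k; rewrite /lincomb; row_ring.
Qed.

Lemma linf_Sigma v : v \in linf -> v \in Sigma.
Proof.
case/mem_span2P => u [k ->]; have := lincomb_Sigma cfg fr 0 0 0 u k.
by rewrite eqxx /lincomb !scale0r !add0r.
Qed.

Lemma tang_plane x y a b : tang x y a b \in plane x y a b.
Proof. by apply/mem_span3P; exists 0, 1, 0; rewrite !scale0r add0r addr0 scale1r. Qed.

Lemma quad_linf a b : quad a b \in linf.
Proof. by rewrite (quadE p e1 e2) lincomb_linf !eqxx. Qed.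

(** Infinite points are values of [quad], hence on [linf]. A point of [Sigma] off [linf] is some
    [tang x y s t] by [tang_surj], so it lies on a C-plane and is no zero point. Conversely, a
    C-plane meets [linf] only in its own [quad a b]. *)
Lemma t_inftyE : t_infty Sigma C P = points linf.
Proof.
apply/setP => z; rewrite inE; apply/orP/idP => [[|]|zl].
- case/existsP => pi /andP[piP].
  have [A /blkP[/DE[x [y ->]] Api]] := blk_neq0 cfg piP.
  have [a [b [ab ->]]] := P_plane cfg fr DE piP Api.
  move=> /(pi_infty_uniq cfg CE fr DE ab) ->.
  apply/mem_pointsP; exists (quad a b); split=> //; first exact: (quad_neq0 cfg fr DE).
  exact: quad_linf.
- case/andP => /mem_pointsP[v [v0 vS ->]] /forallP hz.
  apply/mem_pointsP; exists v; split=> //.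
  have [r [s [t [u [k ev]]]]] := fr.2 v; rewrite -/(lc r s t u k) in ev.
  rewrite ev (lincomb_Sigma cfg fr) in vS; rewrite (eqP vS) in ev.
  rewrite ev lincomb_linf -[_ && _]negbK negb_and; apply/negP => st.
  have [x [y e]] := tang_surj u k st.
  have := hz (plane x y s t); rewrite (plane_P cfg fr DE) //= -memvE => /negP[].
  by rewrite ev -e memv_cap tang_plane e (lincomb_Sigma cfg fr) eqxx.
have /mem_pointsP[v [v0 vl ez]] := zl.
have [|none] := boolP [exists pi in P, (z <= pi :&: Sigma)%VS]; last first.
  right; apply/andP; split; first by apply/mem_pointsP; exists v; rewrite linf_Sigma.
  by rewrite -negb_exists_in.
case/existsP => pi /andP[piP]; rewrite ez -memvE memv_cap => /andP[vpi _]; left.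
apply/existsP; exists pi; rewrite piP /=.
have [A /blkP[/DE[x [y ->]] Api]] := blk_neq0 cfg piP.
have [a [b [ab epi]]] := P_plane cfg fr DE piP Api.
have [u' [k' ev]] := mem_span2P _ _ _ vl.
move: vpi; rewrite epi => vpi; have /mem_span3P[s [t [w ev']]] := vpi.
have e : lc 0 0 0 u' k' = lc s (s * x + t * a) (s * y + t * b)
    (s * (x * y) + t * (x * b + y * a) + w * (a * b))
    (s * (al * x ^+ 2 + be * y ^+ 2) + t * (2 * (al * x * a + be * y * b)) +
     w * (al * a ^+ 2 + be * b ^+ 2)).
  transitivity v; first by rewrite ev /lincomb; row_ring.
  by rewrite ev' phiE (tangE p) (quadE p e1 e2) /lincomb; row_ring.
case/(lincomb_inj fr): e => s0 ea eb _ _; rewrite -s0 !mul0r !add0r in ea eb.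
have t0 : t = 0.
  have [//|tn] := eqVneq t 0; move/esym/eqP: ea; move/esym/eqP: eb.
  by rewrite !mulf_eq0 (negPf tn) /= => b0 a0; rewrite a0 b0 in ab.
have evq : v = w *: quad a b by rewrite ev' -s0 t0 !scale0r !add0r.
have w0 : w != 0 by apply: contraNneq v0 => w0; rewrite evq w0 scale0r.
by rewrite evq vlineZ // (pi_infty_quad cfg CE fr DE).
Qed.

Lemma tline_linf_disjoint x y : [disjoint points (tline x y) & points linf].
Proof.
apply/pred0P => z /=; apply/negP => /andP[/mem_points_tline[a [b [ab ->]]]].
rewrite inE -memvE (tangE p) lincomb_linf => /andP[_ /andP[a0 b0]].
by rewrite a0 b0 in ab.
Qed.

Lemma tline_disjoint x y x' y' z : z \in points (tline x y) ->
  z \in points (tline x' y') -> x = x' /\ y = y'.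
Proof.
case/mem_points_tline => a [b [ab ->]] /mem_points_tline[a' [b' [ab' e]]].
have := memv_line (tang x y a b); rewrite e => /vlineP[k].
have -> : k *: tang x' y' a' b' = tang x' y' (k * a') (k * b').
  by rewrite !(tangE p) /lincomb; row_ring.
move=> e'; have := e'; rewrite !(tangE p) => /(lincomb_inj fr)[_ ea eb _ _].
by rewrite -ea -eb in e'; apply: tang_inj ab e'.
Qed.

Lemma dim_linf : \dim linf = 2%N.
Proof.
have u0 : e3 != 0.
  apply/eqP => e0; have : lc 0 0 0 1 0 = lc 0 0 0 0 0.
    by rewrite /lincomb e0; row_ring.
  by case/(lincomb_inj fr) => _ _ _ /eqP; rewrite oner_eq0.
rewrite dim_add_vline ?dim_vline ?u0 //; apply/negP => /vlineP[k ek].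
have : lc 0 0 0 0 1 = lc 0 0 0 k 0 by rewrite /lincomb ek; row_ring.
by case/(lincomb_inj fr) => _ _ _ _ /eqP; rewrite oner_eq0.
Qed.

Lemma dim_tline x y : \dim (tline x y) = 2%N.
Proof.
rewrite dim_add_vline ?dim_vline; last first.
  apply/negP => /vlineP[k]; rewrite !(tangE p) => ek.
  have : lc 0 0 1 (x * 1 + y * 0) (2 * (al * x * 0 + be * y * 1)) =
     lc 0 k 0 (k * (x * 0 + y * 1)) (k * (2 * (al * x * 1 + be * y * 0))).
    by rewrite ek /lincomb; row_ring.
  by case/(lincomb_inj fr) => _ _ /eqP; rewrite oner_eq0.
by rewrite (tang_neq0 cfg fr DE) // oner_neq0.
Qed.

Lemma tline_Sigma x y v : v \in tline x y -> v \in Sigma.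
Proof. by case/mem_span2P => a [b ->]; rewrite -(tangD p) (tangE p) (lincomb_Sigma cfg fr) eqxx. Qed.

Theorem spread_surface :
  spread Sigma (t_infty Sigma C P |: [set t_at Sigma C P A | A in C]).
Proof.
have TE S : S \in t_infty Sigma C P |: [set t_at Sigma C P A | A in C] ->
    S = points linf \/ exists x y, S = points (tline x y).
  rewrite in_setU1 t_inftyE => /orP[/eqP ->|/imsetP[A]]; first by left.
  rewrite CE => /imsetP[v /DE[x [y ->]] ->] ->; right.
  by exists x, y; rewrite -CE t_atE.
split.
- move=> S /TE[->|[x [y ->]]]; apply/existsP.
    exists linf; rewrite /is_line dim_linf eqxx andbT /=.
    by apply/subvP => v; apply: linf_Sigma.
  exists (tline x y); rewrite /is_line dim_tline eqxx andbT /=.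
  by apply/subvP => v; apply: tline_Sigma.
- move=> S S' /TE[->|[x [y ->]]] /TE[->|[x' [y' ->]]]; first by rewrite eqxx.
  + by move=> _; rewrite disjoint_sym tline_linf_disjoint.
  + by move=> _; rewrite tline_linf_disjoint.
  + move=> ne; apply/pred0P => z /=; apply/negP => /andP[zT zT'].
    by have [ex ey] := tline_disjoint zT zT'; rewrite ex ey eqxx in ne.
- move=> z /mem_pointsP[v [v0 vS ->]].
  have [r [s [t [u [k ev]]]]] := fr.2 v; rewrite -/(lc r s t u k) in ev.
  rewrite ev (lincomb_Sigma cfg fr) in vS; rewrite (eqP vS) in ev.
  have [st|st] := boolP (nz s t).
    have [x [y e]] := tang_surj u k st.
    exists (t_at Sigma C P <[phi x y]>%VS).
      apply/setUP; right; apply/imsetP; exists <[phi x y]>%VS => //.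
      by rewrite CE; apply/imsetP; exists (phi x y) => //; apply/DE; exists x, y.
    by rewrite t_atE; apply/mem_points_tline; exists s, t; rewrite ev e.
  exists (t_infty Sigma C P); first by rewrite in_setU1 eqxx.
  rewrite t_inftyE; apply/mem_pointsP; exists v; split=> //.
  by rewrite ev lincomb_linf; move: st; rewrite negb_or !negbK.
Qed.

End Conclusion.

(* From subspaces to normalised generators *)
Local Close Scope ring_scope.

Theorem theorem3p17 (F : finFieldType) (q : nat)
    (Sigma : {vspace 'rV[F]_5}) (C CP : {set {vspace 'rV[F]_5}})
    (card_F : #|F| = q) (q_odd : odd q) (q_ge7 : 7 <= q)
    (dim_Sigma : \dim Sigma = 4)
    (C_affine_points : forall x, x \in C -> is_point x /\ affine Sigma x)
    (card_C : #|C| = q ^ 2)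
    (CP_affine_planes : forall pi, pi \in CP -> is_plane pi /\ affine Sigma pi)
    (A1_arc : forall pi, pi \in CP -> is_arc q pi (points pi :&: C))
    (A1_plane : forall pi, is_plane pi -> 4 < #|points pi :&: C| -> pi \in CP)
    (A2 : forall x y, x \in C -> y \in C -> x != y ->
        exists! pi, [/\ pi \in CP, (x <= pi)%VS & (y <= pi)%VS])
    (A3 : forall x, is_point x -> affine Sigma x ->
        [\/ x \in C, #|planes_through CP x| = 0 | #|planes_through CP x| = 2]) :
  spread Sigma (t_infty Sigma C CP |: [set t_at Sigma C CP A | A in C]).
Proof.
have [w wS] : exists w, w \notin Sigma.
  apply/existsP; apply: contraT; rewrite negb_exists => /forallP all_in.
  have : (fullv <= Sigma)%VS by apply/subvP => v _; move: (all_in v); rewrite negbK.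
  by move/dimvS; rewrite dim_Sigma dimvf dim_matrix.
have [lam lam_w lam_Sigma] := separating_functional wS.
have SigmaE v : (v \in Sigma) = (dot v lam == 0)%R.
  apply/idP/eqP => [/lam_Sigma//|v0].
  have full : (Sigma + <[w]>)%VS = fullv.
    by apply/eqP; rewrite eqEdim subvf dimvf dim_add_vline // dim_Sigma dim_matrix.
  have : v \in (Sigma + <[w]>)%VS by rewrite full memvf.
  case/memv_addP => s sS [_ /vlineP[k ->] ev].
  move: v0; rewrite ev dotD dotZ lam_w (lam_Sigma _ sS) add0r mulr1 => ->.
  by rewrite scale0r addr0.
pose D := [set v | (dot v lam == 1)%R && (<[v : 'rV[F]_5]>%VS \in C)].
have D1 v : v \in D -> dot v lam = 1%R by rewrite inE => /andP[/eqP].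
have D_C v : v \in D -> <[v]>%VS \in C by rewrite inE => /andP[].
have aff_inj v v' : dot v lam = 1%R -> dot v' lam = 1%R -> <[v]>%VS = <[v']>%VS -> v = v'.
  exact: vline_aff_inj.
have normal x : is_point x -> affine Sigma x -> exists2 v, dot v lam = 1%R & x = <[v]>%VS.
  case/is_pointP => v v0 ->; rewrite /affine -memvE SigmaE => nl.
  exists ((dot v lam)^-1 *: v)%R; first by rewrite dotZ mulVf.
  by rewrite vlineZ // invr_eq0.
have CE : C = [set <[v : 'rV[F]_5]>%VS | v in D].
  apply/setP => x; apply/idP/imsetP => [xC|[v vD ->]]; last exact: D_C.
  have [xp xa] := C_affine_points x xC; have [v v1 ex] := normal x xp xa.
  by exists v => //; rewrite inE v1 eqxx -ex.
have card_D : #|D| = q ^ 2.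
  by rewrite -card_C CE card_in_imset // => v v' /D1 v1 /D1 v'1; apply: aff_inj.
have n0 v : dot v lam = 1%R -> (v != 0)%R.
  by move=> v1; apply/eqP => e; move: v1; rewrite e dot0 => /esym/eqP; rewrite oner_eq0.
have blockE pi : points pi :&: C = [set <[v : 'rV[F]_5]>%VS | v in block D pi].
  apply/setP => x; apply/setIP/imsetP => [[xp]|[v /blkP[vD vpi] ->]].
    rewrite {1}CE => /imsetP[v vD ex]; exists v => //; apply/blkP; split=> //.
    by move: xp; rewrite ex inE -memvE => /andP[].
  by split; [apply/mem_pointsP; exists v; rewrite n0 ?D1 | exact: D_C].
have card_blockE pi : #|points pi :&: C| = #|block D pi|.
  rewrite blockE card_in_imset // => v v' /blkP[/D1 v1 _] /blkP[/D1 v'1 _].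
  exact: aff_inj.
have join a b : a \in D -> b \in D -> a != b ->
    exists! pi, [/\ pi \in CP, a \in pi & b \in pi].
  move=> aD bD ab; have nab : <[a]>%VS != <[b]>%VS.
    by apply: contra ab => /eqP/(aff_inj _ _ (D1 _ aD) (D1 _ bD)) ->.
  have [pi [[piP api bpi] uniq]] := A2 _ _ (D_C _ aD) (D_C _ bD) nab.
  exists pi; split=> [|rho [rP ar br]]; first by rewrite !memvE.
  by apply: (uniq rho); rewrite -!memvE.
have cfg : configuration q Sigma lam D CP.
  split=> //.
  - by move=> pi /CP_affine_planes[/eqP].
  - by move=> pi /A1_arc/and3P[_ /eqP]; rewrite card_blockE.
  (* (A1) excludes collinear triples within one C-plane only; but a point [c] on the line of [a] and
     [b] lies in the C-plane joining them. *)
  - move=> a b c aD bD cD ab ca cb; apply/negP => cab.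
    have [pi [[piP api bpi] _]] := join a b aD bD ab.
    have /and3P[_ _ /forallP/(_ (<[a]> + <[b]>)%VS)] := A1_arc pi piP.
    have dl := dim_span2 (D1 _ aD) (D1 _ bD) ab.
    rewrite /is_line dl eqxx /= leqNgt => /negP[].
    have al : a \in (<[a]> + <[b]>)%VS by rewrite (subvP (addvSl _ _)) ?memv_line.
    have bl : b \in (<[a]> + <[b]>)%VS by rewrite (subvP (addvSr _ _)) ?memv_line.
    have lpi : (<[a]> + <[b]> <= pi)%VS by rewrite subv_add -!memvE api bpi.
    have inl v : v \in D -> v \in (<[a]> + <[b]>)%VS ->
        <[v]>%VS \in points pi :&: C :&: points (<[a]> + <[b]>)%VS.
      move=> vD vl; rewrite !inE D_C // is_point_vline n0 ?D1 // -!memvE vl.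
      by rewrite (subvP lpi).
    apply/card_gt2P; exists <[a]>%VS, <[b]>%VS, <[c]>%VS; split; first by rewrite !inl.
    have nl v v' : v \in D -> v' \in D -> v != v' -> <[v]>%VS != <[v']>%VS.
      by move=> vD v'D; apply: contra => /eqP/(aff_inj _ _ (D1 _ vD) (D1 _ v'D)) ->.
    by rewrite !nl // eq_sym.
  - by move=> U dU bU; apply: A1_plane; [apply/eqP | rewrite card_blockE].
  - by move=> a b aD bD ab; have [pi [h _]] := join a b aD bD ab; exists pi.
  - move=> a b pi rho aD bD ab piP rP api bpi ar br.
    have [tau [_ uniq]] := join a b aD bD ab.
    by rewrite -(uniq pi) // -(uniq rho).
  - move=> v pi v1 vD piP vpi.
    have xp : is_point <[v]>%VS by rewrite is_point_vline n0.
    have xa : affine Sigma <[v]>%VS by rewrite /affine -memvE SigmaE v1 oner_eq0.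
    have tE : planes_through CP <[v]>%VS = [set rho in CP | v \in rho].
      by apply/setP => rho; rewrite !inE -memvE.
    have [xC|c0|c2] := A3 _ xp xa.
    + by case/negP: vD; rewrite inE v1 eqxx.
    + move/eqP: c0; rewrite cards_eq0 => /eqP/setP/(_ pi).
      by rewrite tE !inE piP vpi.
    + by rewrite tE in c2.
have [p [e1 [e2 [e3 [n [al [be [fr DE]]]]]]]] := surface_normal_form cfg.
exact: (spread_surface cfg CE fr DE).
Qed.
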